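(* Let $K$ be an uncountable, compact subspace of $\mathbb{R}^n$ of topological dimension at most $1$. Then there exists a subspace $X$ of $\mathbb{C}^{n+4}$ homeomorphic to $K$ such that $\widehat{X}\setminus X\neq\emptyset$ and the uniform algebra $P(X)$ has dense invertibles.
   Context: For a compact set $X\subset\mathbb{C}^N$, the polynomial hull is $\widehat{X}=\{z\in\mathbb{C}^N: |p(z)|\le \max_{x\in X}|p(x)| \text{ for all polynomials } p\}$. $P(X)$ denotes the uniform closure on $X$ of the polynomials in the complex coordinate functions, a closed subalgebra of $C(X)$ with the supremum norm. A uniform algebra $A$ has dense invertibles if the set of invertible elements of $A$ is dense in $A$. Topological dimension means Lebesgue covering dimension. *)

(* Defs.v *)
From Stdlib Require Import Reals List.
From Stdlib Require Fin.
Open Scope R_scope.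

Record C := mkC { Cre : R; Cim : R }.
Definition Cadd (z w : C) : C := mkC (Cre z + Cre w) (Cim z + Cim w).
Definition Csub (z w : C) : C := mkC (Cre z - Cre w) (Cim z - Cim w).
Definition Cmul (z w : C) : C :=
  mkC (Cre z * Cre w - Cim z * Cim w) (Cre z * Cim w + Cim z * Cre w).
Definition C1 : C := mkC 1 0.
Definition Cabs (z : C) : R := sqrt (Cre z * Cre z + Cim z * Cim z).

Fixpoint fsum (n : nat) : (Fin.t n -> R) -> R :=
  match n return (Fin.t n -> R) -> R with
  | O => fun _ => 0
  | S m => fun f => f Fin.F1 + fsum m (fun i => f (Fin.FS i))
  end.

Definition Rn (n : nat) : Type := Fin.t n -> R.
Definition Cn (N : nat) : Type := Fin.t N -> C.

Definition dist_Rn (n : nat) (x y : Rn n) : R :=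
  sqrt (fsum n (fun i => (x i - y i) * (x i - y i))).
Definition dist_Cn (N : nat) (z w : Cn N) : R :=
  sqrt (fsum N (fun i => Cabs (Csub (z i) (w i)) * Cabs (Csub (z i) (w i)))).

Section Metric.
Context {T : Type} (d : T -> T -> R).

Definition rel_open (K U : T -> Prop) : Prop :=
  forall x, K x -> U x -> exists eps, 0 < eps /\
    forall y, K y -> d x y < eps -> U y.

Definition compact_set (K : T -> Prop) : Prop :=
  forall (I : Type) (U : I -> T -> Prop),
    (forall i, rel_open K (U i)) ->
    (forall x, K x -> exists i, U i x) ->
    exists l : list I, forall x, K x -> exists i, In i l /\ U i x.

Definition covering_dim_le1 (K : T -> Prop) : Prop :=
  forall Us : list (T -> Prop),
    (forall U, In U Us -> rel_open K U) ->
    (forall x, K x -> exists U, In U Us /\ U x) ->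
    exists Vs : list (T -> Prop),
      (forall V, In V Vs -> rel_open K V) /\
      (forall x, K x -> exists V, In V Vs /\ V x) /\
      (forall V, In V Vs -> exists U, In U Us /\ forall x, K x -> V x -> U x) /\
      (forall x, K x -> forall j1 j2 j3 : nat,
          (j1 < j2)%nat -> (j2 < j3)%nat -> (j3 < length Vs)%nat ->
          ~ (nth j1 Vs (fun _ => False) x /\ nth j2 Vs (fun _ => False) x /\
             nth j3 Vs (fun _ => False) x)).

End Metric.

Definition uncountable {T : Type} (K : T -> Prop) : Prop :=
  ~ exists f : nat -> T, forall x, K x -> exists k, f k = x.

Definition continuous_on {T1 T2 : Type} (d1 : T1 -> T1 -> R) (d2 : T2 -> T2 -> R)
  (K : T1 -> Prop) (f : T1 -> T2) : Prop :=
  forall x, K x -> forall eps, 0 < eps -> exists delta, 0 < delta /\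
    forall y, K y -> d1 x y < delta -> d2 (f x) (f y) < eps.

Definition homeomorphic {T1 T2 : Type} (d1 : T1 -> T1 -> R) (d2 : T2 -> T2 -> R)
  (K : T1 -> Prop) (X : T2 -> Prop) : Prop :=
  exists (f : T1 -> T2) (g : T2 -> T1),
    (forall x, K x -> X (f x)) /\ (forall y, X y -> K (g y)) /\
    (forall x, K x -> g (f x) = x) /\ (forall y, X y -> f (g y) = y) /\
    continuous_on d1 d2 K f /\ continuous_on d2 d1 X g.

Inductive poly (N : nat) : Type :=
| PConst : C -> poly N
| PVar : Fin.t N -> poly N
| PAdd : poly N -> poly N -> poly N
| PMul : poly N -> poly N -> poly N.
Arguments PConst {N}. Arguments PVar {N}. Arguments PAdd {N}. Arguments PMul {N}.

Fixpoint peval {N : nat} (p : poly N) (z : Cn N) : C :=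
  match p with
  | PConst c => c
  | PVar i => z i
  | PAdd p q => Cadd (peval p z) (peval q z)
  | PMul p q => Cmul (peval p z) (peval q z)
  end.

(** * Polynomial hull: |p(z)| <= max_X |p| for every polynomial p
    (stated as: |p(z)| is below every upper bound of |p| on X). *)
Definition poly_hull {N : nat} (X : Cn N -> Prop) (z : Cn N) : Prop :=
  forall (p : poly N) (M : R),
    (forall x, X x -> Cabs (peval p x) <= M) -> Cabs (peval p z) <= M.

Definition in_PX {N : nat} (X : Cn N -> Prop) (f : Cn N -> C) : Prop :=
  forall eps, 0 < eps -> exists p : poly N,
    forall x, X x -> Cabs (Csub (f x) (peval p x)) <= eps.

Definition invertible_PX {N : nat} (X : Cn N -> Prop) (f : Cn N -> C) : Prop :=
  exists h, in_PX X h /\ forall x, X x -> Cmul (f x) (h x) = C1.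

Definition PX_dense_invertibles {N : nat} (X : Cn N -> Prop) : Prop :=
  forall f, in_PX X f -> forall eps, 0 < eps ->
    exists g, in_PX X g /\ invertible_PX X g /\
      forall x, X x -> Cabs (Csub (f x) (g x)) <= eps.

(* Main.v *)
From Stdlib Require Import Reals List.
From Stdlib Require Import Lra Lia Psatz Field ZArith.
From Stdlib Require Import Classical ClassicalEpsilon FunctionalExtensionality.
From Stdlib Require Fin Cantor.
Require Import Defs.
Open Scope R_scope.

(** Let [u_j] be seven squared distances to points of C^3 of norm 2 which together determine a point,
    and let [J] be the set of points of the unit ball at which every [u_j] avoids a rapidly shrinking
    sequence of families of gaps; [J] is compact and totally disconnected, and misses 0.  A strictly
    plurisubharmonic function has no local maximum on a fibre of two polynomials on C^3, so by a small
    move along the fibre one can always increase [u_j] enough to leave a gap: hence [J] meets every such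
    fibre through 0 (up to arbitrarily small error).  Consequently, if [q(0) = 1], then 0 lies in the
    polynomial hull of [J] cut by [Re q >= 1/2].  Let the [p_k] with [p_k(0) = 1] run through a dense
    family of polynomials, up to scalars, and put [q_{k+1} = p_k (1 + (q_k - 1)/c)^M] with [c] and
    [M] large; the half-plane conditions are then nested, and on their intersection [X] each [p_k] is
    invertible in [P(X)] because [q_{k+1}] is.

    Now [X] is homeomorphic to a closed [E] contained in [K]; extend the homeomorphism to [F] on [K],
    let [rho] be the distance to [E], and embed [K] by [x |-> (rho x, rho, F)].  By Stone-Weierstrass a
    continuous function belongs to the resulting algebra as soon as its restriction to [E] is in [P(X)],
    and zeros off [E] are perturbed away because [K] has dimension at most one. *)

(** * Complex numbers *)

(** Why three variables: the walk must nearly preserve two polynomials at once, q to respect the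
    half-plane condition and f because the hull is tested against f; two equations in C^3 leave a
    curve on which to climb. No analytic variety is used: second order Taylor expansion gives a
    direction in which both polynomials change far less than the strictly plurisubharmonic function
    gains. How the constants fit: a move of length r raises u_j by at least r^2/2, enough to pass
    from inside a gap of radius r^2/4 to above it, and by at most 8r, too little to reach the next
    gap, 16r further on. All later moves have total length at most 2r' with r' = r^2/128 and change
    u_j by at most 16r' = r^2/8, so a gap of radius r^2/8 survives in the limit. Only polynomials
    nonzero at 0 are made invertible, as is unavoidable when 0 lies in the hull; they suffice, since
    any polynomial becomes nonzero at 0 after a small shift. The n + 4 coordinates are n for rho x,
    one for rho and three for F. *)

Definition C0 : C := mkC 0 0.
Definition Copp (z : C) : C := mkC (- Cre z) (- Cim z).
Definition Cn2 (z : C) : R := Cre z * Cre z + Cim z * Cim z.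
Definition Cconj (z : C) : C := mkC (Cre z) (- Cim z).
Definition Cinv (z : C) : C := mkC (Cre z / Cn2 z) (- Cim z / Cn2 z).
Definition Cdiv (z w : C) : C := Cmul z (Cinv w).
Definition RtoC (x : R) : C := mkC x 0.

Lemma C_ext (z w : C) : Cre z = Cre w -> Cim z = Cim w -> z = w.
Proof. destruct z, w; simpl; intros; subst; reflexivity. Qed.

Lemma Cn2_ge0 z : 0 <= Cn2 z.
Proof. unfold Cn2; nra. Qed.

Lemma Cn2_neq0 z : z <> C0 -> 0 < Cn2 z.
Proof.
  intros H. destruct (Rle_lt_or_eq_dec _ _ (Cn2_ge0 z)) as [|E]; auto.
  exfalso; apply H; apply C_ext; simpl; unfold Cn2 in E; nra.
Qed.

Lemma C_ring_theory : ring_theory C0 C1 Cadd Cmul Csub Copp eq.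
Proof.
  constructor; intros; apply C_ext; simpl; ring.
Qed.

Lemma C_field_theory : field_theory C0 C1 Cadd Cmul Csub Copp Cdiv Cinv eq.
Proof.
  constructor.
  - apply C_ring_theory.
  - intros H; apply (f_equal Cre) in H; simpl in H; lra.
  - reflexivity.
  - intros z Hz; apply Cn2_neq0 in Hz; apply C_ext; unfold Cinv, Cn2 in *; simpl; field; lra.
Qed.

Add Field C_field : C_field_theory.

Declare Scope Cx_scope.
Delimit Scope Cx_scope with Cx.
Bind Scope Cx_scope with C.
Notation "x + y" := (Cadd x y) : Cx_scope.
Notation "x - y" := (Csub x y) : Cx_scope.
Notation "x * y" := (Cmul x y) : Cx_scope.
Notation "- x" := (Copp x) : Cx_scope.
Notation "x / y" := (Cdiv x y) : Cx_scope.

Lemma Cabs_sqr z : Cabs z * Cabs z = Cn2 z.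
Proof. unfold Cabs; apply sqrt_sqrt; apply Cn2_ge0. Qed.

Lemma Cabs_ge0 z : 0 <= Cabs z.
Proof. apply sqrt_pos. Qed.

Lemma Rsqr_le_intro (a b : R) : 0 <= b -> a * a <= b * b -> a <= b.
Proof. intros; nra. Qed.

Lemma Rsqr_eq_intro (a b : R) : 0 <= a -> 0 <= b -> a * a = b * b -> a = b.
Proof. intros; nra. Qed.

Lemma Cabs_mul z w : Cabs (Cmul z w) = Cabs z * Cabs w.
Proof.
  apply Rsqr_eq_intro.
  - apply Cabs_ge0.
  - apply Rmult_le_pos; apply Cabs_ge0.
  - replace (Cabs z * Cabs w * (Cabs z * Cabs w)) with
      ((Cabs z * Cabs z) * (Cabs w * Cabs w)) by ring.
    rewrite !Cabs_sqr; unfold Cn2; simpl; ring.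
Qed.

Lemma Cabs_add z w : Cabs (Cadd z w) <= Cabs z + Cabs w.
Proof.
  apply Rsqr_le_intro.
  - pose proof (Cabs_ge0 z); pose proof (Cabs_ge0 w); lra.
  - rewrite Cabs_sqr.
    assert (Cre z * Cre w + Cim z * Cim w <= Cabs z * Cabs w).
    { apply Rsqr_le_intro.
      - apply Rmult_le_pos; apply Cabs_ge0.
      - replace (Cabs z * Cabs w * (Cabs z * Cabs w)) with
          ((Cabs z * Cabs z) * (Cabs w * Cabs w)) by ring.
        rewrite !Cabs_sqr; unfold Cn2.
        pose proof (Rle_0_sqr (Cre z * Cim w - Cim z * Cre w)); unfold Rsqr in *; nra. }
    pose proof (Cabs_sqr z) as Hz; pose proof (Cabs_sqr w) as Hw; unfold Cn2 in *; simpl; nra.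
Qed.

Lemma Cabs_opp z : Cabs (Copp z) = Cabs z.
Proof. unfold Cabs; f_equal; simpl; ring. Qed.

Lemma Cabs_sub_sym z w : Cabs (Csub z w) = Cabs (Csub w z).
Proof. rewrite <- Cabs_opp; f_equal; ring. Qed.

Lemma Cabs_C0 : Cabs C0 = 0.
Proof. unfold Cabs; simpl; replace (0*0+0*0) with 0 by ring; apply sqrt_0. Qed.

Lemma Cabs_C1 : Cabs C1 = 1.
Proof. unfold Cabs; simpl; replace (1*1+0*0) with 1 by ring; apply sqrt_1. Qed.

Lemma Cabs_RtoC x : Cabs (RtoC x) = Rabs x.
Proof. unfold Cabs; simpl; replace (x*x+0*0) with (Rsqr x) by (unfold Rsqr; ring); apply sqrt_Rsqr_abs. Qed.

Lemma Cabs_eq0 z : Cabs z = 0 -> z = C0.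
Proof.
  intros H. pose proof (Cabs_sqr z) as E; rewrite H in E; unfold Cn2 in E.
  apply C_ext; simpl; nra.
Qed.

Lemma Cabs_pos z : z <> C0 -> 0 < Cabs z.
Proof.
  intros H. destruct (Rle_lt_or_eq_dec _ _ (Cabs_ge0 z)) as [|E]; auto.
  exfalso; apply H, Cabs_eq0; auto.
Qed.

Lemma Cabs_triang x y z : Cabs (Csub x z) <= Cabs (Csub x y) + Cabs (Csub y z).
Proof. replace (Csub x z) with (Cadd (Csub x y) (Csub y z)) by ring. apply Cabs_add. Qed.

Lemma Cabs_sub_le z w : Cabs z - Cabs w <= Cabs (Csub z w).
Proof.
  pose proof (Cabs_add (Csub z w) w) as H.
  replace (Csub z w + w)%Cx with z in H by ring. lra.
Qed.

Lemma Cabs_inv z : z <> C0 -> Cabs (Cinv z) = / Cabs z.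
Proof.
  intros H. pose proof (Cabs_pos z H).
  assert (E : Cabs z * Cabs (Cinv z) = 1).
  { rewrite <- Cabs_mul. replace (z * Cinv z)%Cx with C1 by (field; auto). apply Cabs_C1. }
  apply Rmult_eq_reg_l with (Cabs z); [|lra]. rewrite E; field; lra.
Qed.

Lemma Rabs_Cre z : Rabs (Cre z) <= Cabs z.
Proof.
  pose proof (Cabs_ge0 z); pose proof (Cabs_sqr z) as E; unfold Cn2 in E.
  apply Rabs_le; split; nra.
Qed.

Lemma Rabs_Cim z : Rabs (Cim z) <= Cabs z.
Proof.
  pose proof (Cabs_ge0 z); pose proof (Cabs_sqr z) as E; unfold Cn2 in E.
  apply Rabs_le; split; nra.
Qed.

Lemma Cabs_le_re_im z : Cabs z <= Rabs (Cre z) + Rabs (Cim z).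
Proof.
  apply Rsqr_le_intro; [pose proof (Rabs_pos (Cre z)); pose proof (Rabs_pos (Cim z)); lra|].
  rewrite Cabs_sqr; unfold Cn2.
  pose proof (Rabs_pos (Cre z)); pose proof (Rabs_pos (Cim z)).
  assert (Cre z * Cre z = Rabs (Cre z) * Rabs (Cre z)) as -> by (rewrite <- Rabs_mult; rewrite Rabs_right; nra).
  assert (Cim z * Cim z = Rabs (Cim z) * Rabs (Cim z)) as -> by (rewrite <- Rabs_mult; rewrite Rabs_right; nra).
  nra.
Qed.

Lemma Cmul_eq0 z w : Cmul z w = C0 -> z = C0 \/ w = C0.
Proof.
  intros H. apply (f_equal Cabs) in H. rewrite Cabs_mul, Cabs_C0 in H.
  apply Rmult_integral in H. destruct H; [left|right]; apply Cabs_eq0; auto.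
Qed.

Lemma Cmul_neq0 z w : z <> C0 -> w <> C0 -> Cmul z w <> C0.
Proof. intros Hz Hw H; apply Cmul_eq0 in H; tauto. Qed.

Lemma C1_neq0 : C1 <> C0.
Proof. intros H; apply (f_equal Cre) in H; simpl in H; lra. Qed.

Lemma Csqrt_exists (z : C) : exists w, Cmul w w = z.
Proof.
  destruct z as [a b].
  set (m := sqrt (a*a+b*b)).
  assert (Hm : m * m = a*a+b*b) by (apply sqrt_sqrt; nra).
  assert (Hm0 : 0 <= m) by apply sqrt_pos.
  assert (Hma : - m <= a <= m) by (split; nra).
  set (p := sqrt ((m + a)/2)). set (q := sqrt ((m-a)/2)).
  assert (Hp : p * p = (m+a)/2) by (apply sqrt_sqrt; lra).
  assert (Hq : q * q = (m-a)/2) by (apply sqrt_sqrt; lra).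
  assert (0 <= p) by apply sqrt_pos. assert (0 <= q) by apply sqrt_pos.
  assert (Hpq : (2*p*q)*(2*p*q) = b * b).
  { replace ((2*p*q)*(2*p*q)) with (4*(p*p)*(q*q)) by ring. rewrite Hp, Hq. nra. }
  destruct (Rle_lt_dec 0 b).
  - exists (mkC p q). unfold Cmul; simpl. f_equal; [lra|].
    assert (2*p*q = b) by (apply Rsqr_eq_intro; nra). lra.
  - exists (mkC p (-q)). unfold Cmul; simpl. f_equal; [lra|].
    assert (2*p*q = -b) by (apply Rsqr_eq_intro; nra). lra.
Qed.

(** An isotropic vector for a quadratic form on a plane. It settles the degenerate case of the
    ascent, where the derivatives of both polynomials are parallel to that of the function being
    raised. *)
Lemma binary_form_zero (a b c : C) :
  exists s t, (s <> C0 \/ t <> C0) /\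
    (a * (s * s) + b * (s * t) + c * (t * t))%Cx = C0.
Proof.
  destruct (classic (a = C0)) as [->|Ha].
  - exists C1, C0. split; [left; apply C1_neq0 | ring].
  - destruct (Csqrt_exists (b * b - (C1+C1+C1+C1) * a * c)%Cx) as [d Hd].
    assert (H2 : (C1 + C1)%Cx <> C0) by (intros H; apply (f_equal Cre) in H; simpl in H; lra).
    exists ((d - b) / ((C1 + C1) * a))%Cx, C1.
    split; [right; apply C1_neq0|].
    assert (H4 : (C1 + C1 + C1 + C1)%Cx <> C0) by (intros H; apply (f_equal Cre) in H; simpl in H; lra).
    transitivity ((d*d - (b * b - (C1+C1+C1+C1) * a * c)) / ((C1+C1+C1+C1) * a))%Cx.
    + field; repeat split; auto; intros H; apply (f_equal Cre) in H; simpl in H; lra.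
    + rewrite Hd; field; repeat split; auto; intros H; apply (f_equal Cre) in H; simpl in H; lra.
Qed.

Fixpoint Cpow (z : C) (n : nat) : C := match n with O => C1 | S m => Cmul z (Cpow z m) end.

Lemma Cabs_Cpow z n : Cabs (Cpow z n) = Cabs z ^ n.
Proof. induction n; simpl; [apply Cabs_C1|]. rewrite Cabs_mul, IHn; reflexivity. Qed.

Lemma pow_small (x e : R) : 0 <= x < 1 -> 0 < e -> exists m : nat, x ^ m < e.
Proof.
  intros Hx He.
  destruct (pow_lt_1_zero x) with (y := e) as [N HN]; auto.
  - rewrite Rabs_right; lra.
  - exists N. specialize (HN N (le_n _)). rewrite Rabs_right in HN; auto.
    apply Rle_ge, pow_le; lra.
Qed.

Lemma Rabs_le_inv a b : Rabs a <= b -> - b <= a <= b.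
Proof. intros H; unfold Rabs in H; destruct (Rcase_abs a); lra. Qed.

(** * Metric spaces and compactness *)

Record is_metric {T : Type} (d : T -> T -> R) : Prop := {
  met_ge0 : forall x y, 0 <= d x y;
  met_refl : forall x, d x x = 0;
  met_eq : forall x y, d x y = 0 -> x = y;
  met_sym : forall x y, d x y = d y x;
  met_tri : forall x y z, d x z <= d x y + d y z }.

Definition nrm (n : nat) (a : Fin.t n -> R) : R := sqrt (fsum n (fun i => a i * a i)).

Lemma fsum_sqr_ge0 n (a : Fin.t n -> R) : 0 <= fsum n (fun i => a i * a i).
Proof. induction n; simpl; [lra|]. specialize (IHn (fun i => a (Fin.FS i))). nra. Qed.

Lemma nrm_sqr n a : nrm n a * nrm n a = fsum n (fun i => a i * a i).
Proof. apply sqrt_sqrt, fsum_sqr_ge0. Qed.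

Lemma nrm_ge0 n a : 0 <= nrm n a.
Proof. apply sqrt_pos. Qed.

(** Peeling off one coordinate as the real part of a complex number reduces the triangle inequality
    for [nrm], by induction, to that for [Cabs]. *)
Lemma nrm_S n (a : Fin.t (S n) -> R) :
  nrm (S n) a = Cabs (mkC (a Fin.F1) (nrm n (fun i => a (Fin.FS i)))).
Proof. unfold Cabs; simpl. rewrite nrm_sqr. reflexivity. Qed.

Lemma Cabs_mono a b c : 0 <= b <= c -> Cabs (mkC a b) <= Cabs (mkC a c).
Proof. intros; unfold Cabs; simpl; apply sqrt_le_1_alt; nra. Qed.

Lemma nrm_0 (a : Fin.t 0 -> R) : nrm 0 a = 0.
Proof. unfold nrm; simpl; apply sqrt_0. Qed.

Lemma nrm_add n (a b : Fin.t n -> R) : nrm n (fun i => a i + b i) <= nrm n a + nrm n b.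
Proof.
  induction n.
  - rewrite !nrm_0; lra.
  - rewrite !nrm_S.
    eapply Rle_trans; [apply Cabs_mono; split; [apply nrm_ge0|]; apply (IHn (fun i => a (Fin.FS i)) (fun i => b (Fin.FS i)))|].
    apply (Cabs_add (mkC (a Fin.F1) _) (mkC (b Fin.F1) _)).
Qed.

Lemma nrm_le n (a b : Fin.t n -> R) : (forall i, Rabs (a i) <= b i) -> nrm n a <= nrm n b.
Proof.
  intros H. unfold nrm; apply sqrt_le_1_alt. revert a b H.
  induction n; intros a b H; simpl; [lra|].
  specialize (IHn (fun i => a (Fin.FS i)) (fun i => b (Fin.FS i)) (fun i => H (Fin.FS i))).
  specialize (H Fin.F1). apply Rabs_le_inv in H. simpl in IHn. nra.
Qed.

Lemma nrm_coord n (a : Fin.t n -> R) i : Rabs (a i) <= nrm n a.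
Proof.
  induction i as [n|n i IH]; rewrite nrm_S.
  - apply (Rabs_Cre (mkC _ _)).
  - eapply Rle_trans; [apply (IH (fun i => a (Fin.FS i)))|].
    rewrite <- (Rabs_right (nrm n _)) at 1; [|apply Rle_ge, nrm_ge0].
    apply (Rabs_Cim (mkC _ _)).
Qed.

Lemma nrm_small n (a : Fin.t n -> R) e :
  0 <= e -> (forall i, Rabs (a i) <= e) -> nrm n a <= INR n * e.
Proof.
  intros He. induction n; intros H.
  - rewrite nrm_0. simpl; lra.
  - rewrite nrm_S. eapply Rle_trans; [apply Cabs_le_re_im|]. simpl Cre; simpl Cim.
    rewrite (Rabs_right (nrm _ _)); [|apply Rle_ge, nrm_ge0].
    specialize (IHn (fun i => a (Fin.FS i)) (fun i => H (Fin.FS i))).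
    specialize (H Fin.F1). rewrite S_INR. lra.
Qed.

Lemma nrm_eq0 n (a : Fin.t n -> R) : nrm n a = 0 -> forall i, a i = 0.
Proof.
  intros H i. pose proof (nrm_coord n a i) as Hi. rewrite H in Hi.
  apply Rabs_le_inv in Hi; lra.
Qed.

Lemma nrm_ext n (a b : Fin.t n -> R) : (forall i, a i = b i) -> nrm n a = nrm n b.
Proof. intros H; f_equal; apply functional_extensionality; auto. Qed.

Lemma nrm_opp n (a : Fin.t n -> R) : nrm n (fun i => - a i) = nrm n a.
Proof. unfold nrm; do 2 f_equal; apply functional_extensionality; intros; ring. Qed.

Lemma nrm_zero n : nrm n (fun _ => 0) = 0.
Proof.
  apply Rle_antisym; [|apply nrm_ge0].
  eapply Rle_trans; [apply nrm_small with (e := 0); [lra|intros; rewrite Rabs_R0; lra]|lra].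
Qed.

Lemma dist_Rn_nrm n (x y : Rn n) : dist_Rn n x y = nrm n (fun i => x i - y i).
Proof. reflexivity. Qed.

Lemma dist_Cn_nrm n (x y : Cn n) : dist_Cn n x y = nrm n (fun i => Cabs (Csub (x i) (y i))).
Proof. reflexivity. Qed.

Lemma dist_Rn_metric n : is_metric (dist_Rn n).
Proof.
  split; intros; rewrite ?dist_Rn_nrm in *.
  - apply nrm_ge0.
  - rewrite <- (nrm_zero n); apply nrm_ext; intros; ring.
  - apply functional_extensionality; intros i; pose proof (nrm_eq0 _ _ H i); simpl in *; lra.
  - rewrite <- nrm_opp; apply nrm_ext; intros; ring.
  - eapply Rle_trans; [|apply nrm_add]. right; apply nrm_ext; intros; ring.
Qed.

Lemma dist_Cn_metric n : is_metric (dist_Cn n).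
Proof.
  split; intros; rewrite ?dist_Cn_nrm in *.
  - apply nrm_ge0.
  - rewrite <- (nrm_zero n); apply nrm_ext; intros.
    rewrite <- Cabs_C0; f_equal; ring.
  - apply functional_extensionality; intros i; pose proof (nrm_eq0 _ _ H i) as E; simpl in E.
    apply Cabs_eq0 in E. replace (x i) with (x i - y i + y i)%Cx by ring. rewrite E; ring.
  - apply nrm_ext; intros; apply Cabs_sub_sym.
  - eapply Rle_trans; [|apply nrm_add]. apply nrm_le; intros.
    rewrite Rabs_right; [|apply Rle_ge, Cabs_ge0]. apply Cabs_triang.
Qed.

Lemma dist_Cn_coord n (x y : Cn n) i : Cabs (Csub (x i) (y i)) <= dist_Cn n x y.
Proof.
  rewrite dist_Cn_nrm. eapply Rle_trans; [apply Rle_abs|].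
  apply (nrm_coord n (fun i => Cabs (Csub (x i) (y i)))).
Qed.

Lemma dist_Rn_coord n (x y : Rn n) i : Rabs (x i - y i) <= dist_Rn n x y.
Proof. apply (nrm_coord n (fun i => x i - y i)). Qed.

(** * Sequential compactness and continuity along sequences *)

Section Compactness.
Context {T : Type} (d : T -> T -> R) (Hd : is_metric d).

Definition cluster (x : nat -> T) (l : T) : Prop :=
  forall eps, 0 < eps -> forall N, exists n, (N <= n)%nat /\ d l (x n) < eps.

(** Sequential form of compactness; it passes to continuous images and to subsets closed under
    limits. Open covers are used only for the given [K]. *)
Definition cluster_compact (K : T -> Prop) : Prop :=
  forall x : nat -> T, (forall n, K (x n)) -> exists l, K l /\ cluster x l.

Lemma compact_cluster K : compact_set d K -> cluster_compact K.
Proof.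
  intros HK x Hx. apply NNPP; intros Hno.
  (* The index is (centre, radius, N), and its ball counts only if the sequence avoids it from [N]
     on. A finite subcover would leave no room for a late term. *)
  destruct (HK (T * R * nat)%type
     (fun i y => d (fst (fst i)) y < snd (fst i) /\
        forall n, (snd i <= n)%nat -> snd (fst i) <= d (fst (fst i)) (x n))) as [l Hl].
  - intros [[c e] N] y Ky [Hy HN]; simpl in *.
    exists (e - d c y). split; [lra|]. intros z Kz Hz. split; auto.
    pose proof (met_tri d Hd c y z); lra.
  - intros y Ky.
    assert (Hc : ~ cluster x y) by (intros Hc; apply Hno; exists y; auto).
    apply not_all_ex_not in Hc; destruct Hc as [e Hc].
    apply imply_to_and in Hc; destruct Hc as [He Hc].
    apply not_all_ex_not in Hc; destruct Hc as [N HN].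
    exists (y, e, N); simpl. rewrite (met_refl d Hd). split; auto.
    intros n Hn. apply Rnot_lt_le; intros Hlt; apply HN; exists n; auto.
  - assert (HM : exists M, forall i, In i l -> (snd i <= M)%nat).
    { clear. induction l as [|a l [M HM]].
      - exists O; intros i [].
      - exists (max (snd a) M). intros i [->|H]; [lia|]. specialize (HM i H); lia. }
    destruct HM as [M HM].
    destruct (Hl (x M) (Hx M)) as [i [Hi [H1 H2]]].
    specialize (H2 M (HM i Hi)). lra.
Qed.

Definition mcv (x : nat -> T) (l : T) : Prop := Un_cv (fun n => d l (x n)) 0.

Lemma mcv_intro x l : (forall eps, 0 < eps -> exists N, forall n, (N <= n)%nat -> d l (x n) < eps) -> mcv x l.
Proof.
  intros H e He. destruct (H e He) as [N HN]. exists N. intros n Hn.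
  unfold Rdist. rewrite Rminus_0_r, Rabs_right; [auto|]. apply Rle_ge, (met_ge0 d Hd).
Qed.

Lemma mcv_elim x l : mcv x l -> forall eps, 0 < eps -> exists N, forall n, (N <= n)%nat -> d l (x n) < eps.
Proof.
  intros H e He. destruct (H e He) as [N HN]. exists N. intros n Hn.
  specialize (HN n Hn). unfold Rdist in HN. rewrite Rminus_0_r in HN.
  eapply Rle_lt_trans; [apply Rle_abs|auto].
Qed.

Lemma inv_INR_small eps : 0 < eps -> exists N : nat, forall n, (N <= n)%nat -> / (INR n + 1) < eps.
Proof.
  intros He. destruct (archimed_cor1 eps He) as [N [HN HN0]].
  exists N. intros n Hn. apply le_INR in Hn. apply lt_INR in HN0. simpl in HN0.
  eapply Rlt_trans; [|exact HN]. apply Rinv_lt_contravar; nra.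
Qed.

Lemma inv_INR_pos n : 0 < / (INR n + 1).
Proof. apply Rinv_0_lt_compat. pose proof (pos_INR n); lra. Qed.

Lemma mcv_inv_INR x l : (forall n, d l (x n) < / (INR n + 1)) -> mcv x l.
Proof.
  intros H; apply mcv_intro; intros e He. destruct (inv_INR_small e He) as [N HN].
  exists N. intros n Hn. eapply Rlt_trans; eauto.
Qed.

(** Index maps satisfy only [n <= phi n] and need not be increasing. This is enough for limits to
    survive and is preserved under composition. *)
Lemma cluster_subseq x l : cluster x l ->
  exists phi : nat -> nat, (forall n, (n <= phi n)%nat) /\ mcv (fun n => x (phi n)) l.
Proof.
  intros H.
  assert (Hc : forall n, exists p, (n <= p)%nat /\ d l (x p) < / (INR n + 1)).
  { intros n; apply H, inv_INR_pos. }
  apply choice in Hc. destruct Hc as [phi Hphi].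
  exists phi. split; [intros; apply Hphi|].
  apply mcv_inv_INR; intros; apply Hphi.
Qed.

Lemma cluster_compact_subseq K x : cluster_compact K -> (forall n, K (x n)) ->
  exists phi l, (forall n, (n <= phi n)%nat) /\ K l /\ mcv (fun n => x (phi n)) l.
Proof.
  intros HK Hx. destruct (HK x Hx) as [l [Kl Hl]].
  destruct (cluster_subseq x l Hl) as [phi [H1 H2]]. exists phi, l; auto.
Qed.

Lemma Un_cv_subseq (u : nat -> R) l (phi : nat -> nat) : (forall n, (n <= phi n)%nat) ->
  Un_cv u l -> Un_cv (fun n => u (phi n)) l.
Proof.
  intros Hp H e He. destruct (H e He) as [N HN]. exists N. intros n Hn. apply HN.
  specialize (Hp n). lia.
Qed.

(* Continuity along sequences: algebraic closure properties reduce to those of [Un_cv]. *)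
Definition scont (K : T -> Prop) (f : T -> R) : Prop :=
  forall x y, K x -> (forall n, K (y n)) -> mcv y x -> Un_cv (fun n => f (y n)) (f x).

Definition scontC (K : T -> Prop) (f : T -> C) : Prop :=
  scont K (fun x => Cre (f x)) /\ scont K (fun x => Cim (f x)).

Lemma scont_eps K f : scont K f -> forall x, K x -> forall eps, 0 < eps ->
  exists del, 0 < del /\ forall y, K y -> d x y < del -> Rabs (f y - f x) < eps.
Proof.
  intros Hf x Kx e He. apply NNPP; intros Hno.
  assert (Hc : forall n : nat, exists y, K y /\ d x y < / (INR n + 1) /\ e <= Rabs (f y - f x)).
  { intros n. apply NNPP; intros H. apply Hno. exists (/ (INR n + 1)).
    split; [apply inv_INR_pos|]. intros y Ky Hy. apply Rnot_le_lt; intros Hle.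
    apply H; exists y; auto. }
  apply choice in Hc. destruct Hc as [y Hy].
  destruct (Hf x y Kx (fun n => proj1 (Hy n))
    (mcv_inv_INR y x (fun n => proj1 (proj2 (Hy n)))) e He) as [N HN].
  specialize (HN N (le_n _)). unfold Rdist in HN. destruct (Hy N) as [_ [_ H]]. lra.
Qed.

Lemma scont_intro K f : (forall x, K x -> forall eps, 0 < eps ->
  exists del, 0 < del /\ forall y, K y -> d x y < del -> Rabs (f y - f x) < eps) -> scont K f.
Proof.
  intros H x y Kx Ky Hy e He. destruct (H x Kx e He) as [del [Hdel Hf]].
  destruct (mcv_elim _ _ Hy del Hdel) as [N HN]. exists N. intros n Hn.
  apply Hf; auto.
Qed.

Lemma scontC_eps K f : scontC K f -> forall x, K x -> forall eps, 0 < eps ->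
  exists del, 0 < del /\ forall y, K y -> d x y < del -> Cabs (Csub (f y) (f x)) < eps.
Proof.
  intros [H1 H2] x Kx e He.
  destruct (scont_eps _ _ H1 x Kx (e/2)) as [d1 [Hd1 G1]]; [lra|].
  destruct (scont_eps _ _ H2 x Kx (e/2)) as [d2 [Hd2 G2]]; [lra|].
  exists (Rmin d1 d2). split; [apply Rmin_glb_lt; auto|]. intros y Ky Hy.
  eapply Rle_lt_trans; [apply Cabs_le_re_im|].
  specialize (G1 y Ky (Rlt_le_trans _ _ _ Hy (Rmin_l _ _))).
  specialize (G2 y Ky (Rlt_le_trans _ _ _ Hy (Rmin_r _ _))). simpl; lra.
Qed.

Lemma scontC_intro K f : (forall x, K x -> forall eps, 0 < eps ->
  exists del, 0 < del /\ forall y, K y -> d x y < del -> Cabs (Csub (f y) (f x)) < eps) -> scontC K f.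
Proof.
  intros H; split; apply scont_intro; intros x Kx e He; destruct (H x Kx e He) as [del [Hdel G]];
  exists del; split; auto; intros y Ky Hy; eapply Rle_lt_trans; [|apply (G y Ky Hy)|  |apply (G y Ky Hy)].
  - apply (Rabs_Cre (Csub (f y) (f x))).
  - apply (Rabs_Cim (Csub (f y) (f x))).
Qed.

Lemma scont_const K c : scont K (fun _ => c).
Proof. intros x y _ _ _ e He. exists O; intros; rewrite Rdist_eq; auto. Qed.

Lemma scont_add K f g : scont K f -> scont K g -> scont K (fun x => f x + g x).
Proof. intros Hf Hg x y Kx Ky Hy. apply CV_plus; auto. Qed.

Lemma scont_sub K f g : scont K f -> scont K g -> scont K (fun x => f x - g x).
Proof. intros Hf Hg x y Kx Ky Hy. apply CV_minus; auto. Qed.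

Lemma scont_mul K f g : scont K f -> scont K g -> scont K (fun x => f x * g x).
Proof. intros Hf Hg x y Kx Ky Hy. apply CV_mult; auto. Qed.

Lemma scont_comp K f (h : R -> R) : scont K f -> (forall x, K x -> continuity_pt h (f x)) ->
  scont K (fun x => h (f x)).
Proof. intros Hf Hh x y Kx Ky Hy. apply (continuity_seq h (fun n => f (y n))); auto. Qed.

Lemma scont_abs K f : scont K f -> scont K (fun x => Rabs (f x)).
Proof. intros Hf x y Kx Ky Hy. apply cv_cvabs; auto. Qed.

Lemma scont_inv K f : scont K f -> (forall x, K x -> f x <> 0) -> scont K (fun x => / f x).
Proof.
  intros Hf H0. apply (scont_comp K f Rinv Hf). intros x Kx.
  apply (continuity_pt_inv id); [apply derivable_continuous_pt, derivable_pt_id|]. apply H0; auto.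
Qed.

Lemma scont_ext K f g : (forall x, K x -> f x = g x) -> scont K f -> scont K g.
Proof.
  intros H Hf x y Kx Ky Hy e He. destruct (Hf x y Kx Ky Hy e He) as [N HN].
  exists N. intros n Hn. rewrite <- !H; auto.
Qed.

Lemma scont_max K f g : scont K f -> scont K g -> scont K (fun x => Rmax (f x) (g x)).
Proof.
  intros Hf Hg. apply scont_ext with (fun x => (f x + g x + Rabs (f x - g x)) * / 2).
  - intros x _. unfold Rmax, Rabs. destruct (Rle_dec (f x) (g x)), (Rcase_abs (f x - g x)); lra.
  - apply scont_mul; [|apply scont_const]. apply scont_add; [apply scont_add; auto|].
    apply scont_abs, scont_sub; auto.
Qed.

Lemma scont_min K f g : scont K f -> scont K g -> scont K (fun x => Rmin (f x) (g x)).
Proof.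
  intros Hf Hg. apply scont_ext with (fun x => (f x + g x - Rabs (f x - g x)) * / 2).
  - intros x _. unfold Rmin, Rabs. destruct (Rle_dec (f x) (g x)), (Rcase_abs (f x - g x)); lra.
  - apply scont_mul; [|apply scont_const]. apply scont_sub; [apply scont_add; auto|].
    apply scont_abs, scont_sub; auto.
Qed.

Lemma scont_sqrt K f : (forall x, K x -> 0 <= f x) -> scont K f -> scont K (fun x => sqrt (f x)).
Proof. intros H0 Hf. apply scont_comp with (h := sqrt); auto. intros; apply continuity_pt_sqrt; auto. Qed.

Lemma scont_Cabs K f : scontC K f -> scont K (fun x => Cabs (f x)).
Proof.
  intros [H1 H2]. apply scont_sqrt; [intros; apply Cn2_ge0|].
  apply scont_add; apply scont_mul; auto.
Qed.

Lemma scontC_const K c : scontC K (fun _ => c).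
Proof. split; apply scont_const. Qed.

Lemma scontC_add K f g : scontC K f -> scontC K g -> scontC K (fun x => Cadd (f x) (g x)).
Proof. intros [] []; split; simpl; apply scont_add; auto. Qed.

Lemma scontC_sub K f g : scontC K f -> scontC K g -> scontC K (fun x => Csub (f x) (g x)).
Proof. intros [] []; split; simpl; apply scont_sub; auto. Qed.

Lemma scontC_mul K f g : scontC K f -> scontC K g -> scontC K (fun x => Cmul (f x) (g x)).
Proof. intros [] []; split; simpl; [apply scont_sub|apply scont_add]; apply scont_mul; auto. Qed.

Lemma scontC_RtoC K f : scont K f -> scontC K (fun x => RtoC (f x)).
Proof. intros; split; simpl; auto. apply scont_const. Qed.

Lemma scontC_inv K f : scontC K f -> (forall x, K x -> f x <> C0) -> scontC K (fun x => Cinv (f x)).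
Proof.
  intros [H1 H2] H0.
  assert (scont K (fun x => / Cn2 (f x))).
  { apply scont_inv; [apply scont_add; apply scont_mul; auto|].
    intros x Kx. apply Rgt_not_eq, Cn2_neq0; auto. }
  split; simpl; unfold Rdiv; apply scont_mul; auto.
  apply scont_ext with (fun x => 0 - Cim (f x)); [intros; ring|].
  apply scont_sub; auto. apply scont_const.
Qed.

Lemma scontC_peval K N (F : T -> Cn N) (p : poly N) :
  (forall i, scontC K (fun x => F x i)) -> scontC K (fun x => peval p (F x)).
Proof.
  intros HF. induction p; simpl; auto using scontC_const, scontC_add, scontC_mul.
Qed.

Lemma scont_subset (K K' : T -> Prop) f : (forall x, K' x -> K x) -> scont K f -> scont K' f.
Proof. intros H Hf x y Kx Ky; apply Hf; auto. Qed.

Lemma scont_bounded K f : cluster_compact K -> scont K f -> exists M, 0 < M /\ forall x, K x -> Rabs (f x) <= M.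
Proof.
  intros HK Hf. apply NNPP; intros Hno.
  assert (Hc : forall n : nat, exists x, K x /\ INR n < Rabs (f x)).
  { intros n. apply NNPP; intros H. apply Hno. exists (INR n + 1).
    split; [pose proof (pos_INR n); lra|]. intros x Kx.
    apply Rnot_lt_le; intros Hl. apply H; exists x; split; auto; lra. }
  apply choice in Hc; destruct Hc as [x Hx].
  destruct (cluster_compact_subseq K x HK (fun n => proj1 (Hx n))) as [phi [l [Hp [Kl Hl]]]].
  destruct (Hf l _ Kl (fun n => proj1 (Hx (phi n))) Hl 1 Rlt_0_1) as [N HN].
  destruct (INR_unbounded (Rabs (f l) + 1)) as [N2 HN2].
  set (n := max N N2). specialize (HN n (Nat.le_max_l _ _)). unfold Rdist in HN.
  destruct (Hx (phi n)) as [_ Hb].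
  assert (INR N2 <= INR (phi n)) by (apply le_INR; specialize (Hp n); lia).
  pose proof (Rabs_triang_inv (f (x (phi n))) (f l)). lra.
Qed.

Lemma scont_max_attained K f : cluster_compact K -> scont K f -> (exists x, K x) ->
  exists x, K x /\ forall y, K y -> f y <= f x.
Proof.
  intros HK Hf [x0 Kx0].
  destruct (scont_bounded K f HK Hf) as [M [_ HM]].
  destruct (completeness (fun r => exists x, K x /\ r = f x)) as [s [Hs1 Hs2]].
  - exists M. intros r [x [Kx ->]]. eapply Rle_trans; [apply Rle_abs|auto].
  - exists (f x0), x0; auto.
  - assert (Hc : forall n : nat, exists x, K x /\ s - / (INR n + 1) < f x).
    { intros n. apply NNPP; intros H. pose proof (inv_INR_pos n).
      assert (s <= s - / (INR n + 1)); [|lra]. apply Hs2. intros r [x [Kx ->]].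
      apply Rnot_lt_le; intros Hl; apply H; exists x; auto. }
    apply choice in Hc; destruct Hc as [x Hx].
    destruct (cluster_compact_subseq K x HK (fun n => proj1 (Hx n))) as [phi [l [Hp [Kl Hl]]]].
    exists l; split; auto. intros y Ky.
    assert (Hsl : s <= f l).
    { apply Rnot_lt_le; intros Hlt.
      destruct (Hf l _ Kl (fun n => proj1 (Hx (phi n))) Hl ((s - f l)/2)) as [N HN]; [lra|].
      destruct (inv_INR_small ((s - f l)/2)) as [N2 HN2]; [lra|].
      set (n := max N N2). specialize (HN n (Nat.le_max_l _ _)). unfold Rdist in HN.
      destruct (Hx (phi n)) as [_ Hb].
      specialize (HN2 (phi n)). assert (N2 <= phi n)%nat by (specialize (Hp n); lia).
      apply Rabs_def2 in HN. specialize (HN2 H). lra. }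
    eapply Rle_trans; [|exact Hsl]. apply Hs1; exists y; auto.
Qed.

Lemma cluster_compact_closed_subset (K E : T -> Prop) : cluster_compact K ->
  (forall x, E x -> K x) ->
  (forall x y, K x -> (forall n, E (y n)) -> mcv y x -> E x) -> cluster_compact E.
Proof.
  intros HK HE Hcl x Hx.
  destruct (HK x (fun n => HE _ (Hx n))) as [l [Kl Hl]].
  exists l; split; auto. destruct (cluster_subseq x l Hl) as [phi [_ Hphi]].
  apply (Hcl l (fun n => x (phi n))); auto.
Qed.

(** Chooses an infimum for every parameter at once. Distance functions, the Tietze extension and
    bump functions are all obtained from it. *)
Lemma inf_family (A : Type) (P : A -> Prop) (f : T -> A -> R) (m : R) : (exists a, P a) ->
  (forall x a, P a -> m <= f x a) ->
  exists g : T -> R, forall x, (forall a, P a -> g x <= f x a) /\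
     forall eps, 0 < eps -> exists a, P a /\ f x a < g x + eps.
Proof.
  intros [a0 Ha0] Hm.
  apply (choice (fun x r => (forall a, P a -> r <= f x a) /\
     forall eps, 0 < eps -> exists a, P a /\ f x a < r + eps)).
  intros x.
  destruct (completeness (fun r => exists a, P a /\ r = - f x a)) as [s [Hs1 Hs2]].
  - exists (- m). intros r [a [Ha ->]]. specialize (Hm x a Ha); lra.
  - exists (- f x a0), a0; auto.
  - exists (- s). split.
    + intros a Ha. assert (- f x a <= s) by (apply Hs1; exists a; auto). lra.
    + intros e He. apply NNPP; intros H. assert (s <= s - e); [|lra].
      apply Hs2. intros r [a [Ha ->]]. apply Rnot_lt_le; intros Hl. apply H; exists a; split; auto; lra.
Qed.

End Compactness.

Lemma mcv_scont {T U : Type} (d : T -> T -> R) (d' : U -> U -> R) K f :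
  is_metric d -> is_metric d' -> continuous_on d d' K f ->
  forall x y, K x -> (forall n, K (y n)) -> mcv d y x -> mcv d' (fun n => f (y n)) (f x).
Proof.
  intros Hd Hd' Hf x y Kx Ky Hy. apply mcv_intro; auto. intros e He.
  destruct (Hf x Kx e He) as [del [Hdel G]].
  destruct (mcv_elim d _ _ Hy del Hdel) as [N HN]. exists N. intros n Hn. apply G; auto.
Qed.

Lemma inverse_continuous {T U : Type} (d : T -> T -> R) (d' : U -> U -> R) (K : T -> Prop)
  (Y : U -> Prop) f g :
  is_metric d -> is_metric d' -> cluster_compact d K -> continuous_on d d' K f ->
  (forall y, Y y -> K (g y)) -> (forall y, Y y -> f (g y) = y) ->
  (forall x x', K x -> K x' -> f x = f x' -> x = x') -> continuous_on d' d Y g.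
Proof.
  intros Hd Hd' HK Hf HgK Hfg Hinj y Yy e He. apply NNPP; intros Hno.
  assert (Hc : forall n : nat, exists z, Y z /\ d' y z < / (INR n + 1) /\ e <= d (g y) (g z)).
  { intros n. apply NNPP; intros H. apply Hno. exists (/ (INR n + 1)).
    split; [apply inv_INR_pos|]. intros z Yz Hz. apply Rnot_le_lt; intros Hle.
    apply H; exists z; auto. }
  apply choice in Hc. destruct Hc as [z Hz].
  destruct (cluster_compact_subseq d Hd K (fun n => g (z n)) HK (fun n => HgK _ (proj1 (Hz n))))
    as [phi [l [Hp [Kl Hl]]]].
  pose proof (mcv_scont d d' K f Hd Hd' Hf l _ Kl (fun n => HgK _ (proj1 (Hz (phi n)))) Hl) as Hcv.
  assert (Hz2 : mcv d' z y) by (apply mcv_inv_INR; auto; intros n; apply Hz).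
  assert (Hfl : f l = y).
  { apply (met_eq d' Hd'). apply Rle_antisym; [|apply (met_ge0 d' Hd')].
    apply le_epsilon. intros e' He'. rewrite Rplus_0_l.
    destruct (mcv_elim d' _ _ Hcv (e'/2)) as [N1 HN1]; [lra|].
    destruct (mcv_elim d' _ _ Hz2 (e'/2)) as [N2 HN2]; [lra|].
    specialize (HN1 (max N1 N2) (Nat.le_max_l _ _)). cbv beta in HN1.
    rewrite Hfg in HN1 by apply Hz.
    specialize (HN2 (phi (max N1 N2))).
    assert (N2 <= phi (max N1 N2))%nat by (specialize (Hp (max N1 N2)); lia).
    specialize (HN2 H).
    pose proof (met_tri d' Hd' (f l) (z (phi (max N1 N2))) y).
    rewrite (met_sym d' Hd' (z _) y) in H0. lra. }
  assert (l = g y).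
  { apply Hinj; auto. rewrite Hfg; auto. }
  subst l. destruct (mcv_elim d _ _ Hl e He) as [N HN].
  specialize (HN N (le_n _)). destruct (Hz (phi N)) as [_ [_ H]]. lra.
Qed.

Lemma bounded_subseq (u : nat -> R) M : (forall n, Rabs (u n) <= M) ->
  exists phi l, (forall n, (n <= phi n)%nat) /\ Un_cv (fun n => u (phi n)) l.
Proof.
  intros H.
  destruct (Bolzano_Weierstrass u (fun x => - M <= x <= M)) as [l Hl].
  - apply compact_P3.
  - intros n; apply Rabs_le_inv, H.
  - assert (Hc : forall n, exists p, (n <= p)%nat /\ Rabs (u p - l) < / (INR n + 1)).
    { intros n. destruct (Hl (fun x => Rabs (x - l) < / (INR n + 1)) n) as [p [Hp1 Hp2]].
      - exists (mkposreal _ (inv_INR_pos n)). intros x Hx; exact Hx.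
      - exists p; auto. }
    apply choice in Hc; destruct Hc as [phi Hphi]. exists phi, l.
    split; [intros; apply Hphi|]. intros e He. destruct (inv_INR_small e He) as [N HN].
    exists N. intros n Hn. eapply Rlt_trans; [apply Hphi|]. apply HN; lia.
Qed.

Lemma bounded_subseq_fin (k : nat) (u : Fin.t k -> nat -> R) M : (forall i n, Rabs (u i n) <= M) ->
  exists phi (l : Fin.t k -> R), (forall n, (n <= phi n)%nat) /\ forall i, Un_cv (fun n => u i (phi n)) (l i).
Proof.
  induction k; intros H.
  - exists (fun n => n), (fun _ => 0). split; auto. intros i; apply (Fin.case0 (fun _ => _) i).
  - destruct (IHk (fun i => u (Fin.FS i))) as [phi [l [Hp Hl]]]; [auto|].
    destruct (bounded_subseq (fun n => u Fin.F1 (phi n)) M) as [psi [l0 [Hq Hl0]]]; [auto|].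
    exists (fun n => phi (psi n)), (fun i => Fin.caseS' i (fun _ => R) l0 l).
    split.
    + intros n. specialize (Hq n). specialize (Hp (psi n)). lia.
    + intros i. apply (Fin.caseS' i); simpl; auto. intros j.
      apply (Un_cv_subseq (fun n => u (Fin.FS j) (phi n))); auto.
Qed.

Lemma mcv_Cn N (z : nat -> Cn N) l :
  (forall i, Un_cv (fun n => Cre (z n i)) (Cre (l i))) ->
  (forall i, Un_cv (fun n => Cim (z n i)) (Cim (l i))) -> mcv (dist_Cn N) z l.
Proof.
  intros H1 H2.
  assert (Hall : forall (a : nat -> Fin.t N -> R), (forall i, Un_cv (fun n => a n i) 0) ->
     forall e, 0 < e -> exists M, forall n, (M <= n)%nat -> forall i, Rabs (a n i) < e).
  { clear. induction N; intros a Ha e He.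
    - exists O. intros n _ i; apply (Fin.case0 (fun _ => _) i).
    - destruct (IHN (fun n i => a n (Fin.FS i)) (fun i => Ha (Fin.FS i)) e He) as [M HM].
      destruct (Ha Fin.F1 e He) as [M' HM'].
      exists (max M M'). intros n Hn i. apply (Fin.caseS' i).
      + specialize (HM' n). unfold Rdist in HM'. rewrite Rminus_0_r in HM'. apply HM'; lia.
      + intros j. apply HM; lia. }
  apply mcv_intro; [apply dist_Cn_metric|]. intros e He.
  set (e' := e / (INR N + 1) / 2).
  assert (HN : 0 < INR N + 1) by (pose proof (pos_INR N); lra).
  assert (He' : 0 < e') by (unfold e'; apply Rdiv_lt_0_compat; [apply Rdiv_lt_0_compat|]; lra).
  destruct (Hall (fun n i => Cabs (Csub (l i) (z n i)))) with (e := e') as [M HM]; auto.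
  - intros i e1 He1. destruct (H1 i (e1/2)) as [N1 G1]; [lra|]. destruct (H2 i (e1/2)) as [N2 G2]; [lra|].
    exists (max N1 N2). intros n Hn. unfold Rdist. rewrite Rminus_0_r, Rabs_right; [|apply Rle_ge, Cabs_ge0].
    rewrite Cabs_sub_sym. eapply Rle_lt_trans; [apply Cabs_le_re_im|].
    specialize (G1 n ltac:(lia)). specialize (G2 n ltac:(lia)). unfold Rdist in *. simpl. lra.
  - exists M. intros n Hn. rewrite dist_Cn_nrm.
    eapply Rle_lt_trans; [apply nrm_small with (e := e'); [lra|]; intros i; left; apply HM; auto|].
    assert ((INR N + 1) * e' = e / 2) by (unfold e'; field; lra). lra.
Qed.

Lemma closed_bounded_compact N (S : Cn N -> Prop) M :
  (forall z, S z -> forall i, Cabs (z i) <= M) ->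
  (forall z l, (forall n, S (z n)) -> mcv (dist_Cn N) z l -> S l) -> cluster_compact (dist_Cn N) S.
Proof.
  intros HM Hcl z Hz.
  destruct (bounded_subseq_fin N (fun i n => Cre (z n i)) M) as [phi [l [Hp Hl]]].
  { intros; eapply Rle_trans; [apply Rabs_Cre|auto]. }
  destruct (bounded_subseq_fin N (fun i n => Cim (z (phi n) i)) M) as [psi [l' [Hq Hl']]].
  { intros; eapply Rle_trans; [apply Rabs_Cim|auto]. }
  set (w := fun i => mkC (l i) (l' i)).
  assert (Hcv : mcv (dist_Cn N) (fun n => z (phi (psi n))) w).
  { apply mcv_Cn; intros i; simpl; auto.
    apply (Un_cv_subseq (fun n => Cre (z (phi n) i))); auto. }
  exists w. split; [apply (Hcl _ _ (fun n => Hz _) Hcv)|].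
  intros e He K. destruct (mcv_elim _ _ _ Hcv e He) as [N1 HN1].
  exists (phi (psi (max N1 K))). split.
  - specialize (Hq (max N1 K)). specialize (Hp (psi (max N1 K))). lia.
  - apply HN1; lia.
Qed.

Lemma scontC_coord N (S : Cn N -> Prop) i : scontC (dist_Cn N) S (fun z => z i).
Proof.
  apply scontC_intro. intros x _ e He. exists e; split; auto.
  intros y _ Hy. eapply Rle_lt_trans; [|exact Hy]. rewrite Cabs_sub_sym. apply dist_Cn_coord.
Qed.

(** * Second order jets of polynomials *)

Fixpoint D1 {N} (p : poly N) (x v : Cn N) : C :=
  match p with
  | PConst _ => C0
  | PVar i => v i
  | PAdd p q => D1 p x v + D1 q x v
  | PMul p q => peval p x * D1 q x v + peval q x * D1 p x v
  end%Cx.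

(** Taylor coefficient of z^2 in p(x + z v), that is, half the second derivative; hence the single
    mixed term in the product rule. *)
Fixpoint D2 {N} (p : poly N) (x v : Cn N) : C :=
  match p with
  | PConst _ => C0
  | PVar _ => C0
  | PAdd p q => D2 p x v + D2 q x v
  | PMul p q => peval p x * D2 q x v + D1 p x v * D1 q x v + peval q x * D2 p x v
  end%Cx.

Definition lin2 {N} (s : C) (v : Cn N) (t : C) (w : Cn N) : Cn N := fun i => (s * v i + t * w i)%Cx.
Definition vadd {N} (v w : Cn N) : Cn N := fun i => (v i + w i)%Cx.

Lemma D1_lin {N} (p : poly N) x s v t w :
  D1 p x (lin2 s v t w) = (s * D1 p x v + t * D1 p x w)%Cx.
Proof. induction p; simpl; rewrite ?IHp1, ?IHp2; unfold lin2; ring. Qed.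

Lemma D2_lin {N} (p : poly N) x v w : exists a b c, forall s t,
  D2 p x (lin2 s v t w) = (a * (s * s) + b * (s * t) + c * (t * t))%Cx.
Proof.
  induction p as [c|i|p [a [b [c H]]] q [a' [b' [c' H']]]|p [a [b [c H]]] q [a' [b' [c' H']]]]; simpl.
  - exists C0, C0, C0; intros; ring.
  - exists C0, C0, C0; intros; ring.
  - exists (a + a')%Cx, (b + b')%Cx, (c + c')%Cx; intros; rewrite H, H'; ring.
  - exists (peval p x * a' + D1 p x v * D1 q x v + peval q x * a)%Cx,
      (peval p x * b' + (D1 p x v * D1 q x w + D1 p x w * D1 q x v) + peval q x * b)%Cx,
      (peval p x * c' + D1 p x w * D1 q x w + peval q x * c)%Cx.
    intros; rewrite H, H', !D1_lin; ring.
Qed.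

Definition jet2 (f : C -> C) (a b c : C) : Prop :=
  exists M, 0 <= M /\ forall z, Cabs z <= 1 ->
    Cabs (f z - (a + z * b + z * z * c))%Cx <= M * (Cabs z * Cabs z * Cabs z).

Lemma jet2_add f g a b c a' b' c' : jet2 f a b c -> jet2 g a' b' c' ->
  jet2 (fun z => f z + g z)%Cx (a + a')%Cx (b + b')%Cx (c + c')%Cx.
Proof.
  intros [M [HM H]] [M' [HM' H']]. exists (M + M'). split; [lra|]. intros z Hz.
  replace (f z + g z - (a + a' + z * (b + b') + z * z * (c + c')))%Cx with
    ((f z - (a + z * b + z * z * c)) + (g z - (a' + z * b' + z * z * c')))%Cx by ring.
  eapply Rle_trans; [apply Cabs_add|]. specialize (H z Hz); specialize (H' z Hz). lra.
Qed.

Lemma Cabs_quad a b c z : Cabs z <= 1 -> Cabs (a + z * b + z * z * c)%Cx <= Cabs a + Cabs b + Cabs c.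
Proof.
  intros Hz. pose proof (Cabs_ge0 z); pose proof (Cabs_ge0 b); pose proof (Cabs_ge0 c).
  eapply Rle_trans; [apply Cabs_add|]. apply Rplus_le_compat.
  - eapply Rle_trans; [apply Cabs_add|]. rewrite Cabs_mul. nra.
  - rewrite !Cabs_mul. assert (Cabs z * Cabs z <= 1) by nra. nra.
Qed.

Lemma jet2_mul f g a b c a' b' c' : jet2 f a b c -> jet2 g a' b' c' ->
  jet2 (fun z => f z * g z)%Cx (a * a')%Cx (a * b' + a' * b)%Cx (a * c' + b * b' + a' * c)%Cx.
Proof.
  intros [M [HM H]] [M' [HM' H']].
  set (P := Cabs a + Cabs b + Cabs c). set (P' := Cabs a' + Cabs b' + Cabs c').
  set (R0 := Cabs (b * c' + c * b')%Cx). set (R1 := Cabs (c * c')%Cx).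
  assert (HP : 0 <= P) by (unfold P; pose proof (Cabs_ge0 a); pose proof (Cabs_ge0 b); pose proof (Cabs_ge0 c); lra).
  assert (HP' : 0 <= P') by (unfold P'; pose proof (Cabs_ge0 a'); pose proof (Cabs_ge0 b'); pose proof (Cabs_ge0 c'); lra).
  assert (HR0 : 0 <= R0) by apply Cabs_ge0. assert (HR1 : 0 <= R1) by apply Cabs_ge0.
  exists (M * (P' + M') + P * M' + R0 + R1). split; [nra|].
  intros z Hz. pose proof (Cabs_ge0 z) as Hz0.
  specialize (H z Hz); specialize (H' z Hz).
  pose proof (Cabs_quad a b c z Hz) as HPz. pose proof (Cabs_quad a' b' c' z Hz) as HPz'.
  fold P in HPz. fold P' in HPz'.
  set (p := (a + z * b + z * z * c)%Cx) in *. set (p' := (a' + z * b' + z * z * c')%Cx) in *.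
  replace (f z * g z - (a * a' + z * (a * b' + a' * b) + z * z * (a * c' + b * b' + a' * c)))%Cx
   with ((f z - p) * g z + p * (g z - p') + (z * z * z) * ((b * c' + c * b') + z * (c * c')))%Cx
   by (unfold p, p'; ring).
  set (t := Cabs z * Cabs z * Cabs z) in *.
  assert (Ht : 0 <= t <= 1) by (unfold t; split; [repeat apply Rmult_le_pos; auto|]; nra).
  assert (Hg : Cabs (g z) <= P' + M').
  { replace (g z) with ((g z - p') + p')%Cx by ring. eapply Rle_trans; [apply Cabs_add|]. nra. }
  pose proof (Cabs_ge0 (f z - p)%Cx). pose proof (Cabs_ge0 (g z)). pose proof (Cabs_ge0 p).
  pose proof (Cabs_ge0 (g z - p')%Cx).
  assert (E1 : Cabs ((f z - p) * g z)%Cx <= M * t * (P' + M')).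
  { rewrite Cabs_mul. apply Rmult_le_compat; auto. }
  assert (E2 : Cabs (p * (g z - p'))%Cx <= P * (M' * t)).
  { rewrite Cabs_mul. apply Rmult_le_compat; auto. }
  assert (E3 : Cabs ((z * z * z) * ((b * c' + c * b') + z * (c * c')))%Cx <= t * (R0 + R1)).
  { rewrite Cabs_mul, !Cabs_mul. fold t. apply Rmult_le_compat_l; [lra|].
    eapply Rle_trans; [apply Cabs_add|]. rewrite Cabs_mul. fold R0 R1. nra. }
  eapply Rle_trans; [apply Cabs_add|]. eapply Rle_trans; [apply Rplus_le_compat_r, Cabs_add|].
  lra.
Qed.

(** Bending the line by z^2 w adds [D1 p x w] at the same order as [D2 p x v], so a suitable [w] can
    cancel the second order term. *)
Lemma peval_jet2 {N} (p : poly N) x v w :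
  jet2 (fun z => peval p (vadd x (lin2 z v (z * z)%Cx w)))
    (peval p x) (D1 p x v) (D1 p x w + D2 p x v)%Cx.
Proof.
  induction p as [c|i|p IHp q IHq|p IHp q IHq]; simpl.
  - exists 0. split; [lra|]. intros z _.
    replace (c - (c + z * C0 + z * z * (C0 + C0)))%Cx with C0 by ring. rewrite Cabs_C0; lra.
  - exists 0. split; [lra|]. intros z _. unfold vadd, lin2.
    replace (x i + (z * v i + z * z * w i) - (x i + z * v i + z * z * (w i + C0)))%Cx with C0 by ring.
    rewrite Cabs_C0; lra.
  - replace (D1 p x w + D1 q x w + (D2 p x v + D2 q x v))%Cx with
      ((D1 p x w + D2 p x v) + (D1 q x w + D2 q x v))%Cx by ring.
    apply jet2_add; auto.
  - replace (peval p x * D1 q x w + peval q x * D1 p x w +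
      (peval p x * D2 q x v + D1 p x v * D1 q x v + peval q x * D2 p x v))%Cx with
      (peval p x * (D1 q x w + D2 q x v) + D1 p x v * D1 q x v + peval q x * (D1 p x w + D2 p x v))%Cx by ring.
    apply jet2_mul; auto.
Qed.

(** * Strictly plurisubharmonic ascent along the fibres of two polynomials on C^3 *)

Definition i1 : Fin.t 3 := Fin.F1.
Definition i2 : Fin.t 3 := Fin.FS Fin.F1.
Definition i3 : Fin.t 3 := Fin.FS (Fin.FS Fin.F1).

Lemma fin3_ind (P : Fin.t 3 -> Prop) : P i1 -> P i2 -> P i3 -> forall i, P i.
Proof.
  intros H1 H2 H3 i. apply (Fin.caseS' i); auto. intros j.
  apply (Fin.caseS' j); auto. intros k. apply (Fin.caseS' k); auto. intros l; apply (Fin.case0 (fun _ => _) l).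
Qed.

Definition V3 (a b c : C) : Cn 3 := fun i =>
  Fin.caseS' i (fun _ => C) a (fun j => Fin.caseS' j (fun _ => C) b (fun _ => c)).

Lemma V3_eta (z : Cn 3) : z = V3 (z i1) (z i2) (z i3).
Proof. apply functional_extensionality. apply fin3_ind; reflexivity. Qed.

Definition dot3 (a v : Cn 3) : C := (a i1 * v i1 + a i2 * v i2 + a i3 * v i3)%Cx.
Definition conj3 (a : Cn 3) : Cn 3 := fun i => Cconj (a i).
Definition n2 (y : Cn 3) : R := Cn2 (y i1) + Cn2 (y i2) + Cn2 (y i3).
Definition cross (a b : Cn 3) : Cn 3 :=
  V3 (a i2 * b i3 - a i3 * b i2)%Cx (a i3 * b i1 - a i1 * b i3)%Cx (a i1 * b i2 - a i2 * b i1)%Cx.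
Definition zero3 : Cn 3 := fun _ => C0.

Ltac vec := unfold dot3, cross, lin2, vadd, conj3, zero3; simpl.

Lemma dot_lin a s v t w : dot3 a (lin2 s v t w) = (s * dot3 a v + t * dot3 a w)%Cx.
Proof. vec; ring. Qed.

Lemma dot_cross_l a b : dot3 a (cross a b) = C0.
Proof. vec; ring. Qed.

Lemma dot_cross_r a b : dot3 b (cross a b) = C0.
Proof. vec; ring. Qed.

Lemma dot_cross_rot a b k : dot3 a (cross b k) = dot3 k (cross a b).
Proof. vec; ring. Qed.

Lemma n2_ge0 v : 0 <= n2 v.
Proof. unfold n2; pose proof (Cn2_ge0 (v i1)); pose proof (Cn2_ge0 (v i2)); pose proof (Cn2_ge0 (v i3)); lra. Qed.

Lemma n2_eq0 v : n2 v = 0 -> v = zero3.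
Proof.
  intros H. unfold n2 in H.
  pose proof (Cn2_ge0 (v i1)); pose proof (Cn2_ge0 (v i2)); pose proof (Cn2_ge0 (v i3)).
  apply functional_extensionality. unfold zero3. unfold Cn2 in *.
  apply fin3_ind; apply C_ext; simpl; nra.
Qed.

Lemma n2_pos v : v <> zero3 -> 0 < n2 v.
Proof.
  intros H. destruct (Rle_lt_or_eq_dec _ _ (n2_ge0 v)) as [|E]; auto.
  exfalso; apply H, n2_eq0; auto.
Qed.

Lemma dot_conj v : dot3 v (conj3 v) = RtoC (n2 v).
Proof. unfold n2, RtoC, Cn2; vec; apply C_ext; simpl; ring. Qed.

Lemma dot_conj' v : dot3 (conj3 v) v = RtoC (n2 v).
Proof. unfold n2, RtoC, Cn2; vec; apply C_ext; simpl; ring. Qed.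

Lemma RtoC_neq0 x : x <> 0 -> RtoC x <> C0.
Proof. intros H E; apply (f_equal Cre) in E; simpl in E; auto. Qed.

Lemma dot_conj_neq0 v : v <> zero3 -> dot3 v (conj3 v) <> C0.
Proof. intros H; rewrite dot_conj; apply RtoC_neq0, Rgt_not_eq, n2_pos; auto. Qed.

Lemma dot_conj_neq0' v : v <> zero3 -> dot3 (conj3 v) v <> C0.
Proof. intros H; rewrite dot_conj'; apply RtoC_neq0, Rgt_not_eq, n2_pos; auto. Qed.

Lemma D1_dot (p : poly 3) x : exists l : Cn 3, forall v, D1 p x v = dot3 l v.
Proof.
  induction p as [c|i|p [l Hl] q [m Hm]|p [l Hl] q [m Hm]]; simpl.
  - exists zero3; intros; vec; ring.
  - revert i. apply fin3_ind; [exists (V3 C1 C0 C0)|exists (V3 C0 C1 C0)|exists (V3 C0 C0 C1)]; intros; vec; ring.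
  - exists (lin2 C1 l C1 m); intros v; rewrite Hl, Hm; vec; ring.
  - exists (lin2 (peval p x) m (peval q x) l); intros v; rewrite Hl, Hm; vec; ring.
Qed.

(** [lin2 m a C0 a] encodes the multiple m a; the coefficient is that of the Hermitian projection of
    [b] onto the line of [a]. *)
Lemma cross0_parallel a b : a <> zero3 -> cross a b = zero3 -> exists m, b = lin2 m a C0 a.
Proof.
  intros Ha Hc.
  exists (dot3 (conj3 a) b / dot3 (conj3 a) a)%Cx.
  pose proof (dot_conj_neq0' a Ha) as Hn.
  pose proof (f_equal (fun f => f i1) Hc) as E1. pose proof (f_equal (fun f => f i2) Hc) as E2.
  pose proof (f_equal (fun f => f i3) Hc) as E3. unfold cross, zero3 in E1, E2, E3; simpl in E1, E2, E3.
  change (Fin.F1) with i1 in *. 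
  assert (E1' : (a i2 * b i3)%Cx = (a i3 * b i2)%Cx) by (replace (a i2 * b i3)%Cx with (a i2 * b i3 - a i3 * b i2 + a i3 * b i2)%Cx by ring; rewrite E1; ring).
  assert (E2' : (a i3 * b i1)%Cx = (a i1 * b i3)%Cx) by (replace (a i3 * b i1)%Cx with (a i3 * b i1 - a i1 * b i3 + a i1 * b i3)%Cx by ring; rewrite E2; ring).
  assert (E3' : (a i1 * b i2)%Cx = (a i2 * b i1)%Cx) by (replace (a i1 * b i2)%Cx with (a i1 * b i2 - a i2 * b i1 + a i2 * b i1)%Cx by ring; rewrite E3; ring).
  apply functional_extensionality.
  assert (G : forall i, (dot3 (conj3 a) b * a i)%Cx = (dot3 (conj3 a) a * b i)%Cx ->
     b i = lin2 (dot3 (conj3 a) b / dot3 (conj3 a) a)%Cx a C0 a i).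
  { intros i H. unfold lin2.
    transitivity ((dot3 (conj3 a) a * b i) / dot3 (conj3 a) a)%Cx; [field; auto|].
    rewrite <- H. field; auto. }
  apply fin3_ind; apply G; unfold dot3.
  - transitivity (conj3 a i1 * a i1 * b i1 + conj3 a i2 * (a i1 * b i2) + conj3 a i3 * (a i1 * b i3))%Cx; [ring|].
    rewrite E3', <- E2'. ring.
  - transitivity (conj3 a i1 * (a i2 * b i1) + conj3 a i2 * a i2 * b i2 + conj3 a i3 * (a i2 * b i3))%Cx; [ring|].
    rewrite <- E3', E1'. ring.
  - transitivity (conj3 a i1 * (a i3 * b i1) + conj3 a i2 * (a i3 * b i2) + conj3 a i3 * a i3 * b i3)%Cx; [ring|].
    rewrite E2', <- E1'. ring.
Qed.

Lemma dot_ker_basis a : a <> zero3 -> exists e f, dot3 a e = C0 /\ dot3 a f = C0 /\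
  forall s t, lin2 s e t f = zero3 -> s = C0 /\ t = C0.
Proof.
  intros Ha.
  assert (Hz : forall x y, x <> C0 -> Cmul y x = C0 -> y = C0).
  { intros x y Hx H. apply Cmul_eq0 in H. tauto. }
  destruct (classic (a i1 = C0)) as [H1|H1]; [destruct (classic (a i2 = C0)) as [H2|H2];
    [destruct (classic (a i3 = C0)) as [H3|H3]|]|].
  - exfalso; apply Ha. rewrite (V3_eta a), H1, H2, H3. symmetry; apply (V3_eta zero3).
  - exists (V3 C1 C0 C0), (V3 C0 C1 C0). split; [|split]; [vec; change Fin.F1 with i1; rewrite H1; ring| |].
    + unfold dot3; rewrite H2; vec; ring.
    + intros s t H. pose proof (f_equal (fun f => f i1) H) as E1. pose proof (f_equal (fun f => f i2) H) as E2.
      unfold lin2, zero3 in E1, E2; simpl in E1, E2. split; [rewrite <- E1|rewrite <- E2]; ring.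
  - exists (V3 C1 C0 C0), (V3 C0 (- a i3)%Cx (a i2)). split; [|split].
    + unfold dot3; rewrite H1; vec; ring.
    + unfold dot3; vec; ring.
    + intros s t H. pose proof (f_equal (fun f => f i1) H) as E1. pose proof (f_equal (fun f => f i3) H) as E2.
      unfold lin2, zero3 in E1, E2; simpl in E1, E2. split; [rewrite <- E1; ring|].
      apply (Hz (a i2)); auto. rewrite <- E2; ring.
  - exists (V3 (- a i2)%Cx (a i1) C0), (V3 (- a i3)%Cx C0 (a i1)). split; [|split].
    + unfold dot3; vec; ring.
    + unfold dot3; vec; ring.
    + intros s t H. pose proof (f_equal (fun f => f i2) H) as E1. pose proof (f_equal (fun f => f i3) H) as E2.
      unfold lin2, zero3 in E1, E2; simpl in E1, E2. 
      split; apply (Hz (a i1)); auto; [rewrite <- E1|rewrite <- E2]; ring.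
Qed.

Lemma Cn2_add_lower a b : Cn2 a / 2 - Cn2 b <= Cn2 (a + b)%Cx.
Proof.
  unfold Cn2; simpl.
  pose proof (Rle_0_sqr (Cre a + 2 * Cre b)). pose proof (Rle_0_sqr (Cim a + 2 * Cim b)). unfold Rsqr in *. nra.
Qed.

Lemma Cn2_add_upper a b : Cn2 (a + b)%Cx <= 2 * Cn2 a + 2 * Cn2 b.
Proof.
  unfold Cn2; simpl.
  pose proof (Rle_0_sqr (Cre a - Cre b)). pose proof (Rle_0_sqr (Cim a - Cim b)). unfold Rsqr in *. nra.
Qed.

Lemma Cn2_mul a b : Cn2 (a * b)%Cx = Cn2 a * Cn2 b.
Proof. unfold Cn2; simpl; ring. Qed.

Lemma n2_lin_lower s v t w : Cn2 s * n2 v / 2 - Cn2 t * n2 w <= n2 (lin2 s v t w).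
Proof.
  unfold n2, lin2.
  pose proof (Cn2_add_lower (s * v i1)%Cx (t * w i1)%Cx).
  pose proof (Cn2_add_lower (s * v i2)%Cx (t * w i2)%Cx).
  pose proof (Cn2_add_lower (s * v i3)%Cx (t * w i3)%Cx).
  rewrite !Cn2_mul in *. lra.
Qed.

Lemma n2_lin_upper s v t w : n2 (lin2 s v t w) <= 2 * Cn2 s * n2 v + 2 * Cn2 t * n2 w.
Proof.
  unfold n2, lin2.
  pose proof (Cn2_add_upper (s * v i1)%Cx (t * w i1)%Cx).
  pose proof (Cn2_add_upper (s * v i2)%Cx (t * w i2)%Cx).
  pose proof (Cn2_add_upper (s * v i3)%Cx (t * w i3)%Cx).
  rewrite !Cn2_mul in *. lra.
Qed.

(** Exact increment of a function with derivative Re(A . y) and second order part |y|^2/2; the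
    function maximised in [fibre_sphere] is of this kind. *)
Definition gain (A y : Cn 3) : R := Cre (dot3 A y) + n2 y / 2.

(** The change of each polynomial is measured against the gain, so that the changes accumulated
    during an ascent stay below [eps] times the total rise. *)
Definition ascends (F1 F2 : poly 3) (x A : Cn 3) : Prop :=
  forall eps rho, 0 < eps -> 0 < rho -> exists y, n2 y < rho /\ 0 < gain A y /\
    Cabs (peval F1 (vadd x y) - peval F1 x)%Cx <= eps * gain A y /\
    Cabs (peval F2 (vadd x y) - peval F2 x)%Cx <= eps * gain A y.

Lemma ascends_sym F1 F2 x A : ascends F1 F2 x A -> ascends F2 F1 x A.
Proof. intros H e r He Hr. destruct (H e r He Hr) as [y [? [? [? ?]]]]. exists y; auto. Qed.

Lemma small_pos a b : 0 < a -> 0 < b -> exists h, 0 < h <= 1 /\ h <= a /\ h <= b.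
Proof.
  intros. exists (Rmin 1 (Rmin a b)).
  split; [split|split].
  - repeat apply Rmin_glb_lt; lra.
  - apply Rmin_l.
  - eapply Rle_trans; [apply Rmin_r|apply Rmin_l].
  - eapply Rle_trans; [apply Rmin_r|apply Rmin_r].
Qed.

Lemma jet_bound_first (F : poly 3) x v : D1 F x v = C0 -> exists M, 0 <= M /\ forall h, 0 < h <= 1 ->
  Cabs (peval F (vadd x (lin2 (RtoC h) v (RtoC h * RtoC h)%Cx zero3)) - peval F x)%Cx <= M * (h * h).
Proof.
  intros Hv. destruct (peval_jet2 F x v zero3) as [M [HM H]].
  rewrite Hv in H. set (c := (D1 F x zero3 + D2 F x v)%Cx) in *.
  exists (M + Cabs c). split; [pose proof (Cabs_ge0 c); lra|]. intros h Hh.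
  specialize (H (RtoC h)). rewrite Cabs_RtoC, Rabs_right in H by lra. specialize (H ltac:(lra)).
  set (P := peval F (vadd _ _)) in *.
  replace (P - peval F x)%Cx with
   ((P - (peval F x + RtoC h * C0 + RtoC h * RtoC h * c)) + RtoC h * RtoC h * c)%Cx by ring.
  eapply Rle_trans; [apply Cabs_add|]. rewrite !Cabs_mul, Cabs_RtoC, Rabs_right by lra.
  assert (M * (h * h * h) <= M * (h * h)) by (apply Rmult_le_compat_l; nra). lra.
Qed.

(** Along h v the gain is of order h, while both polynomials change only by O(h^2). *)
Lemma ascends_first_order F1 F2 x A v :
  D1 F1 x v = C0 -> D1 F2 x v = C0 -> dot3 A v <> C0 -> ascends F1 F2 x A.
Proof.
  intros H1 H2 HA eps rho He Hr.
  set (v' := lin2 (Cinv (dot3 A v)) v C0 v).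
  assert (Hv' : dot3 A v' = C1) by (unfold v'; rewrite dot_lin; field; auto).
  destruct (jet_bound_first F1 x v') as [M1 [HM1 B1]]; [unfold v'; rewrite D1_lin, H1; ring|].
  destruct (jet_bound_first F2 x v') as [M2 [HM2 B2]]; [unfold v'; rewrite D1_lin, H2; ring|].
  pose proof (n2_ge0 v') as Hn.
  destruct (small_pos (eps / (M1 + M2 + 1)) (rho / (2 * n2 v' + 1))) as [h [Hh [Ha Hb]]].
  { apply Rdiv_lt_0_compat; lra. } { apply Rdiv_lt_0_compat; lra. }
  assert (Ha' : h * (M1 + M2 + 1) <= eps).
  { apply Rmult_le_compat_r with (r := M1 + M2 + 1) in Ha; [|lra].
    unfold Rdiv in Ha. rewrite Rmult_assoc, Rinv_l, Rmult_1_r in Ha by lra. auto. }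
  assert (Hb' : h * (2 * n2 v' + 1) <= rho).
  { apply Rmult_le_compat_r with (r := 2 * n2 v' + 1) in Hb; [|lra].
    unfold Rdiv in Hb. rewrite Rmult_assoc, Rinv_l, Rmult_1_r in Hb by lra. auto. }
  set (y := lin2 (RtoC h) v' (RtoC h * RtoC h)%Cx zero3) in *.
  assert (Hy : n2 y <= 2 * (h * h) * n2 v').
  { eapply Rle_trans; [apply n2_lin_upper|]. unfold n2 at 2; unfold zero3, Cn2; simpl. lra. }
  assert (Hg : h <= gain A y).
  { unfold gain. pose proof (n2_ge0 y). unfold y at 1. rewrite dot_lin, Hv'. vec; simpl. lra. }
  exists y. split; [nra|]. split; [lra|].
  specialize (B1 h Hh). specialize (B2 h Hh). fold y in B1, B2.
  assert (eps * h <= eps * gain A y) by (apply Rmult_le_compat_l; lra).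
  split; (eapply Rle_trans; [eassumption|]); nra.
Qed.

Lemma jet_bound_second (F : poly 3) x v w : D1 F x v = C0 -> (D1 F x w + D2 F x v)%Cx = C0 ->
  exists M, 0 <= M /\ forall z, Cabs z <= 1 ->
  Cabs (peval F (vadd x (lin2 z v (z * z)%Cx w)) - peval F x)%Cx <= M * (Cabs z * Cabs z * Cabs z).
Proof.
  intros Hv Hw. destruct (peval_jet2 F x v w) as [M [HM H]].
  rewrite Hv, Hw in H. exists M. split; auto. intros z Hz. specialize (H z Hz).
  replace (peval F x + z * C0 + z * z * C0)%Cx with (peval F x) in H by ring. auto.
Qed.

(* Along [y = z v + z^2 w] both polynomials vary by O(|z|^3) while, for a suitable phase of [z],
   the gain is at least of order |z|^2. *)
Lemma ascends_second_order F1 F2 x A v w :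
  v <> zero3 -> D1 F1 x v = C0 -> D1 F2 x v = C0 -> dot3 A v = C0 ->
  (D1 F1 x w + D2 F1 x v)%Cx = C0 -> (D1 F2 x w + D2 F2 x v)%Cx = C0 -> ascends F1 F2 x A.
Proof.
  intros Hv H1 H2 HA G1 G2 eps rho He Hr.
  destruct (jet_bound_second F1 x v w H1 G1) as [M1 [HM1 B1]].
  destruct (jet_bound_second F2 x v w H2 G2) as [M2 [HM2 B2]].
  pose proof (n2_pos v Hv) as Hn. pose proof (n2_ge0 w) as Hw.
  (* The bounds on [h] serve three ends: the cubic change stays below [eps] times the gain, [n2 y]
     stays below [rho], and the z^2 w term costs at most half of the lower bound |z v|^2 / 2. *)
  destruct (small_pos (eps * n2 v / (8 * (M1 + M2 + 1))) (Rmin (rho / (4 * (n2 v + n2 w))) (n2 v / (4 * (n2 w + 1))))) as [h [Hh [Ha Hb]]].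
  { apply Rdiv_lt_0_compat; nra. }
  { apply Rmin_glb_lt; apply Rdiv_lt_0_compat; lra. }
  assert (Hb1 := Rle_trans _ _ _ Hb (Rmin_l _ _)). assert (Hb2 := Rle_trans _ _ _ Hb (Rmin_r _ _)).
  assert (Ha' : h * (8 * (M1 + M2 + 1)) <= eps * n2 v).
  { apply Rmult_le_compat_r with (r := 8 * (M1 + M2 + 1)) in Ha; [|lra].
    unfold Rdiv in Ha. rewrite Rmult_assoc, Rinv_l, Rmult_1_r in Ha by lra. auto. }
  assert (Hb1' : h * (4 * (n2 v + n2 w)) <= rho).
  { apply Rmult_le_compat_r with (r := 4 * (n2 v + n2 w)) in Hb1; [|lra].
    unfold Rdiv in Hb1. rewrite Rmult_assoc, Rinv_l, Rmult_1_r in Hb1 by lra. auto. }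
  assert (Hb2' : h * (4 * (n2 w + 1)) <= n2 v).
  { apply Rmult_le_compat_r with (r := 4 * (n2 w + 1)) in Hb2; [|lra].
    unfold Rdiv in Hb2. rewrite Rmult_assoc, Rinv_l, Rmult_1_r in Hb2 by lra. auto. }
  (* With z = h or z = i h the factor z^2 is h^2 or -h^2, whichever makes the linear term
     nonnegative. *)
  assert (Hz : exists z, Cabs z = h /\ 0 <= Cre (z * z * dot3 A w)%Cx).
  { generalize (dot3 A w); intros [a b]. assert (0 <= h * h) by nra. destruct (Rle_lt_dec 0 a).
    - exists (RtoC h). rewrite Cabs_RtoC, Rabs_right by lra. split; auto.
      simpl. nra.
    - exists (mkC 0 h). split.
      + unfold Cabs; simpl. replace (0 * 0 + h * h) with (Rsqr h) by (unfold Rsqr; ring). apply sqrt_Rsqr; lra.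
      + simpl. nra. }
  destruct Hz as [z [Hz Hre]].
  assert (Hcz : Cn2 z = h * h) by (rewrite <- Cabs_sqr, Hz; auto).
  set (y := lin2 z v (z * z)%Cx w) in *.
  assert (Hdot : Cre (dot3 A y) = Cre (z * z * dot3 A w)%Cx).
  { unfold y; rewrite dot_lin, HA. f_equal. ring. }
  pose proof (n2_lin_lower z v (z * z)%Cx w) as Hlo. pose proof (n2_lin_upper z v (z * z)%Cx w) as Hup.
  fold y in Hlo, Hup. rewrite Cn2_mul, Hcz in Hlo, Hup.
  assert (Hhh : 0 < h * h <= h) by (split; nra).
  assert (Hw1 : (h * h) * n2 w <= n2 v / 4).
  { assert (h * h * n2 w <= h * n2 w) by (apply Rmult_le_compat_r; lra). lra. }
  assert (Hw2 : h * h * (h * h) * n2 w <= h * h * (n2 v / 4)).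
  { rewrite Rmult_assoc. apply Rmult_le_compat_l; lra. }
  assert (Hlo' : h * h * n2 v / 4 <= n2 y) by lra.
  assert (Hg : h * h * n2 v / 8 <= gain A y) by (unfold gain; rewrite Hdot; lra).
  assert (Hpos : 0 < h * h * n2 v) by (apply Rmult_lt_0_compat; lra).
  exists y. split.
  { assert (h * h * n2 v <= h * n2 v) by (apply Rmult_le_compat_r; lra).
    assert (h * h * (h * h) * n2 w <= h * n2 w) by (apply Rmult_le_compat_r; nra).
    assert (0 < h * (n2 v + n2 w)) by (apply Rmult_lt_0_compat; lra). lra. }
  split; [lra|].
  assert (Hfin : forall M, M <= M1 + M2 -> M * (h * h * h) <= eps * gain A y).
  { intros M HM. apply Rle_trans with (eps * (h * h * n2 v / 8)).
    - assert (h * M <= eps * n2 v / 8) by nra.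
      replace (M * (h * h * h)) with (h * h * (h * M)) by ring.
      replace (eps * (h * h * n2 v / 8)) with (h * h * (eps * n2 v / 8)) by field.
      apply Rmult_le_compat_l; lra.
    - apply Rmult_le_compat_l; lra. }
  split.
  - eapply Rle_trans; [apply B1; lra|]. rewrite Hz. apply Hfin; lra.
  - eapply Rle_trans; [apply B2; lra|]. rewrite Hz. apply Hfin; lra.
Qed.

(** By the triple product, A . (l x conj(A x l)) = |A x l|^2, which is nonzero; [m] is a multiple of
    [l] and so kills [k] as well. *)
Lemma cross_nonparallel A l m k : cross A l <> zero3 -> cross l m = zero3 ->
  k = cross l (conj3 (cross A l)) -> dot3 l k = C0 /\ dot3 m k = C0 /\ dot3 A k <> C0.
Proof.
  intros HA Hlm ->.
  assert (Hl : l <> zero3).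
  { intros ->. apply HA. rewrite (V3_eta zero3). unfold cross, zero3; simpl.
    f_equal; ring. }
  destruct (cross0_parallel l m Hl Hlm) as [c ->].
  repeat split.
  - apply dot_cross_l.
  - unfold lin2. transitivity (c * dot3 l (cross l (conj3 (cross A l))))%Cx; [unfold dot3; ring|].
    rewrite dot_cross_l; ring.
  - rewrite dot_cross_rot. apply dot_conj_neq0'; auto.
Qed.

(** Critical case: a direction that kills the derivative of [F1] also kills [A]. The combination m1
    F2 - m2 F1 has zero derivative; take [v] in the two-dimensional kernel of [A], isotropic for its
    second order form. Then the [w] that cancels the second order term of [F1] cancels that of [F2]
    too. *)
Lemma ascends_parallel F1 F2 x A l m m1 m2 : A <> zero3 ->
  (forall v, D1 F1 x v = dot3 l v) -> (forall v, D1 F2 x v = dot3 m v) ->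
  l = lin2 m1 A C0 A -> m = lin2 m2 A C0 A -> m1 <> C0 -> ascends F1 F2 x A.
Proof.
  intros HA HD1 HD2 Hl Hm Hm1.
  assert (E1 : forall v, D1 F1 x v = (m1 * dot3 A v)%Cx) by (intros; rewrite HD1, Hl; vec; ring).
  assert (E2 : forall v, D1 F2 x v = (m2 * dot3 A v)%Cx) by (intros; rewrite HD2, Hm; vec; ring).
  destruct (dot_ker_basis A HA) as [e [f [He [Hf Hind]]]].
  destruct (D2_lin F1 x e f) as [a1 [b1 [c1 Q1]]]. destruct (D2_lin F2 x e f) as [a2 [b2 [c2 Q2]]].
  destruct (binary_form_zero (m1 * a2 - m2 * a1)%Cx (m1 * b2 - m2 * b1)%Cx (m1 * c2 - m2 * c1)%Cx)
    as [s [t [Hst H0]]].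
  set (v := lin2 s e t f). 
  assert (HAv : dot3 A v = C0) by (unfold v; rewrite dot_lin, He, Hf; ring).
  assert (HQ : (m1 * D2 F2 x v)%Cx = (m2 * D2 F1 x v)%Cx).
  { unfold v; rewrite Q1, Q2.
    transitivity (((m1 * a2 - m2 * a1) * (s * s) + (m1 * b2 - m2 * b1) * (s * t) + (m1 * c2 - m2 * c1) * (t * t))
      + m2 * (a1 * (s * s) + b1 * (s * t) + c1 * (t * t)))%Cx; [ring|]. rewrite H0; ring. }
  pose proof (dot_conj_neq0 A HA) as HN. set (Nn := dot3 A (conj3 A)) in *.
  set (w := lin2 (- D2 F1 x v / (m1 * Nn))%Cx (conj3 A) C0 (conj3 A)).
  assert (HAw2 : dot3 A w = (- D2 F1 x v / m1)%Cx).
  { unfold w. rewrite dot_lin. fold Nn. field. split; auto. }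
  apply ascends_second_order with v w; auto.
  - intros Hv0. apply Hind in Hv0. tauto.
  - rewrite E1, HAv; ring.
  - rewrite E2, HAv; ring.
  - rewrite E1, HAw2. field; auto.
  - rewrite E2, HAw2.
    transitivity ((m1 * D2 F2 x v - m2 * D2 F1 x v) / m1)%Cx; [field; auto|]. rewrite HQ. field; auto.
Qed.

(** If [A] is nonzero somewhere on the common kernel of the derivatives [l] and [m], first order
    suffices. Otherwise either [l] and [m] are independent, and one [w] can correct both second
    order terms, or both are multiples of [A], not both 0. *)
Lemma ascent_step F1 F2 x A : A <> zero3 -> ascends F1 F2 x A.
Proof.
  intros HA.
  destruct (D1_dot F1 x) as [l Hl]. destruct (D1_dot F2 x) as [m Hm].
  destruct (classic (cross l m = zero3)) as [Hc|Hc].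
  - destruct (classic (cross A l = zero3)) as [Al|Al].
    + destruct (classic (cross A m = zero3)) as [Am|Am].
      * destruct (cross0_parallel A l HA Al) as [m1 E1]. destruct (cross0_parallel A m HA Am) as [m2 E2].
        destruct (classic (m1 = C0)) as [Z1|Z1]; [destruct (classic (m2 = C0)) as [Z2|Z2]|].
        -- apply ascends_first_order with (conj3 A).
           ++ rewrite Hl, E1, Z1. vec; ring.
           ++ rewrite Hm, E2, Z2. vec; ring.
           ++ apply dot_conj_neq0; auto.
        -- apply ascends_sym, ascends_parallel with m l m2 m1; auto.
        -- apply ascends_parallel with l m m1 m2; auto.
      * assert (Hc' : cross m l = zero3).
        { apply functional_extensionality; intros i.
          transitivity (- cross l m i)%Cx; [revert i; apply fin3_ind; vec; ring|].
          rewrite Hc; vec; ring. }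
        destruct (cross_nonparallel A m l _ Am Hc' eq_refl) as [K1 [K2 K3]].
        apply ascends_first_order with (cross m (conj3 (cross A m))); auto; rewrite ?Hl, ?Hm; auto.
    + destruct (cross_nonparallel A l m _ Al Hc eq_refl) as [K1 [K2 K3]].
      apply ascends_first_order with (cross l (conj3 (cross A l))); auto; rewrite ?Hl, ?Hm; auto.
  - set (v := cross l m) in *.
    assert (lv : dot3 l v = C0) by apply dot_cross_l. assert (mv : dot3 m v = C0) by apply dot_cross_r.
    destruct (classic (dot3 A v = C0)) as [Av|Av].
    + pose proof (dot_conj_neq0' v Hc) as HN. set (Nn := dot3 (conj3 v) v) in *.
      (* Dual to [l] and [m] up to sign and the factor [Nn], so the two second order terms can be
         cancelled independently. *)
      set (w1 := cross m (conj3 v)). set (w2 := cross l (conj3 v)).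
      assert (lw1 : dot3 l w1 = Nn) by (unfold w1; rewrite dot_cross_rot; reflexivity).
      assert (mw1 : dot3 m w1 = C0) by apply dot_cross_l.
      assert (lw2 : dot3 l w2 = C0) by apply dot_cross_l.
      assert (mw2 : dot3 m w2 = (- Nn)%Cx) by (unfold w2, Nn, v; vec; ring).
      apply ascends_second_order with v (lin2 (- D2 F1 x v / Nn)%Cx w1 (D2 F2 x v / Nn)%Cx w2);
        rewrite ?Hl, ?Hm, ?dot_lin; auto.
      * rewrite lw1, lw2. field; auto.
      * rewrite mw1, mw2. field; auto.
    + apply ascends_first_order with v; rewrite ?Hl, ?Hm; auto.
Qed.

Lemma scont_le_limit {T} (d : T -> T -> R) (K : T -> Prop) f c y x : scont d K f -> K x ->
  (forall n, K (y n)) -> mcv d y x -> (forall n, f (y n) <= c) -> f x <= c.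
Proof.
  intros Hf Kx Ky Hy Hc. apply Rnot_lt_le; intros Hlt.
  destruct (Hf x y Kx Ky Hy (f x - c)) as [N HN]; [lra|].
  specialize (HN N (le_n _)). specialize (Hc N). unfold Rdist in HN. apply Rabs_def2 in HN. lra.
Qed.

Lemma mcv_subseq {T} (d : T -> T -> R) y x (phi : nat -> nat) : (forall n, (n <= phi n)%nat) ->
  mcv d y x -> mcv d (fun n => y (phi n)) x.
Proof. intros Hp H. apply (Un_cv_subseq (fun n => d x (y n))); auto. Qed.

(** * Squared distances to points of norm 2, and ascent to a small sphere *)

Definition vsub {N} (v w : Cn N) : Cn N := fun i => (v i - w i)%Cx.

Lemma dist3_sqr z w : dist_Cn 3 z w * dist_Cn 3 z w = n2 (vsub z w).
Proof.
  rewrite dist_Cn_nrm, nrm_sqr. unfold n2, vsub, i1, i2, i3. simpl fsum. rewrite !Cabs_sqr. ring.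
Qed.

(* [usq t z] is the squared distance from [z] to the centre [2 conj t], when [n2 t = 1]. *)
Definition usq (t z : Cn 3) : R := n2 z + 4 - 4 * Cre (dot3 t z).

Lemma Cre_dot_am a y : 2 * Cre (dot3 a y) <= n2 a + n2 y.
Proof.
  unfold n2, Cn2, dot3; simpl.
  assert (H : forall a b c d : R, 2 * (a * c - b * d) <= a * a + b * b + (c * c + d * d)).
  { intros p q s t. pose proof (Rle_0_sqr (p - s)); pose proof (Rle_0_sqr (q + t)). unfold Rsqr in *. nra. }
  pose proof (H (Cre (a i1)) (Cim (a i1)) (Cre (y i1)) (Cim (y i1))).
  pose proof (H (Cre (a i2)) (Cim (a i2)) (Cre (y i2)) (Cim (y i2))).
  pose proof (H (Cre (a i3)) (Cim (a i3)) (Cre (y i3)) (Cim (y i3))). lra.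
Qed.

Definition scal3 (s : R) (y : Cn 3) : Cn 3 := fun i => (RtoC s * y i)%Cx.

Lemma Cre_dot_scal a s y : Cre (dot3 a (scal3 s y)) = s * Cre (dot3 a y).
Proof. unfold dot3, scal3; simpl; ring. Qed.

Lemma n2_scal s y : n2 (scal3 s y) = s * s * n2 y.
Proof. unfold n2, scal3, Cn2; simpl; ring. Qed.

Lemma Rabs_Cre_dot a y D : n2 a <= 1 -> 0 <= D -> n2 y = D * D -> Rabs (Cre (dot3 a y)) <= D.
Proof.
  intros Ha HD Hy. destruct (Rle_lt_or_eq_dec _ _ HD) as [HD'|HD'].
  - assert (G : forall s, s * s = 1 -> s * Cre (dot3 a y) <= D).
    { intros s Hs. pose proof (Cre_dot_am a (scal3 (s / D) y)) as H.
      rewrite Cre_dot_scal, n2_scal, Hy in H.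
      replace (s / D * (s / D) * (D * D)) with (s * s) in H by (field; lra). rewrite Hs in H.
      assert (s / D * Cre (dot3 a y) <= 1) by lra.
      apply Rmult_le_compat_r with (r := D) in H0; [|lra].
      replace (s / D * Cre (dot3 a y) * D) with (s * Cre (dot3 a y)) in H0 by (field; lra). lra. }
    pose proof (G 1 ltac:(ring)). pose proof (G (-1) ltac:(ring)). apply Rabs_le; lra.
  - assert (y = zero3) as -> by (apply n2_eq0; nra).
    unfold dot3, zero3; simpl. replace (_ + _) with 0 by ring. rewrite Rabs_R0; lra.
Qed.

Lemma usq_range t z : n2 t = 1 -> n2 z <= 1 -> 0 <= usq t z <= 9.
Proof.
  intros Ht Hz. unfold usq. pose proof (n2_ge0 z).
  pose proof (Cre_dot_am t z). 
  pose proof (Cre_dot_am t (scal3 (-1) z)) as H1. rewrite Cre_dot_scal, n2_scal in H1.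
  (* The weight 1/2 gives 4 Re(t . z) <= 4 + n2 z, the nonnegativity of a squared distance. *)
  pose proof (Cre_dot_am t (scal3 (1/2) z)) as H2. rewrite Cre_dot_scal, n2_scal in H2.
  split; lra.
Qed.

Lemma usq_lip t z w : n2 t = 1 -> n2 z <= 1 -> n2 w <= 1 ->
  Rabs (usq t z - usq t w) <= 8 * dist_Cn 3 z w.
Proof.
  intros Ht Hz Hw. set (D := dist_Cn 3 z w).
  assert (HD : 0 <= D) by apply (met_ge0 _ (dist_Cn_metric 3)).
  assert (HDD : n2 (vsub z w) = D * D) by (symmetry; apply dist3_sqr).
  assert (Hc : forall x, n2 (conj3 x) = n2 x) by (intros; unfold n2, conj3, Cn2; simpl; ring).
  pose proof (Rabs_Cre_dot t _ D ltac:(lra) HD HDD) as A1.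
  pose proof (Rabs_Cre_dot (conj3 z) _ D ltac:(rewrite Hc; lra) HD HDD) as A2.
  pose proof (Rabs_Cre_dot (conj3 w) _ D ltac:(rewrite Hc; lra) HD HDD) as A3.
  assert (E : usq t z - usq t w = Cre (dot3 (conj3 z) (vsub z w)) + Cre (dot3 (conj3 w) (vsub z w))
     - 4 * Cre (dot3 t (vsub z w))).
  { unfold usq, n2, Cn2, dot3, conj3, vsub; simpl; ring. }
  rewrite E. apply Rabs_le_inv in A1, A2, A3. apply Rabs_le. lra.
Qed.

Lemma scont_n2 K (w : Cn 3) : scont (dist_Cn 3) K (fun z => n2 (vsub z w)).
Proof.
  assert (G : forall i, scont (dist_Cn 3) K (fun z => Cn2 (z i - w i)%Cx)).
  { intros i. destruct (scontC_sub _ K (fun z => z i) (fun _ => w i) (scontC_coord 3 K i) (scontC_const _ _ _)).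
    apply scont_add; apply scont_mul; auto. }
  unfold n2, vsub. apply scont_add; [apply scont_add|]; apply G.
Qed.

Lemma scont_usq K t : scont (dist_Cn 3) K (usq t).
Proof.
  unfold usq. apply scont_sub; [apply scont_add; [|apply scont_const]|].
  - eapply scont_ext; [|apply (scont_n2 K zero3)]. intros x _. unfold n2, vsub, zero3, Cn2; simpl; ring.
  - apply scont_mul; [apply scont_const|].
    assert (G : forall i, scontC (dist_Cn 3) K (fun z => t i * z i)%Cx).
    { intros i. apply scontC_mul; [apply scontC_const|apply scontC_coord]. }
    apply (scontC_add _ K _ _ (scontC_add _ K _ _ (G i1) (G i2)) (G i3)).
Qed.

Lemma scontC_poly K (p : poly 3) : scontC (dist_Cn 3) K (peval p).
Proof. apply (scontC_peval _ K 3 (fun z => z)). intros; apply scontC_coord. Qed.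

Lemma n2_coord z i : Cabs (z i) * Cabs (z i) <= n2 z.
Proof.
  rewrite Cabs_sqr. unfold n2. pose proof (Cn2_ge0 (z i1)); pose proof (Cn2_ge0 (z i2)); pose proof (Cn2_ge0 (z i3)).
  revert i. apply fin3_ind; lra.
Qed.

(** Maximise [phi] over the points of the ball at which both polynomials have changed by at most [e]
    times the rise of [phi]. A maximum inside the open ball would be improved by [ascent_step], so
    it lies on the sphere, where the subtracted |z - x0|^2 / 2 comes back as the gain r^2/2. *)
Lemma fibre_sphere (F1 F2 : poly 3) t x0 r eps : n2 t = 1 -> 0 < r -> n2 x0 <= 1 ->
  (forall z, n2 (vsub z x0) <= r * r -> n2 z <= 1) -> 0 < eps ->
  exists x, n2 (vsub x x0) = r * r /\ Cabs (peval F1 x - peval F1 x0)%Cx <= eps /\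
    Cabs (peval F2 x - peval F2 x0)%Cx <= eps /\ usq t x0 + r * r / 2 <= usq t x.
Proof.
  intros Ht Hr Hx0 Hball Heps.
  set (phi := fun z => usq t z - n2 (vsub z x0) / 2).
  (* [phi] rises by at most 9, so each polynomial changes by at most 9 e, which is below [eps]. *)
  set (e := eps / 10).
  set (S := fun z => n2 (vsub z x0) <= r * r /\
     Cabs (peval F1 z - peval F1 x0)%Cx - e * (phi z - phi x0) <= 0 /\
     Cabs (peval F2 z - peval F2 x0)%Cx - e * (phi z - phi x0) <= 0).
  set (top := fun _ : Cn 3 => True).
  assert (Cphi : scont (dist_Cn 3) top phi).
  { unfold phi. apply scont_sub; [apply scont_usq|]. apply scont_mul; [apply scont_n2|apply scont_const]. }
  assert (Cg : forall F : poly 3, scont (dist_Cn 3) top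
     (fun z => Cabs (peval F z - peval F x0)%Cx - e * (phi z - phi x0))).
  { intros F. apply scont_sub.
    - apply scont_Cabs, scontC_sub; [apply scontC_poly|apply scontC_const].
    - apply scont_mul; [apply scont_const|]. apply scont_sub; [auto|apply scont_const]. }
  assert (H00 : n2 (vsub x0 x0) = 0) by (unfold n2, vsub, Cn2; simpl; ring).
  assert (HS : cluster_compact (dist_Cn 3) S).
  { apply closed_bounded_compact with 1.
    - intros z [Hz _] i. pose proof (n2_coord z i). specialize (Hball z Hz). pose proof (Cabs_ge0 (z i)). nra.
    - intros z l Hz Hcv.
      assert (Hle : forall f, scont (dist_Cn 3) top f -> forall c, (forall n, f (z n) <= c) -> f l <= c).
      { intros f Hf c Hc. apply (scont_le_limit (dist_Cn 3) top f c z l); auto; unfold top; auto. }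
      split; [|split].
      + apply (Hle (fun z => n2 (vsub z x0))); [apply scont_n2|]. intros n; apply (Hz n).
      + apply (Hle _ (Cg F1)). intros n; apply (Hz n).
      + apply (Hle _ (Cg F2)). intros n; apply (Hz n). }
  assert (Sx0 : S x0).
  { split; [rewrite H00; nra|]. split.
    - replace (peval F1 x0 - peval F1 x0)%Cx with C0 by ring. rewrite Cabs_C0; lra.
    - replace (peval F2 x0 - peval F2 x0)%Cx with C0 by ring. rewrite Cabs_C0; lra. }
  destruct (scont_max_attained (dist_Cn 3) (dist_Cn_metric 3) S phi HS) as [x [Sx Hmax]].
  { eapply scont_subset; [|exact Cphi]. unfold top; auto. }
  { exists x0; auto. }
  destruct Sx as [Sx1 [Sx2 Sx3]].
  pose proof (Hball x Sx1) as Hx1.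
  assert (Hphi0 : phi x0 = usq t x0) by (unfold phi; rewrite H00; lra).
  assert (Hge : phi x0 <= phi x) by (apply Hmax; auto).
  assert (Hphi9 : phi x - phi x0 <= 9).
  { rewrite Hphi0. unfold phi. pose proof (usq_range t x Ht Hx1). pose proof (usq_range t x0 Ht Hx0).
    pose proof (n2_ge0 (vsub x x0)). lra. }
  assert (He : 0 < e) by (unfold e; lra).
  assert (Hsph : n2 (vsub x x0) = r * r).
  { apply Rle_antisym; auto. apply Rnot_lt_le; intros Hlt.
    (* Derivative of [phi] at [x]. It could vanish only if x + x0 = 4 conj t, a vector of norm 4,
       whereas [x] and [x0] lie in the unit ball. *)
    set (A := fun i => (Cconj (x i) + Cconj (x0 i) - RtoC 4 * t i)%Cx).
    assert (Hphi : forall y, phi (vadd x y) - phi x = gain A y).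
    { intros y. unfold phi, gain, usq, A, n2, Cn2, dot3, vadd, vsub; simpl. field. }
    assert (HA : A <> zero3).
    { intros HA. assert (E : n2 (vadd x x0) = 16 * n2 t).
      { assert (G : forall i, (x i + x0 i)%Cx = Cconj (RtoC 4 * t i)%Cx).
        { intros i. pose proof (f_equal (fun f => f i) HA) as G. unfold A, zero3 in G.
          pose proof (f_equal Cre G) as G1. pose proof (f_equal Cim G) as G2. simpl in G1, G2.
          apply C_ext; simpl; lra. }
        unfold n2, vadd. rewrite !G. unfold Cn2; simpl; ring. }
      assert (E2 : n2 (vadd x x0) <= 2 * n2 x + 2 * n2 x0).
      { unfold n2, vadd. pose proof (Cn2_add_upper (x i1) (x0 i1)). pose proof (Cn2_add_upper (x i2) (x0 i2)).
        pose proof (Cn2_add_upper (x i3) (x0 i3)). lra. }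
      lra. }
    set (D := dist_Cn 3 x x0).
    assert (HD : 0 <= D) by apply (met_ge0 _ (dist_Cn_metric 3)).
    assert (HDD : D * D = n2 (vsub x x0)) by apply dist3_sqr.
    assert (HDr : D < r) by nra.
    destruct (ascent_step F1 F2 x A HA e ((r - D) * (r - D)) He ltac:(nra)) as [y [Hy1 [Hy2 [Hy3 Hy4]]]].
    assert (HS' : S (vadd x y)).
    { assert (Hxy : phi (vadd x y) - phi x0 = (phi x - phi x0) + gain A y) by (rewrite <- Hphi; ring).
      split; [|split].
      - rewrite <- dist3_sqr.
        pose proof (met_tri _ (dist_Cn_metric 3) (vadd x y) x x0) as Htri. fold D in Htri.
        assert (Hyd : dist_Cn 3 (vadd x y) x * dist_Cn 3 (vadd x y) x = n2 y).
        { rewrite dist3_sqr. f_equal. apply functional_extensionality; intros i. unfold vsub, vadd; ring. }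
        pose proof (met_ge0 _ (dist_Cn_metric 3) (vadd x y) x).
        pose proof (met_ge0 _ (dist_Cn_metric 3) (vadd x y) x0).
        assert (dist_Cn 3 (vadd x y) x <= r - D) by (apply Rsqr_le_intro; lra).
        nra.
      - rewrite Hxy. pose proof (Cabs_triang (peval F1 (vadd x y)) (peval F1 x) (peval F1 x0)). lra.
      - rewrite Hxy. pose proof (Cabs_triang (peval F2 (vadd x y)) (peval F2 x) (peval F2 x0)). lra. }
    specialize (Hmax _ HS'). specialize (Hphi y). lra. }
  exists x. split; [auto|split; [|split]].
  - unfold e in *. nra.
  - unfold e in *. nra.
  - rewrite Hphi0 in Hge. unfold phi in Hge at 1. lra.
Qed.

(** * A totally disconnected set meeting the fibres through the origin *)

Fixpoint rr (m : nat) : R := match m with O => 1 / 128 | S m => rr m * rr m / 128 end.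

Lemma rr_range m : 0 < rr m <= 1 / 128.
Proof. induction m; simpl; [lra|]. nra. Qed.

Lemma rr_half m : 2 * rr (S m) <= rr m.
Proof. pose proof (rr_range m). simpl. nra. Qed.

Lemma rr_small e : 0 < e -> exists M, forall m, (M <= m)%nat -> rr m < e.
Proof.
  intros He.
  assert (H : forall m, rr m <= (1 / 2) ^ m).
  { induction m; simpl; [lra|]. pose proof (rr_half m). simpl in *. lra. }
  destruct (pow_small (1/2) e) as [M HM]; [lra|auto|]. exists M. intros m Hm.
  eapply Rle_lt_trans; [apply H|]. eapply Rle_lt_trans; [|exact HM].
  clear H HM. induction Hm; [lra|]. simpl. pose proof (pow_lt (1/2) m). lra.
Qed.

(** Indices 0 and 1 are opposite, so the sum and difference of their values of [usq] give |z|^2 and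
    Re z1; each remaining index then yields one further real coordinate. *)
Definition tau (j : nat) : Cn 3 :=
  match j with
  | 0 => V3 C1 C0 C0
  | 1 => V3 (- C1)%Cx C0 C0
  | 2 => V3 (mkC 0 (-1)) C0 C0
  | 3 => V3 C0 C1 C0
  | 4 => V3 C0 (mkC 0 (-1)) C0
  | 5 => V3 C0 C0 C1
  | _ => V3 C0 C0 (mkC 0 (-1))
  end%nat.

Lemma tau_unit j : n2 (tau j) = 1.
Proof. do 6 (destruct j; [unfold n2, Cn2; simpl; ring|]). unfold n2, Cn2; simpl; ring. Qed.

Definition um (m : nat) (z : Cn 3) : R := usq (tau (m mod 7)) z.

(* [um m] runs through seven squared distances which together determine the point; at stage [m] a gap
   of radius [rr m ^ 2 / 8] is removed around every multiple of [16 rr m]. *)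
Definition J (z : Cn 3) : Prop :=
  n2 z <= 1 /\ forall m k : nat, rr m * rr m / 8 <= Rabs (um m z - INR k * (16 * rr m)).

Lemma J_not_origin : ~ J zero3.
Proof.
  (* Every [um m] equals 4 at the origin, and 32 * 16 * rr 0 = 4: the origin is at the centre of a
     gap of stage 0. *)
  intros [_ H]. specialize (H O 32%nat). unfold um, usq, dot3, n2, zero3, Cn2 in H. simpl in H.
  revert H. replace (_ - _) with 0 by field. rewrite Rabs_R0. lra.
Qed.

Lemma J_compact : cluster_compact (dist_Cn 3) J.
Proof.
  apply closed_bounded_compact with 1.
  - intros z [Hz _] i. pose proof (n2_coord z i). pose proof (Cabs_ge0 (z i)). nra.
  - intros z l Hz Hcv. set (top := fun _ : Cn 3 => True). split.
    + assert (H : n2 (vsub l zero3) <= 1).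
      { apply (scont_le_limit (dist_Cn 3) top (fun z => n2 (vsub z zero3)) 1 z l); unfold top; auto.
        - apply scont_n2.
        - intros n. destruct (Hz n) as [H _]. unfold n2, vsub, zero3, Cn2 in *; simpl; lra. }
      unfold n2, vsub, zero3, Cn2 in *; simpl in *; lra.
    + intros m k.
      assert (H : - Rabs (um m l - INR k * (16 * rr m)) <= - (rr m * rr m / 8)); [|lra].
      apply (scont_le_limit (dist_Cn 3) top (fun z => - Rabs (um m z - INR k * (16 * rr m))) _ z l); unfold top; auto.
      * apply scont_ext with (fun z => 0 - Rabs (um m z - INR k * (16 * rr m))); [intros; ring|].
        apply scont_sub; [apply scont_const|]. apply scont_abs, scont_sub; [apply scont_usq|apply scont_const].
      * intros n. destruct (Hz n) as [_ H]. specialize (H m k). lra.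
Qed.

Lemma walk_step (q f : poly 3) m x e : dist_Cn 3 zero3 x <= 1 / 2 -> 0 < e ->
  exists x', dist_Cn 3 x x' <= rr m /\ Cabs (peval q x' - peval q x)%Cx <= e /\
    Cabs (peval f x' - peval f x)%Cx <= e /\
    forall k : nat, rr m * rr m / 4 <= Rabs (um m x' - INR k * (16 * rr m)).
Proof.
  intros Hx He. pose proof (rr_range m) as Hr. set (r := rr m) in *.
  destruct (classic (forall k : nat, r * r / 4 <= Rabs (um m x - INR k * (16 * r)))) as [H|H].
  - exists x. rewrite (met_refl _ (dist_Cn_metric 3)). split; [lra|].
    replace (peval q x - peval q x)%Cx with C0 by ring. replace (peval f x - peval f x)%Cx with C0 by ring.
    rewrite Cabs_C0. repeat split; auto; lra.
  - apply not_all_ex_not in H. destruct H as [k Hk]. apply Rnot_le_lt in Hk. apply Rabs_def2 in Hk.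
    assert (Hn0 : forall z, n2 z = dist_Cn 3 zero3 z * dist_Cn 3 zero3 z).
    { intros z. rewrite dist3_sqr. unfold n2, vsub, zero3, Cn2; simpl; ring. }
    assert (Hball : forall z, n2 (vsub z x) <= r * r -> n2 z <= 1).
    { intros z Hz. rewrite <- dist3_sqr in Hz. rewrite Hn0.
      pose proof (met_ge0 _ (dist_Cn_metric 3) z x). pose proof (met_ge0 _ (dist_Cn_metric 3) zero3 z).
      assert (dist_Cn 3 z x <= r) by (apply Rsqr_le_intro; lra).
      pose proof (met_tri _ (dist_Cn_metric 3) zero3 x z) as Ht. rewrite (met_sym _ (dist_Cn_metric 3) x z) in Ht.
      nra. }
    assert (Hx1 : n2 x <= 1).
    { rewrite Hn0. pose proof (met_ge0 _ (dist_Cn_metric 3) zero3 x). nra. }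
    destruct (fibre_sphere q f (tau (m mod 7)) x r e (tau_unit _) ltac:(lra) Hx1 Hball He)
      as [x' [H1 [H2 [H3 H4]]]].
    assert (Hd : dist_Cn 3 x' x = r).
    { rewrite <- dist3_sqr in H1. apply Rsqr_eq_intro; auto; [apply (met_ge0 _ (dist_Cn_metric 3))|lra]. }
    exists x'. rewrite (met_sym _ (dist_Cn_metric 3)), Hd. split; [lra|]. split; auto. split; auto.
    intros k'. fold (um m x) in H4. fold (um m x') in H4.
    pose proof (usq_lip (tau (m mod 7)) x' x (tau_unit _) (Hball x' ltac:(lra)) Hx1) as HL.
    fold (um m x) in HL. fold (um m x') in HL. rewrite Hd in HL. apply Rabs_le_inv in HL.
    assert (Hrr : r * r <= r / 128) by nra.
    (* For centres up to the offending one the gain r^2/2 decides; for later ones, the Lipschitz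
       bound 8 r against the spacing 16 r. *)
    destruct (Nat.le_gt_cases k' k) as [Hkk|Hkk].
    + apply le_INR in Hkk. rewrite Rabs_right; nra.
    + assert (INR k + 1 <= INR k') by (rewrite <- S_INR; apply le_INR; lia).
      rewrite Rabs_left; nra.
Qed.

(** The point is a limit of a walk from 0 whose stage [m] clears the gaps of stage [m]; tolerances
    eps / 2^(m+1) keep the total drift of both polynomials below [eps]. *)
Lemma J_meets_fibres (q f : poly 3) eps : 0 < eps -> exists x, J x /\
  Cabs (peval q x - peval q zero3)%Cx <= eps /\ Cabs (peval f x - peval f zero3)%Cx <= eps.
Proof.
  intros He.
  assert (Hpow : forall m, 0 < eps * (1/2)^(S m)) by (intros m; apply Rmult_lt_0_compat; auto; apply pow_lt; lra).
  assert (Hc : forall mx : nat * Cn 3, exists x', dist_Cn 3 zero3 (snd mx) <= 1 / 2 ->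
    dist_Cn 3 (snd mx) x' <= rr (fst mx) /\ Cabs (peval q x' - peval q (snd mx))%Cx <= eps * (1/2)^(S (fst mx)) /\
    Cabs (peval f x' - peval f (snd mx))%Cx <= eps * (1/2)^(S (fst mx)) /\
    forall k : nat, rr (fst mx) * rr (fst mx) / 4 <= Rabs (um (fst mx) x' - INR k * (16 * rr (fst mx)))).
  { intros [m x]; simpl fst; simpl snd.
    destruct (classic (dist_Cn 3 zero3 x <= 1/2)) as [H|H].
    - destruct (walk_step q f m x _ H (Hpow m)) as [x' Hx']. exists x'; auto.
    - exists x; tauto. }
  apply choice in Hc. destruct Hc as [g Hg].
  set (x := fix x m := match m with O => zero3 | S m => g (m, x m) end).
  pose proof (dist_Cn_metric 3) as Hmet.
  (* Tight at the start, since 2 * rr 0 = 1/64; [rr_half] lets the bound absorb each move, and it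
     keeps the walk in the region where [walk_step] applies. *)
  assert (Hx0 : forall m, dist_Cn 3 zero3 (x m) <= 1 / 64 - 2 * rr m).
  { induction m.
    - simpl. rewrite (met_refl _ Hmet). lra.
    - pose proof (rr_range m). pose proof (rr_half m).
      destruct (Hg (m, x m)) as [H1 _]; [simpl; lra|]. simpl fst in H1; simpl snd in H1.
      pose proof (met_tri _ Hmet zero3 (x m) (x (S m))). change (g (m, x m)) with (x (S m)) in H1. lra. }
  assert (Hstep : forall m, dist_Cn 3 (x m) (x (S m)) <= rr m /\
     Cabs (peval q (x (S m)) - peval q (x m))%Cx <= eps * (1/2)^(S m) /\
     Cabs (peval f (x (S m)) - peval f (x m))%Cx <= eps * (1/2)^(S m) /\
     forall k : nat, rr m * rr m / 4 <= Rabs (um m (x (S m)) - INR k * (16 * rr m))).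
  { intros m. apply (Hg (m, x m)). simpl. specialize (Hx0 m). pose proof (rr_range m). lra. }
  assert (Hdist : forall a b, dist_Cn 3 (x a) (x (a + b)%nat) <= 2 * rr a - 2 * rr (a + b)).
  { intros a b. induction b.
    - rewrite Nat.add_0_r, (met_refl _ Hmet). lra.
    - rewrite Nat.add_succ_r. destruct (Hstep (a + b)%nat) as [H1 _].
      pose proof (met_tri _ Hmet (x a) (x (a + b)%nat) (x (S (a + b)))). pose proof (rr_half (a + b)). lra. }
  assert (Herr : forall p : poly 3, (forall m, Cabs (peval p (x (S m)) - peval p (x m))%Cx <= eps * (1/2)^(S m)) ->
     forall m, Cabs (peval p (x m) - peval p zero3)%Cx <= eps).
  { intros p Hp m. apply Rle_trans with (eps * (1 - (1/2)^m)).
    - induction m.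
      + simpl. replace (_ - _)%Cx with C0 by ring. rewrite Cabs_C0. lra.
      + pose proof (Cabs_triang (peval p (x (S m))) (peval p (x m)) (peval p zero3)). specialize (Hp m).
        change ((1/2)^(S m)) with (1/2 * (1/2)^m) in *. lra.
    - pose proof (pow_lt (1/2) m ltac:(lra)). nra. }
  assert (Hn2 : forall m, n2 (x m) <= 1).
  { intros m. specialize (Hx0 m). pose proof (rr_range m). pose proof (met_ge0 _ Hmet zero3 (x m)).
    assert (n2 (x m) = dist_Cn 3 zero3 (x m) * dist_Cn 3 zero3 (x m)) as ->.
    { rewrite dist3_sqr. unfold n2, vsub, zero3, Cn2; simpl; ring. }
    nra. }
  set (top := fun _ : Cn 3 => True).
  assert (Hball : cluster_compact (dist_Cn 3) (fun z => n2 z <= 1)).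
  { apply closed_bounded_compact with 1.
    - intros z Hz i. pose proof (n2_coord z i). pose proof (Cabs_ge0 (z i)). nra.
    - intros z l Hz Hcv.
      assert (H : n2 (vsub l zero3) <= 1).
      { apply (scont_le_limit (dist_Cn 3) top (fun z => n2 (vsub z zero3)) 1 z l); unfold top; auto.
        - apply scont_n2.
        - intros n. specialize (Hz n). unfold n2, vsub, zero3, Cn2 in *; simpl; lra. }
      unfold n2, vsub, zero3, Cn2 in *; simpl in *; lra. }
  destruct (cluster_compact_subseq _ Hmet _ x Hball Hn2) as [phi [l [Hphi [Hl Hcv]]]].
  exists l. split; [split; auto|].
  - intros m k.
    assert (H : - Rabs (um m l - INR k * (16 * rr m)) <= - (rr m * rr m / 8)); [|lra].
    (* Shifting by [S m] leaves only points reached after stage [m], when the gaps of that stage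
       have been cleared. *)
    apply (scont_le_limit (dist_Cn 3) top (fun z => - Rabs (um m z - INR k * (16 * rr m))) _
      (fun n => x (phi (n + S m)%nat)) l); unfold top; auto.
    + apply scont_ext with (fun z => 0 - Rabs (um m z - INR k * (16 * rr m))); [intros; ring|].
      apply scont_sub; [apply scont_const|]. apply scont_abs, scont_sub; [apply scont_usq|apply scont_const].
    + apply (mcv_subseq _ (fun n => x (phi n)) l (fun n => (n + S m)%nat)); auto. intros; lia.
    + intros n. set (p := phi (n + S m)%nat).
      assert (Hp : (S m <= p)%nat) by (unfold p; specialize (Hphi (n + S m)%nat); lia).
      destruct (Hstep m) as [_ [_ [_ Hk]]]. specialize (Hk k).
      pose proof (Hdist (S m) (p - S m)%nat) as HD. replace (S m + (p - S m))%nat with p in HD by lia.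
      pose proof (usq_lip (tau (m mod 7)) (x (S m)) (x p) (tau_unit _) (Hn2 _) (Hn2 _)) as HL.
      fold (um m (x (S m))) in HL. fold (um m (x p)) in HL.
      pose proof (Rabs_triang (um m (x (S m)) - um m (x p)) (um m (x p) - INR k * (16 * rr m))) as HT.
      replace (um m (x (S m)) - um m (x p) + (um m (x p) - INR k * (16 * rr m))) with
        (um m (x (S m)) - INR k * (16 * rr m)) in HT by ring.
      pose proof (rr_range p). assert (rr (S m) = rr m * rr m / 128) by reflexivity. lra.
  - assert (G : forall p : poly 3, (forall m, Cabs (peval p (x m) - peval p zero3)%Cx <= eps) ->
      Cabs (peval p l - peval p zero3)%Cx <= eps).
    { intros p Hp. apply (scont_le_limit (dist_Cn 3) top (fun z => Cabs (peval p z - peval p zero3)%Cx) eps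
        (fun n => x (phi n)) l); unfold top; auto.
      apply scont_Cabs, scontC_sub; [apply scontC_poly|apply scontC_const]. }
    split; apply G, Herr; intros m; apply Hstep.
Qed.

(** * A totally disconnected set in C^3 with nontrivial hull and dense invertibles *)

Definition bounded_by {N} (M : R) (z : Cn N) : Prop := forall i, Cabs (z i) <= M.

Lemma poly_bounded {N} (p : poly N) M : exists B, 0 <= B /\ forall z, bounded_by M z -> Cabs (peval p z) <= B.
Proof.
  induction p as [c|i|p [B [HB H]] q [B' [HB' H']]|p [B [HB H]] q [B' [HB' H']]]; simpl.
  - exists (Cabs c). split; [apply Cabs_ge0|]. intros; lra.
  - exists (Rabs M). split; [apply Rabs_pos|]. intros z Hz. eapply Rle_trans; [apply Hz|apply Rle_abs].
  - exists (B + B'). split; [lra|]. intros z Hz. specialize (H z Hz). specialize (H' z Hz).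
    eapply Rle_trans; [apply Cabs_add|]. lra.
  - exists (B * B'). split; [nra|]. intros z Hz. specialize (H z Hz). specialize (H' z Hz).
    rewrite Cabs_mul. apply Rmult_le_compat; auto; apply Cabs_ge0.
Qed.

(** * A countable dense family of polynomials *)

Definition Qdec (n : nat) : R :=
  let (a, m) := Cantor.of_nat n in let (b, c) := Cantor.of_nat m in (INR a - INR b) / (INR c + 1).

Definition Cdec (n : nat) : C := let (a, b) := Cantor.of_nat n in mkC (Qdec a) (Qdec b).

Lemma Z_as_nat_diff z : exists a b : nat, IZR z = INR a - INR b.
Proof.
  destruct z.
  - exists O, O. simpl; lra.
  - exists (Pos.to_nat p), O. rewrite INR_IZR_INZ, Znat.positive_nat_Z. simpl; lra.
  - exists O, (Pos.to_nat p). rewrite (INR_IZR_INZ (Pos.to_nat p)), Znat.positive_nat_Z. simpl.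
    replace (Z.neg p) with (- Z.pos p)%Z by reflexivity. rewrite opp_IZR. lra.
Qed.

Lemma Qdec_dense x e : 0 < e -> exists n, Rabs (Qdec n - x) <= e.
Proof.
  intros He. destruct (inv_INR_small e He) as [c Hc]. specialize (Hc c (le_n _)).
  pose proof (inv_INR_pos c) as Hp.
  assert (Hc1 : 0 < INR c + 1) by (pose proof (pos_INR c); lra).
  destruct (archimed (x * (INR c + 1))) as [A1 A2].
  destruct (Z_as_nat_diff (up (x * (INR c + 1)))) as [a [b Hab]].
  exists (Cantor.to_nat (a, Cantor.to_nat (b, c))).
  unfold Qdec. rewrite !Cantor.cancel_of_to. rewrite <- Hab.
  assert (E : IZR (up (x * (INR c + 1))) / (INR c + 1) - x =
     (IZR (up (x * (INR c + 1))) - x * (INR c + 1)) * / (INR c + 1)) by (field; lra).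
  rewrite E. apply Rabs_le. set (d := IZR _ - _) in *. assert (0 < d <= 1) by (unfold d in *; lra).
  split; nra.
Qed.

Lemma Cdec_dense z e : 0 < e -> exists n, Cabs (Cdec n - z)%Cx <= e.
Proof.
  intros He. destruct (Qdec_dense (Cre z) (e/2)) as [a Ha]; [lra|].
  destruct (Qdec_dense (Cim z) (e/2)) as [b Hb]; [lra|].
  exists (Cantor.to_nat (a, b)). unfold Cdec. rewrite Cantor.cancel_of_to.
  eapply Rle_trans; [apply Cabs_le_re_im|]. simpl. lra.
Qed.

(** [k] bounds the depth of the syntax tree and [n] codes it; the tag [t] selects the constructor,
    and depth 0 yields a dummy. *)
Fixpoint penum (k n : nat) : poly 3 :=
  match k with
  | O => PConst C0
  | S k => let (t, m) := Cantor.of_nat n in let (a, b) := Cantor.of_nat m in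
    match t with
    | 0 => PConst (Cdec m)
    | 1 => PVar i1
    | 2 => PVar i2
    | 3 => PVar i3
    | 4 => PAdd (penum k a) (penum k b)
    | _ => PMul (penum k a) (penum k b)
    end%nat
  end.

(** Stated for all depths from some [d] on, so that both arguments of a sum or product can be taken
    at the same depth. *)
Lemma penum_dense (p : poly 3) M : exists d, forall k, (d <= k)%nat -> forall e, 0 < e ->
  exists n, forall z, bounded_by M z -> Cabs (peval (penum k n) z - peval p z)%Cx <= e.
Proof.
  induction p as [c|i|p [d Hp] q [d' Hq]|p [d Hp] q [d' Hq]].
  - exists 1%nat. intros [|k] Hk e He; [lia|]. destruct (Cdec_dense c e He) as [m Hm].
    exists (Cantor.to_nat (0%nat, m)). intros z _. cbn [penum]. rewrite Cantor.cancel_of_to.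
    destruct (Cantor.of_nat m) eqn:E. simpl. auto.
  - exists 1%nat. intros [|k] Hk e He; [lia|].
    assert (G : forall x : C, Cabs (x - x)%Cx <= e).
    { intros x. replace (x - x)%Cx with C0 by ring. rewrite Cabs_C0; lra. }
    revert i. apply fin3_ind;
    [exists (Cantor.to_nat (1%nat, O))|exists (Cantor.to_nat (2%nat, O))|exists (Cantor.to_nat (3%nat, O))];
    intros z _; cbn [penum]; rewrite Cantor.cancel_of_to; apply G.
  - exists (S (max d d')). intros [|k] Hk e He; [lia|].
    destruct (Hp k ltac:(lia) (e/2)) as [a Ha]; [lra|]. destruct (Hq k ltac:(lia) (e/2)) as [b Hb]; [lra|].
    exists (Cantor.to_nat (4%nat, Cantor.to_nat (a, b))). intros z Hz. cbn [penum].
    rewrite !Cantor.cancel_of_to. simpl. specialize (Ha z Hz). specialize (Hb z Hz).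
    set (x := peval (penum k a) z) in *. set (y := peval (penum k b) z) in *.
    replace (x + y - (peval p z + peval q z))%Cx with ((x - peval p z) + (y - peval q z))%Cx by ring.
    eapply Rle_trans; [apply Cabs_add|]. lra.
  - exists (S (max d d')). intros [|k] Hk e He; [lia|].
    destruct (poly_bounded p M) as [B [HB0 HB]]. destruct (poly_bounded q M) as [B' [HB0' HB']].
    destruct (small_pos (e / (B + B' + 1)) 1) as [h [Hh [Hh1 _]]]; [apply Rdiv_lt_0_compat; lra|lra|].
    assert (Hh2 : h * (B + B' + 1) <= e).
    { apply Rmult_le_compat_r with (r := B + B' + 1) in Hh1; [|lra].
      unfold Rdiv in Hh1. rewrite Rmult_assoc, Rinv_l, Rmult_1_r in Hh1 by lra. auto. }
    destruct (Hp k ltac:(lia) h) as [a Ha]; [lra|]. destruct (Hq k ltac:(lia) h) as [b Hb]; [lra|].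
    exists (Cantor.to_nat (5%nat, Cantor.to_nat (a, b))). intros z Hz. cbn [penum].
    rewrite !Cantor.cancel_of_to. simpl. specialize (Ha z Hz). specialize (Hb z Hz).
    specialize (HB z Hz). specialize (HB' z Hz).
    set (x := peval (penum k a) z) in *. set (y := peval (penum k b) z) in *.
    replace (x * y - peval p z * peval q z)%Cx with
      ((x - peval p z) * (y - peval q z) + (x - peval p z) * peval q z + peval p z * (y - peval q z))%Cx by ring.
    eapply Rle_trans; [apply Cabs_add|]. eapply Rle_trans; [apply Rplus_le_compat_r, Cabs_add|].
    rewrite !Cabs_mul. pose proof (Cabs_ge0 (x - peval p z)%Cx). pose proof (Cabs_ge0 (y - peval q z)%Cx).
    pose proof (Cabs_ge0 (peval p z)). pose proof (Cabs_ge0 (peval q z)).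
    assert (Cabs (x - peval p z)%Cx * Cabs (y - peval q z)%Cx <= h * 1) by (apply Rmult_le_compat; lra).
    assert (Cabs (x - peval p z)%Cx * Cabs (peval q z) <= h * B') by (apply Rmult_le_compat; lra).
    assert (Cabs (peval p z) * Cabs (y - peval q z)%Cx <= B * h) by (apply Rmult_le_compat; lra).
    lra.
Qed.

(** * Nested half-plane conditions and approximate inverses *)

Fixpoint ppow {N} (p : poly N) (m : nat) : poly N :=
  match m with O => PConst C1 | S m => PMul p (ppow p m) end.

Lemma peval_ppow {N} (p : poly N) m z : peval (ppow p m) z = Cpow (peval p z) m.
Proof. induction m; simpl; auto. rewrite IHm; auto. Qed.

Lemma Cpow_C1 m : Cpow C1 m = C1.
Proof. induction m; simpl; auto. rewrite IHm; ring. Qed.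

Lemma J_bounded z : J z -> bounded_by 1 z.
Proof. intros [Hz _] i. pose proof (n2_coord z i). pose proof (Cabs_ge0 (z i)). nra. Qed.

Lemma Cabs_pow_even w k m : Cn2 w <= k -> Cabs (Cpow w (2 * m)) <= k ^ m.
Proof.
  intros H. rewrite Cabs_Cpow, pow_mult. simpl (Cabs w ^ 2). rewrite Rmult_1_r, Cabs_sqr.
  apply pow_incr. split; [apply Cn2_ge0|auto].
Qed.

(* Where [Re q < 1/2], the base [1 + (q - 1)/rho] has modulus bounded by a constant less than 1, so
   that a high power of it beats any upper bound of [p]. *)
Lemma half_plane_refine (q p : poly 3) : exists E : poly 3,
  (peval q zero3 = C1 -> peval E zero3 = C1) /\
  forall x, J x -> 1 / 2 <= Cre (peval p x * peval E x)%Cx -> 1 / 2 <= Cre (peval q x).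
Proof.
  destruct (poly_bounded (PAdd q (PConst (- C1)%Cx)) 1) as [R [HR HRb]].
  destruct (poly_bounded p 1) as [B [HB HBb]].
  (* With w = q - 1, |w| <= R and Re w <= -1/2 give |1 + w/rho|^2 <= 1 - 1/rho + (rho - 1)/rho^2 = 1
     - 1/rho^2, the constant [k]. It bounds a squared modulus, whence the even exponent below. *)
  set (rho := R * R + 1). assert (Hrho : 1 <= rho) by (unfold rho; nra).
  set (k := 1 - / rho * / rho).
  assert (Hirho : 0 < / rho <= 1).
  { split; [apply Rinv_0_lt_compat; lra|]. rewrite <- Rinv_1. apply Rinv_le_contravar; lra. }
  assert (Hk : 0 <= k < 1) by (unfold k; split; nra).
  destruct (pow_small k (/ (2 * (B + 1)))) as [m Hm]; auto.
  { apply Rinv_0_lt_compat; lra. }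
  exists (ppow (PAdd (PConst C1) (PMul (PConst (RtoC (/ rho))) (PAdd q (PConst (- C1)%Cx)))) (2 * m)).
  split.
  - intros Hq. rewrite peval_ppow. simpl peval. rewrite Hq.
    replace (C1 + RtoC (/ rho) * (C1 + - C1))%Cx with C1 by ring. apply Cpow_C1.
  - intros x Jx Hx. apply Rnot_lt_le; intros Hlt.
    specialize (HRb x (J_bounded x Jx)). specialize (HBb x (J_bounded x Jx)).
    rewrite peval_ppow in Hx. simpl peval in Hx, HRb.
    set (w := (peval q x + - C1)%Cx) in *.
    assert (Hw : Cn2 (C1 + RtoC (/ rho) * w)%Cx <= k).
    { assert (E : Cn2 (C1 + RtoC (/ rho) * w)%Cx = 1 + 2 * / rho * Cre w + / rho * / rho * Cn2 w)
        by (unfold Cn2, RtoC; simpl; ring).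
      assert (Hn : Cn2 w <= R * R) by (rewrite <- Cabs_sqr; pose proof (Cabs_ge0 w); nra).
      assert (Hre : Cre w <= - (1 / 2)) by (unfold w; simpl; lra).
      assert (X1 : / rho * / rho * Cn2 w <= / rho * / rho * (R * R)) by (apply Rmult_le_compat_l; nra).
      assert (X2 : / rho * / rho * (R * R) = / rho - / rho * / rho).
      { replace (R * R) with (rho - 1) by (unfold rho; ring). field. lra. }
      assert (X3 : 2 * / rho * Cre w <= - / rho) by nra.
      rewrite E. unfold k. lra. }
    pose proof (Cabs_pow_even _ _ m Hw) as HP.
    set (W := Cpow (C1 + RtoC (/ rho) * w)%Cx (2 * m)) in *.
    assert (Hfin : Cabs (peval p x * W)%Cx < 1 / 2).
    { rewrite Cabs_mul.
      apply Rle_lt_trans with (B * / (2 * (B + 1))).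
      - apply Rmult_le_compat; auto; try apply Cabs_ge0. lra.
      - apply Rmult_lt_reg_r with (2 * (B + 1)); [lra|].
        rewrite Rmult_assoc, Rinv_l by lra. lra. }
    pose proof (Rabs_Cre (peval p x * W)%Cx). pose proof (Rle_abs (Cre (peval p x * W)%Cx)). lra.
Qed.

(** Partial sum a * (1 + (1 - a q) + (1 - a q)^2 + ...) of the Neumann series for 1/q. *)
Fixpoint geom {N} (q : poly N) (a : C) (m : nat) : poly N :=
  match m with
  | O => PConst C0
  | S m => PAdd (PConst a) (PMul (PAdd (PConst C1) (PMul (PConst (- a)%Cx) q)) (geom q a m))
  end.

Lemma geom_spec {N} (q : poly N) a m z :
  (C1 - peval q z * peval (geom q a m) z)%Cx = Cpow (C1 - a * peval q z)%Cx m.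
Proof.
  induction m; simpl; [ring|]. rewrite <- IHm. ring.
Qed.

(** Where Re q >= 1/2, the modulus of 1 - q/rho is bounded away from 1 by the computation of
    [half_plane_refine], so the Neumann series converges uniformly there. *)
Lemma half_plane_invertible (q : poly 3) e : 0 < e -> exists h : poly 3,
  forall x, J x -> 1 / 2 <= Cre (peval q x) -> Cabs (C1 - peval q x * peval h x)%Cx <= e.
Proof.
  intros He. destruct (poly_bounded q 1) as [R [HR HRb]].
  set (rho := R * R + 1). assert (Hrho : 1 <= rho) by (unfold rho; nra).
  set (k := 1 - / rho * / rho).
  assert (Hirho : 0 < / rho <= 1).
  { split; [apply Rinv_0_lt_compat; lra|]. rewrite <- Rinv_1. apply Rinv_le_contravar; lra. }
  assert (Hk : 0 <= k < 1) by (unfold k; split; nra).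
  destruct (pow_small k e) as [m Hm]; auto.
  exists (geom q (RtoC (/ rho)) (2 * m)). intros x Jx Hx. specialize (HRb x (J_bounded x Jx)).
  rewrite geom_spec. eapply Rle_trans; [apply Cabs_pow_even with (k := k)|lra].
  set (w := peval q x) in *.
  assert (E : Cn2 (C1 - RtoC (/ rho) * w)%Cx = 1 - 2 * / rho * Cre w + / rho * / rho * Cn2 w)
    by (unfold Cn2, RtoC; simpl; ring).
  assert (Hn : Cn2 w <= R * R) by (rewrite <- Cabs_sqr; pose proof (Cabs_ge0 w); nra).
  assert (X1 : / rho * / rho * Cn2 w <= / rho * / rho * (R * R)) by (apply Rmult_le_compat_l; nra).
  assert (X2 : / rho * / rho * (R * R) = / rho - / rho * / rho).
  { replace (R * R) with (rho - 1) by (unfold rho; ring). field. lra. }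
  assert (X3 : / rho <= 2 * / rho * Cre w) by nra.
  rewrite E. unfold k. lra.
Qed.

Definition approx_inv (X : Cn 3 -> Prop) (p : poly 3) : Prop :=
  forall e, 0 < e -> exists h : poly 3, forall x, X x -> Cabs (C1 - peval p x * peval h x)%Cx <= e.

Lemma refined_subset (p : nat -> poly 3) : (forall k, peval (p k) zero3 = C1) ->
  exists X : Cn 3 -> Prop, (forall x, X x -> J x) /\ cluster_compact (dist_Cn 3) X /\
    poly_hull X zero3 /\ forall k, approx_inv X (p k).
Proof.
  intros Hp0.
  destruct (choice _ (fun qp : poly 3 * poly 3 => half_plane_refine (fst qp) (snd qp))) as [nx Hnx].
  set (qs := fix qs k := match k with O => PConst C1 | S k => PMul (p k) (nx (qs k, p k)) end).
  assert (Hq0 : forall k, peval (qs k) zero3 = C1).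
  { induction k; simpl; auto. destruct (Hnx (qs k, p k)) as [H _]. simpl in H.
    rewrite H, Hp0 by auto. ring. }
  assert (Hnest : forall k x, J x -> 1/2 <= Cre (peval (qs (S k)) x) -> 1/2 <= Cre (peval (qs k) x)).
  { intros k x Jx Hx. destruct (Hnx (qs k, p k)) as [_ H]. apply (H x Jx Hx). }
  assert (Hnest' : forall j k x, J x -> 1/2 <= Cre (peval (qs (j + k)%nat) x) -> 1/2 <= Cre (peval (qs k) x)).
  { induction j; intros k x Jx Hx; auto. }
  set (X := fun x => J x /\ forall k, 1/2 <= Cre (peval (qs k) x)).
  set (top := fun _ : Cn 3 => True).
  assert (Hlim : forall k y l, mcv (dist_Cn 3) y l -> (forall n, 1/2 <= Cre (peval (qs k) (y n))) ->
     1/2 <= Cre (peval (qs k) l)).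
  { intros k y l Hcv Hy. assert (- Cre (peval (qs k) l) <= - (1/2)); [|lra].
    apply (scont_le_limit (dist_Cn 3) top (fun z => - Cre (peval (qs k) z)) _ y l); unfold top; auto.
    - apply scont_ext with (fun z => 0 - Cre (peval (qs k) z)); [intros; ring|].
      apply scont_sub; [apply scont_const|]. apply (scontC_poly _ (qs k)).
    - intros n. specialize (Hy n). lra. }
  exists X. split; [intros x Hx; apply Hx|]. split; [|split].
  - apply cluster_compact_closed_subset with J; [apply dist_Cn_metric|apply J_compact|intros x Hx; apply Hx|].
    intros x y Jx Hy Hcv. split; auto. intros k. apply (Hlim k y x Hcv). intros n; apply Hy.
  - intros f M HM. apply le_epsilon. intros e He.
    (* The k-th point satisfies just the k-th condition, but the conditions are nested: a limit of
       these points satisfies all of them and lies in [X], with f still within [e] of f(0). *)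
    assert (Hc : forall k : nat, exists x, J x /\ Cabs (peval (qs k) x - C1)%Cx <= 1/2 /\
       Cabs (peval f x - peval f zero3)%Cx <= e).
    { intros k. destruct (J_meets_fibres (qs k) f (Rmin e (1/2))) as [x [Jx [H1 H2]]].
      - apply Rmin_glb_lt; lra.
      - rewrite Hq0 in H1. exists x. split; auto.
        split; eapply Rle_trans; eauto; [apply Rmin_r|apply Rmin_l]. }
    apply choice in Hc. destruct Hc as [x Hx].
    destruct (cluster_compact_subseq _ (dist_Cn_metric 3) J x J_compact (fun n => proj1 (Hx n)))
      as [phi [l [Hphi [Jl Hcv]]]].
    assert (Xl : X l).
    { split; auto. intros k. apply (Hlim k (fun n => x (phi (n + k)%nat)) l).
      - apply (mcv_subseq _ (fun n => x (phi n)) l (fun n => (n + k)%nat)); auto. intros; lia.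
      - intros n. destruct (Hx (phi (n + k)%nat)) as [J1 [J2 _]].
        set (j := phi (n + k)%nat) in *. assert (Hj : (k <= j)%nat) by (unfold j; specialize (Hphi (n + k)%nat); lia).
        apply (Hnest' (j - k)%nat k); auto. replace (j - k + k)%nat with j by lia.
        pose proof (Rabs_Cre (peval (qs j) (x j) - C1)%Cx) as H. simpl in H.
        assert (H' := Rle_trans _ _ _ H J2). apply Rabs_le_inv in H'. lra. }
    assert (Hfl : Cabs (peval f l - peval f zero3)%Cx <= e).
    { apply (scont_le_limit (dist_Cn 3) top (fun z => Cabs (peval f z - peval f zero3)%Cx) e
        (fun n => x (phi n)) l); unfold top; auto.
      - apply scont_Cabs, scontC_sub; [apply scontC_poly|apply scontC_const].
      - intros n; apply Hx. }
    specialize (HM l Xl). pose proof (Cabs_sub_le (peval f zero3) (peval f l)) as H.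
    rewrite Cabs_sub_sym in H. lra.
  (* The next q is a product p E, so an approximate inverse h of it makes E h one of p. *)
  - intros k e He. destruct (half_plane_invertible (qs (S k)) e He) as [h Hh].
    exists (PMul (nx (qs k, p k)) h). intros x [Jx Xx]. specialize (Hh x Jx (Xx (S k))).
    simpl in *. replace (peval (p k) x * (peval (nx (qs k, p k)) x * peval h x))%Cx with
      (peval (p k) x * peval (nx (qs k, p k)) x * peval h x)%Cx by ring. auto.
Qed.

(** The approximation is asked for on polydiscs of any radius [M], not only on [X], because it will
    be applied on the larger set F(K). *)
Lemma dense_inv_subset : exists X : Cn 3 -> Prop, (forall x, X x -> J x) /\
  cluster_compact (dist_Cn 3) X /\ poly_hull X zero3 /\
  forall (p : poly 3) M e, 0 < e -> exists p' : poly 3, approx_inv X p' /\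
    forall z, bounded_by M z -> Cabs (peval p' z - peval p z)%Cx <= e.
Proof.
  set (P := fun n => let (k, m) := Cantor.of_nat n in penum k m).
  (* Normalised at 0; the constant 1 stands in for the polynomials that vanish there. *)
  set (p := fun n => if excluded_middle_informative (peval (P n) zero3 = C0) then PConst C1
     else PMul (PConst (Cinv (peval (P n) zero3))) (P n)).
  destruct (refined_subset p) as [X [HJ [HC [Hh Hinv]]]].
  - intros n. unfold p. destruct (excluded_middle_informative _); simpl; auto. field; auto.
  - exists X. split; [auto|split; [auto|split; [auto|]]]. intros f M e He.
    (* The approximant must be nonzero at 0 to be a multiple of some [p n]. The shift [c] makes the
       target nonzero there, and the tolerance a/2 below transfers this to the approximant. *)
    assert (Hc : exists c, Cabs c <= e / 2 /\ (peval f zero3 + c)%Cx <> C0).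
    { destruct (classic (peval f zero3 = C0)) as [H|H].
      - exists (RtoC (e/2)). rewrite Cabs_RtoC, Rabs_right by lra. split; [lra|]. rewrite H.
        intros E. apply (f_equal Cre) in E. simpl in E. lra.
      - exists C0. rewrite Cabs_C0. split; [lra|]. intros E; apply H. rewrite <- E; ring. }
    destruct Hc as [c [Hc1 Hc2]]. pose proof (Cabs_pos _ Hc2) as Hpos.
    set (a := Cabs (peval f zero3 + c)%Cx) in *.
    (* [Rmax 0 M] puts the origin into the polydisc even if [M] is negative. *)
    destruct (penum_dense (PAdd f (PConst c)) (Rmax 0 M)) as [k Hk].
    destruct (Hk k (le_n _) (Rmin (e/2) (a/2))) as [m Hm]; [apply Rmin_glb_lt; lra|].
    set (n := Cantor.to_nat (k, m)).
    assert (HPn : P n = penum k m) by (unfold P, n; rewrite Cantor.cancel_of_to; auto).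
    assert (Hz0 : bounded_by (Rmax 0 M) zero3) by (intros i; unfold zero3; rewrite Cabs_C0; apply Rmax_l).
    assert (Hn0 : peval (P n) zero3 <> C0).
    { intros E. specialize (Hm zero3 Hz0). rewrite HPn in E. rewrite E in Hm. simpl in Hm.
      rewrite Cabs_sub_sym in Hm. replace (peval f zero3 + c - C0)%Cx with (peval f zero3 + c)%Cx in Hm by ring.
      fold a in Hm. pose proof (Rmin_r (e/2) (a/2)). lra. }
    exists (P n). split.
    + intros e' He'. destruct (Hinv n e' He') as [h Hh'].
      exists (PMul (PConst (Cinv (peval (P n) zero3))) h). intros x Xx. specialize (Hh' x Xx).
      unfold p in Hh'. destruct (excluded_middle_informative _) as [E|_]; [tauto|]. simpl in Hh' |- *.
      replace (peval (P n) x * (Cinv (peval (P n) zero3) * peval h x))%Cx with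
        (Cinv (peval (P n) zero3) * peval (P n) x * peval h x)%Cx by ring. auto.
    + intros z Hz. rewrite HPn. assert (Hz' : bounded_by (Rmax 0 M) z).
      { intros i. eapply Rle_trans; [apply Hz|apply Rmax_r]. }
      specialize (Hm z Hz'). simpl in Hm.
      pose proof (Cabs_triang (peval (penum k m) z) (peval f z + c)%Cx (peval f z)) as HT.
      replace (peval f z + c - peval f z)%Cx with c in HT by ring.
      pose proof (Rmin_l (e/2) (a/2)). lra.
Qed.

(** * Embedding totally disconnected compacta into uncountable compacta *)

Section CantorScheme.
Context {T : Type} (d : T -> T -> R) (Hd : is_metric d) (K : T -> Prop).
Hypothesis HK : compact_set d K.

Definition countable (S : T -> Prop) : Prop := exists f : nat -> T, forall x, S x -> exists k, f k = x.

Lemma countable_subset (S S' : T -> Prop) : (forall x, S x -> S' x) -> countable S' -> countable S.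
Proof. intros H [f Hf]. exists f; auto. Qed.

Lemma countable_Union (S : nat -> T -> Prop) :
  (forall n, countable (S n)) -> countable (fun x => exists n, S n x).
Proof.
  intros H. apply choice in H. destruct H as [f Hf].
  exists (fun n => let (a, b) := Cantor.of_nat n in f a b).
  intros x [n Hx]. destruct (Hf n x Hx) as [k Hk].
  exists (Cantor.to_nat (n, k)). rewrite Cantor.cancel_of_to. auto.
Qed.

Lemma countable_union (S S' : T -> Prop) : countable S -> countable S' -> countable (fun x => S x \/ S' x).
Proof.
  intros H H'. apply countable_subset with (fun x => exists n, (match n with O => S | _ => S' end) x).
  - intros x [Hx|Hx]; [exists O|exists 1%nat]; auto.
  - apply countable_Union. intros [|n]; auto.
Qed.

Lemma countable_list_union {I} (l : list I) (S : I -> T -> Prop) (a : T) :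
  (forall i, In i l -> countable (S i)) -> countable (fun x => exists i, In i l /\ S i x).
Proof.
  induction l; intros H.
  - exists (fun _ => a). intros x [i [[] _]].
  - apply countable_subset with (fun x => S a0 x \/ exists i, In i l /\ S i x).
    + intros x [i [[->|Hi] Hx]]; eauto.
    + apply countable_union; [apply H; left; auto|]. apply IHl; intros; apply H; right; auto.
Qed.

Lemma uncountable_inhabited (S : T -> Prop) : inhabited T -> uncountable S -> exists x, S x.
Proof.
  intros [a] H. apply NNPP; intros Hno. apply H. exists (fun _ => a). intros x Sx; exfalso; eauto.
Qed.

Definition condensation (S : T -> Prop) (a : T) : Prop :=
  forall r, 0 < r -> uncountable (fun x => S x /\ d a x <= r).

(** If no point but [a] were a condensation point, compactness would cover the part of [S] at
    distance at least 1/(m+1) from [a] by finitely many balls with countable trace, for every m, and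
    [S] would be countable. *)
Lemma two_condensation_points (S : T -> Prop) : inhabited T -> (forall x, S x -> K x) -> uncountable S ->
  exists a b, a <> b /\ condensation S a /\ condensation S b.
Proof.
  intros Hin HSK HS. apply NNPP; intros Hno.
  assert (Ha : exists a, forall y, y <> a -> ~ condensation S y).
  { destruct (classic (exists a, condensation S a)) as [[a Ca]|Hn].
    - exists a. intros y Hy Cy. apply Hno. exists y, a; auto.
    - destruct Hin as [a]. exists a. intros y _ Cy. apply Hn; eauto. }
  destruct Ha as [a Ha]. apply HS.
  assert (Hm : forall m : nat, countable (fun x => S x /\ / (INR m + 1) <= d a x)).
  { intros m. pose proof (inv_INR_pos m) as Hpos. set (e := / (INR m + 1)) in *.
    (* [None] indexes the ball around the exceptional point, [Some (y, r)] a ball whose closed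
       version meets [S] in a countable set. *)
    destruct (HK (option (T * R)) (fun i x => match i with
       | None => d a x < e
       | Some (y, r) => d y x < r /\ countable (fun x => S x /\ d y x <= r) end)) as [l Hl].
    - intros [[y r]|] x Kx.
      + intros [Hx Hc]. exists (r - d y x). split; [lra|]. intros z Kz Hz. split; auto.
        pose proof (met_tri d Hd y x z); lra.
      + intros Hx. exists (e - d a x). split; [lra|]. intros z Kz Hz.
        pose proof (met_tri d Hd a x z); lra.
    - intros x Kx. destruct (Rlt_le_dec (d a x) e) as [H|H]; [exists None; auto|].
      assert (Hxa : x <> a) by (intros ->; rewrite (met_refl d Hd) in H; lra).
      specialize (Ha x Hxa). apply not_all_ex_not in Ha. destruct Ha as [r Hr].
      apply imply_to_and in Hr. destruct Hr as [Hr Hc]. apply NNPP in Hc.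
      exists (Some (x, r)). rewrite (met_refl d Hd). auto.
    - apply countable_subset with (fun x => exists i, In i l /\
        match i with None => False | Some (y, r) => (S x /\ d y x <= r) /\ countable (fun x => S x /\ d y x <= r) end).
      + intros x [Sx Hx]. destruct (Hl x (HSK x Sx)) as [[[y r]|] [Hi Hix]].
        * exists (Some (y, r)). split; auto. destruct Hix as [H1 H2]. split; auto. split; auto; lra.
        * lra.
      + apply countable_list_union; auto. intros [[y r]|] Hi.
        * destruct (classic (countable (fun x => S x /\ d y x <= r))) as [Hc|Hc].
          -- eapply countable_subset; [|exact Hc]. intros x Hx; apply Hx.
          -- exists (fun _ => a). intros x [_ Hx]. tauto.
        * exists (fun _ => a). intros x []. }
  apply countable_subset with (fun x => (exists m : nat, S x /\ / (INR m + 1) <= d a x) \/ x = a).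
  - intros x Sx. destruct (classic (x = a)) as [->|Hxa]; auto. left.
    assert (Hpos : 0 < d a x).
    { destruct (Rle_lt_or_eq_dec _ _ (met_ge0 d Hd a x)) as [|E]; auto.
      exfalso; apply Hxa. symmetry. apply (met_eq d Hd); auto. }
    destruct (inv_INR_small _ Hpos) as [N HN]. exists N. split; auto. left; apply HN; auto.
  - apply countable_union.
    + apply (countable_Union (fun m x => S x /\ / (INR m + 1) <= d a x)); auto.
    + exists (fun _ => a). intros x ->. exists O; auto.
Qed.

Definition seq_closed (S : T -> Prop) : Prop :=
  forall y l, K l -> (forall n, S (y n)) -> mcv d y l -> S l.

Definition good (S : T -> Prop) : Prop :=
  (forall x, S x -> K x) /\ uncountable S /\ seq_closed S.

Lemma good_split (S : T -> Prop) e : inhabited T -> good S -> 0 < e ->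
  exists P : bool -> T -> Prop, (forall c, good (P c)) /\ (forall c x, P c x -> S x) /\
    (forall c x y, P c x -> P c y -> d x y <= 2 * e) /\ (forall x, P true x -> P false x -> False).
Proof.
  intros Hin [HSK [HSu HSc]] He.
  destruct (two_condensation_points S Hin HSK HSu) as [a [b [Hab [Ca Cb]]]].
  assert (Hpos : 0 < d a b).
  { destruct (Rle_lt_or_eq_dec _ _ (met_ge0 d Hd a b)) as [|E]; auto.
    exfalso; apply Hab, (met_eq d Hd); auto. }
  set (r := Rmin e (d a b / 3)).
  assert (Hr : 0 < r) by (apply Rmin_glb_lt; lra).
  assert (Hre : r <= e) by apply Rmin_l. assert (Hrab : r <= d a b / 3) by apply Rmin_r.
  set (ctr := fun c : bool => if c then a else b).
  exists (fun c x => S x /\ d (ctr c) x <= r). split; [|split; [|split]].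
  - intros c. split; [intros x [Sx _]; auto|]. split.
    + destruct c; simpl; [apply Ca|apply Cb]; auto.
    + intros y l Kl Hy Hcv. split; [apply (HSc y l); auto; intros n; apply Hy|].
      apply le_epsilon. intros e' He'. destruct (mcv_elim d _ _ Hcv e' He') as [N HN].
      specialize (HN N (le_n _)). destruct (Hy N) as [_ H].
      pose proof (met_tri d Hd (ctr c) (y N) l). rewrite (met_sym d Hd (y N) l) in H0. lra.
  - intros c x [Sx _]; auto.
  - intros c x y [_ Hx] [_ Hy]. pose proof (met_tri d Hd x (ctr c) y).
    rewrite (met_sym d Hd x (ctr c)) in H. lra.
  - intros x [_ Hx] [_ Hy]. simpl in *. pose proof (met_tri d Hd a x b).
    rewrite (met_sym d Hd x b) in H. lra.
Qed.

(** A binary tree of uncountable closed sets. Dependence on the first [k] bits, with the diameter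
    bound, makes the map from codes to points continuous; the last clause makes it injective. *)
Lemma cantor_scheme : inhabited T -> uncountable K -> exists S : (nat -> bool) -> nat -> T -> Prop,
  (forall s k, good (S s k)) /\ (forall s k x, S s (Datatypes.S k) x -> S s k x) /\
  (forall s k x y, S s (Datatypes.S k) x -> S s (Datatypes.S k) y -> d x y <= 2 * / (INR k + 1)) /\
  (forall s s' k, (forall i, (i < k)%nat -> s i = s' i) -> S s k = S s' k) /\
  (forall s s' x, (forall k, S s k x) -> (forall k, S s' k x) -> forall i, s i = s' i).
Proof.
  intros Hin Hunc.
  assert (HKgood : good K).
  { split; auto. split; auto. intros y l Kl _ _; auto. }
  assert (Hc : forall Se : (T -> Prop) * R, exists P : bool -> T -> Prop, good (fst Se) -> 0 < snd Se ->
    (forall c, good (P c)) /\ (forall c x, P c x -> fst Se x) /\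
    (forall c x y, P c x -> P c y -> d x y <= 2 * snd Se) /\ (forall x, P true x -> P false x -> False)).
  { intros [S e]; simpl. destruct (classic (good S /\ 0 < e)) as [[H1 H2]|H].
    - destruct (good_split S e Hin H1 H2) as [P HP]. exists P; auto.
    - exists (fun _ => S). tauto. }
  apply choice in Hc. destruct Hc as [ch Hch].
  set (S := fix S (s : nat -> bool) (k : nat) : T -> Prop :=
     match k with O => K | Datatypes.S k => ch (S s k, / (INR k + 1)) (s k) end).
  assert (Hg : forall s k, good (S s k)).
  { intros s k. induction k; simpl; auto.
    destruct (Hch (S s k, / (INR k + 1)) IHk (inv_INR_pos k)) as [H _]. apply H. }
  assert (Hs : forall s k, (forall c x, ch (S s k, / (INR k + 1)) c x -> S s k x) /\
    (forall c x y, ch (S s k, / (INR k + 1)) c x -> ch (S s k, / (INR k + 1)) c y -> d x y <= 2 * / (INR k + 1)) /\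
    (forall x, ch (S s k, / (INR k + 1)) true x -> ch (S s k, / (INR k + 1)) false x -> False)).
  { intros s k. destruct (Hch (S s k, / (INR k + 1)) (Hg s k) (inv_INR_pos k)) as [_ H]. apply H. }
  assert (Hagree : forall s s' k, (forall i, (i < k)%nat -> s i = s' i) -> S s k = S s' k).
  { intros s s' k. induction k; intros Hi; simpl; auto. rewrite IHk, (Hi k); auto. }
  exists S. split; [auto|]. split; [|split; [|split; [auto|]]].
  - intros s k x Hx. destruct (Hs s k) as [H _]. apply (H (s k)), Hx.
  - intros s k x y Hx Hy. destruct (Hs s k) as [_ [H _]]. apply (H (s k)); auto.
  - intros s s' x Hx Hx'.
    assert (G : forall k i, (i < k)%nat -> s i = s' i).
    { induction k; intros i Hi; [lia|]. destruct (Nat.eq_dec i k) as [->|Hik]; [|apply IHk; lia].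
      specialize (Hx (Datatypes.S k)). specialize (Hx' (Datatypes.S k)). simpl in Hx, Hx'.
      rewrite <- (Hagree s s' k IHk) in Hx'.
      destruct (Hs s k) as [_ [_ H]].
      destruct (s k), (s' k); auto; exfalso; eauto. }
    intros i. apply (G (Datatypes.S i)); lia.
Qed.

End CantorScheme.

Lemma image_compact {T U} (d : T -> T -> R) (d' : U -> U -> R) (X : U -> Prop) (th : U -> T) :
  is_metric d -> is_metric d' -> cluster_compact d' X -> continuous_on d' d X th ->
  cluster_compact d (fun x => exists z, X z /\ x = th z).
Proof.
  intros Hd Hd' HX Hth x Hx. apply choice in Hx. destruct Hx as [z Hz].
  destruct (HX z (fun n => proj1 (Hz n))) as [l [Xl Hl]].
  exists (th l). split; [exists l; auto|]. intros e He N.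
  destruct (Hth l Xl e He) as [del [Hdel H]]. destruct (Hl del Hdel N) as [n [Hn Hn']].
  exists n. split; auto. destruct (Hz n) as [Xn ->]. auto.
Qed.

(** Locally constant separating bits code [X] by binary sequences, which the Cantor scheme places in
    [K]; [E] is the image and [g] the inverse, continuous by compactness of [X]. *)
Lemma zero_dim_embeds {T U} (d : T -> T -> R) (d' : U -> U -> R) (K : T -> Prop) (X : U -> Prop)
  (b : nat -> U -> bool) :
  is_metric d -> is_metric d' -> inhabited T -> compact_set d K -> uncountable K -> cluster_compact d' X -> (exists z, X z) ->
  (forall z z', X z -> X z' -> (forall i, b i z = b i z') -> z = z') ->
  (forall i z, X z -> exists del, 0 < del /\ forall z', X z' -> d' z z' < del -> b i z' = b i z) ->
  exists (E : T -> Prop) (g : T -> U), (forall x, E x -> K x) /\ cluster_compact d E /\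
    (forall x, E x -> X (g x)) /\ (forall z, X z -> exists x, E x /\ g x = z) /\
    (forall x y, E x -> E y -> g x = g y -> x = y) /\ continuous_on d d' E g.
Proof.
  intros Hd Hd' Hin HK Hunc HX [z0 Xz0] Hinj Hloc.
  destruct (cantor_scheme d Hd K HK Hin Hunc) as [S [Hgood [Hnest [Hdiam [Hagree Huniq]]]]].
  set (code := fun z i => b i z).
  assert (Hnest' : forall s j k x, S s (j + k)%nat x -> S s k x).
  { induction j; simpl; intros k x Hx; auto. }
  assert (Hpt : forall s, exists x, K x /\ forall k, S s k x).
  { intros s.
    assert (Hc : forall k, exists x, S s k x) by (intros k; apply uncountable_inhabited; auto; apply (Hgood s k)).
    apply choice in Hc. destruct Hc as [x Hx].
    destruct (cluster_compact_subseq d Hd K x (compact_cluster d Hd K HK)) as [phi [l [Hphi [Kl Hcv]]]].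
    { intros n. apply (proj1 (Hgood s n)), Hx. }
    exists l. split; auto. intros k. destruct (Hgood s k) as [_ [_ Hcl]].
    apply (Hcl (fun n => x (phi (n + k)%nat)) l); auto.
    - intros n. set (j := phi (n + k)%nat). assert (k <= j)%nat by (unfold j; specialize (Hphi (n + k)%nat); lia).
      apply (Hnest' s (j - k)%nat k). replace (j - k + k)%nat with j by lia. apply Hx.
    - apply (mcv_subseq d (fun n => x (phi n)) l (fun n => (n + k)%nat)); auto. intros; lia. }
  apply choice in Hpt. destruct Hpt as [pt Hpt].
  set (th := fun z => pt (code z)).
  assert (Hthinj : forall z z', X z -> X z' -> th z = th z' -> z = z').
  { intros z z' Xz Xz' E. apply Hinj; auto. apply (Huniq (code z) (code z') (th z)).
    - apply Hpt.
    - rewrite E. apply Hpt. }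
  assert (Hloc' : forall k z, X z -> exists del, 0 < del /\ forall z', X z' -> d' z z' < del ->
     forall i, (i < k)%nat -> code z i = code z' i).
  { induction k; intros z Xz; [exists 1; split; [lra|]; intros; lia|].
    destruct (IHk z Xz) as [d1 [Hd1 H1]]. destruct (Hloc k z Xz) as [d2 [Hd2 H2]].
    exists (Rmin d1 d2). split; [apply Rmin_glb_lt; auto|]. intros z' Xz' Hz i Hi.
    destruct (Nat.eq_dec i k) as [->|Hik].
    - symmetry. apply H2; auto. eapply Rlt_le_trans; [exact Hz|apply Rmin_r].
    - apply H1; auto; [|lia]. eapply Rlt_le_trans; [exact Hz|apply Rmin_l]. }
  assert (Hth : continuous_on d' d X th).
  { intros z Xz e He. destruct (inv_INR_small (e/2)) as [k Hk]; [lra|]. specialize (Hk k (le_n _)).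
    destruct (Hloc' (Datatypes.S k) z Xz) as [del [Hdel H]]. exists del. split; auto.
    intros z' Xz' Hz. apply Rle_lt_trans with (2 * / (INR k + 1)); [|lra].
    apply (Hdiam (code z) k); [apply Hpt|].
    rewrite (Hagree (code z) (code z')) by (apply H; auto). apply Hpt. }
  set (E := fun x => exists z, X z /\ x = th z).
  assert (Hg : forall x, exists z, E x -> X z /\ x = th z).
  { intros x. destruct (classic (E x)) as [[z Hz]|H]; [exists z; auto|].
    exists z0; tauto. }
  apply choice in Hg. destruct Hg as [g Hg].
  exists E, g. split; [|split; [|split; [|split; [|split]]]].
  - intros x [z [Xz ->]]. apply Hpt.
  - apply (image_compact d d'); auto.
  - intros x Ex. apply Hg; auto.
  - intros z Xz. exists (th z). assert (Eth : E (th z)) by (exists z; auto). split; auto.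
    destruct (Hg _ Eth) as [H1 H2]. symmetry. apply Hthinj; auto.
  - intros x y Ex Ey Hxy. destruct (Hg x Ex) as [_ ->]. destruct (Hg y Ey) as [_ ->]. rewrite Hxy; auto.
  - apply (inverse_continuous d' d X E th g); auto.
    + intros y Ey; apply Hg; auto.
    + intros y Ey; symmetry; apply Hg; auto.
Qed.

(** * Binary coding of [J] by the gaps *)

Definition jbit (i : nat) (z : Cn 3) : bool :=
  let (m, k) := Cantor.of_nat i in
  if Rlt_dec (INR k * (16 * rr m)) (um m z) then true else false.

Lemma um_periodic j m : (j < 7)%nat -> um (j + m * 7) = um j.
Proof. intros Hj. unfold um. rewrite Nat.Div0.mod_add. reflexivity. Qed.

(** The j-th function recurs at the stages j + 7 M with spacing tending to 0, so some gap centre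
    separates any two different values of it. *)
Lemma jbit_um z z' j : (j < 7)%nat -> J z -> J z' -> (forall i, jbit i z = jbit i z') -> um j z <= um j z'.
Proof.
  intros Hj Jz Jz' H. apply Rnot_lt_le; intros Hlt.
  destruct (rr_small ((um j z - um j z') / 16)) as [M HM]; [lra|].
  set (m := (j + M * 7)%nat). specialize (HM m ltac:(unfold m; lia)).
  pose proof (rr_range m) as Hr.
  assert (Hu : forall w, um m w = um j w) by (intros; unfold m; rewrite um_periodic; auto).
  assert (H0 : 0 <= um j z').
  { unfold um. apply usq_range; [apply tau_unit|apply Jz']. }
  assert (Hk : exists k : nat, um j z' <= INR k * (16 * rr m) < um j z).
  { destruct (archimed (um j z' / (16 * rr m))) as [A1 A2].
    assert (Hdiv : 0 <= um j z' / (16 * rr m)) by (apply Rmult_le_pos; [lra|]; left; apply Rinv_0_lt_compat; lra).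
    set (u := up (um j z' / (16 * rr m))) in *.
    assert (0 < u)%Z by (apply lt_IZR; lra).
    exists (Z.to_nat u). rewrite INR_IZR_INZ, Z2Nat.id by lia.
    assert (E : um j z' = um j z' / (16 * rr m) * (16 * rr m)) by (field; lra).
    split; [rewrite E at 1; apply Rmult_le_compat_r; lra|].
    apply Rle_lt_trans with ((um j z' / (16 * rr m) + 1) * (16 * rr m)); [apply Rmult_le_compat_r; lra|].
    rewrite Rmult_plus_distr_r, <- E. lra. }
  destruct Hk as [k [Hk1 Hk2]].
  specialize (H (Cantor.to_nat (m, k))). unfold jbit in H. rewrite Cantor.cancel_of_to, !Hu in H.
  destruct (Rlt_dec (INR k * (16 * rr m)) (um j z)); [|lra].
  destruct (Rlt_dec (INR k * (16 * rr m)) (um j z')); [lra|discriminate].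
Qed.

Lemma jbit_inj z z' : J z -> J z' -> (forall i, jbit i z = jbit i z') -> z = z'.
Proof.
  intros Jz Jz' H.
  assert (G : forall j, (j < 7)%nat -> um j z = um j z').
  { intros j Hj. apply Rle_antisym; apply jbit_um; auto. }
  pose proof (G 0%nat ltac:(lia)) as G0. pose proof (G 1%nat ltac:(lia)) as G1.
  pose proof (G 2%nat ltac:(lia)) as G2. pose proof (G 3%nat ltac:(lia)) as G3.
  pose proof (G 4%nat ltac:(lia)) as G4. pose proof (G 5%nat ltac:(lia)) as G5.
  pose proof (G 6%nat ltac:(lia)) as G6. clear G.
  unfold um, usq in *. simpl in *.
  apply functional_extensionality. apply fin3_ind; apply C_ext; lra.
Qed.

(** Within distance rr m ^ 2 / 64 the function [um m] moves by less than rr m ^ 2 / 8, the gap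
    radius, so it cannot cross the gap. *)
Lemma jbit_loc i z : J z -> exists del, 0 < del /\
  forall z', J z' -> dist_Cn 3 z z' < del -> jbit i z' = jbit i z.
Proof.
  intros Jz. unfold jbit. destruct (Cantor.of_nat i) as [m k]. pose proof (rr_range m) as Hr.
  exists (rr m * rr m / 64). split; [nra|]. intros z' Jz' Hz.
  pose proof (usq_lip (tau (m mod 7)) z z' (tau_unit _) (proj1 Jz) (proj1 Jz')) as HL.
  fold (um m z) in HL. fold (um m z') in HL. apply Rabs_le_inv in HL.
  destruct Jz as [_ H]. specialize (H m k).
  destruct (Rlt_dec (INR k * (16 * rr m)) (um m z')), (Rlt_dec (INR k * (16 * rr m)) (um m z)); auto; exfalso.
  - rewrite Rabs_left1 in H; lra.
  - rewrite Rabs_right in H; lra.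
Qed.

(** * Distance functions and Tietze extension *)

Section Tietze.
Context {T : Type} (d : T -> T -> R) (Hd : is_metric d) (E : T -> Prop).
Hypothesis HE : cluster_compact d E.
Hypothesis HE0 : exists e, E e.

Lemma dist_fun_exists : exists rho : T -> R,
  (forall x, 0 <= rho x) /\ (forall x y, Rabs (rho x - rho y) <= d x y) /\
  (forall x e, E e -> rho x <= d x e) /\ (forall x, rho x = 0 <-> E x) /\
  (forall x eps, 0 < eps -> exists e, E e /\ d x e < rho x + eps).
Proof.
  destruct (inf_family (T := T) T E (fun x e => d x e) 0 HE0) as [rho Hrho].
  { intros; apply (met_ge0 d Hd). }
  assert (H0 : forall x, 0 <= rho x).
  { intros x. apply Rnot_lt_le; intros Hlt. destruct (Hrho x) as [_ H].
    destruct (H (- rho x)) as [e [Ee He]]; [lra|]. pose proof (met_ge0 d Hd x e). lra. }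
  assert (HL : forall x y, rho x - rho y <= d x y).
  { intros x y. apply le_epsilon. intros e He. destruct (Hrho y) as [_ H].
    destruct (H e He) as [a [Ea Ha]]. destruct (Hrho x) as [H1 _]. specialize (H1 a Ea).
    pose proof (met_tri d Hd x y a). lra. }
  exists rho. split; [auto|]. split; [|split; [|split]].
  - intros x y. apply Rabs_le. pose proof (HL x y). pose proof (HL y x).
    rewrite (met_sym d Hd y x) in H1. lra.
  - intros x e Ee. apply Hrho; auto.
  - intros x. split.
    + intros Hx. assert (Hc : forall n : nat, exists e, E e /\ d x e < / (INR n + 1)).
      { intros n. destruct (Hrho x) as [_ H]. destruct (H _ (inv_INR_pos n)) as [e [Ee He]].
        exists e. split; auto. lra. }
      apply choice in Hc. destruct Hc as [y Hy].
      destruct (cluster_compact_subseq d Hd E y HE (fun n => proj1 (Hy n))) as [phi [l [Hphi [El Hcv]]]].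
      assert (x = l) as ->; auto. apply (met_eq d Hd). apply Rle_antisym; [|apply (met_ge0 d Hd)].
      apply le_epsilon. intros e He. destruct (mcv_elim d _ _ Hcv (e/2)) as [N HN]; [lra|].
      destruct (inv_INR_small (e/2)) as [N2 HN2]; [lra|].
      specialize (HN (max N N2) (Nat.le_max_l _ _)).
      specialize (HN2 (phi (max N N2)) ltac:(specialize (Hphi (max N N2)); lia)).
      destruct (Hy (phi (max N N2))) as [_ H]. pose proof (met_tri d Hd x (y (phi (max N N2))) l) as HT.
      rewrite (met_sym d Hd (y _) l) in HT. lra.
    + intros Ex. apply Rle_antisym; auto. rewrite <- (met_refl d Hd x). apply Hrho; auto.
  - intros x. apply Hrho.
Qed.

(** Hausdorff's formula: off [E], G(x) is the infimum over e in [E] of g(e) + d(x,e)/rho(x) - 1.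
    Near [E] the quotient is close to 1 at almost nearest points and large at far ones, which forces
    G(x) towards the boundary value. *)
Lemma tietze (g : T -> R) (K : T -> Prop) : scont d E g ->
  exists G : T -> R, scont d K G /\ forall x, E x -> G x = g x.
Proof.
  intros Hg. destruct dist_fun_exists as [rho [R0 [RL [RE [RZ RI]]]]].
  destruct (scont_bounded d Hd E g HE Hg) as [M [HM0 HM]].
  assert (HM' : forall e, E e -> - M <= g e <= M) by (intros; apply Rabs_le_inv, HM; auto).
  assert (Hpos : forall x, ~ E x -> 0 < rho x).
  { intros x Hx. destruct (Rle_lt_or_eq_dec _ _ (R0 x)) as [|E0]; auto.
    exfalso; apply Hx, RZ; auto. }
  set (f := fun x e => if excluded_middle_informative (E x) then g x else g e + d x e / rho x - 1).
  assert (Hdiv : forall x e, ~ E x -> E e -> 1 <= d x e / rho x).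
  { intros x e Hx Ee. specialize (Hpos x Hx). specialize (RE x e Ee).
    apply Rmult_le_reg_r with (rho x); auto. unfold Rdiv. rewrite Rmult_assoc, Rinv_l by lra. lra. }
  destruct (inf_family T E f (- M) HE0) as [G HG].
  { intros x e Ee. unfold f. destruct (excluded_middle_informative (E x)) as [Ex|Ex].
    - apply HM'; auto.
    - pose proof (HM' e Ee). pose proof (Hdiv x e Ex Ee). lra. }
  assert (HGE : forall x, E x -> G x = g x).
  { intros x Ex. destruct (HG x) as [H1 H2]. destruct HE0 as [e0 Ee0].
    unfold f in H1, H2. destruct (excluded_middle_informative (E x)) as [_|]; [|tauto].
    apply Rle_antisym; [apply (H1 e0 Ee0)|]. apply le_epsilon. intros e He.
    destruct (H2 e He) as [a [Ea Ha]]. lra. }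
  assert (HGn : forall x, ~ E x -> (forall e, E e -> G x <= g e + d x e / rho x - 1) /\
    forall eps, 0 < eps -> exists e, E e /\ g e + d x e / rho x - 1 < G x + eps).
  { intros x Ex. specialize (HG x). unfold f in HG. destruct (excluded_middle_informative (E x)); [tauto|]. auto. }
  exists G. split; auto.
  apply scont_intro. intros x _ eps Heps.
  destruct (classic (E x)) as [Ex|Ex].
  - rewrite (HGE x Ex).
    destruct (scont_eps d Hd E g Hg x Ex (Rmin 1 (eps / 3))) as [del [Hdel Hgx]].
    { apply Rmin_glb_lt; lra. }
    pose proof (Rmin_r 1 (eps/3)) as Hm1. pose proof (Rmin_l 1 (eps/3)) as Hm2.
    set (e1 := Rmin 1 (eps/3)) in *. assert (He1 : 0 < e1) by (apply Rmin_glb_lt; lra).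
    (* The first bound keeps almost nearest points of [E] within [del] of [x]. By the second, a
       point of [E] at distance [del] or more adds at least 2 M, too much to undercut [g x]. *)
    exists (Rmin (del / 3) (del / (2 * M + 2))). split.
    { apply Rmin_glb_lt; apply Rdiv_lt_0_compat; lra. }
    intros y _ Hy.
    assert (Hy1 := Rlt_le_trans _ _ _ Hy (Rmin_l _ _)). assert (Hy2 := Rlt_le_trans _ _ _ Hy (Rmin_r _ _)).
    destruct (classic (E y)) as [Ey|Ey].
    { rewrite (HGE y Ey). eapply Rlt_le_trans; [apply Hgx; auto; lra|lra]. }
    destruct (HGn y Ey) as [U1 U2]. specialize (Hpos y Ey).
    pose proof (RE y x Ex) as Hry. rewrite (met_sym d Hd y x) in Hry.
    set (tt := d x y) in *.
    assert (Hup : G y <= g x + 2 * e1).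
    { destruct (RI y (e1 * rho y)) as [a [Ea Ha]]; [nra|].
      specialize (U1 a Ea).
      assert (d y a / rho y <= 1 + e1).
      { apply Rmult_le_reg_r with (rho y); auto. unfold Rdiv. rewrite Rmult_assoc, Rinv_l by lra. lra. }
      assert (Hxa : d x a < del).
      { pose proof (met_tri d Hd x y a) as HT. fold tt in HT. nra. }
      pose proof (Hgx a Ea Hxa) as H1. apply Rabs_def2 in H1. lra. }
    assert (Hlo : g x - 2 * e1 <= G y).
    { destruct (U2 e1 He1) as [a [Ea Ha]]. pose proof (Hdiv y a Ey Ea) as H1.
      destruct (Rlt_le_dec (d x a) del) as [Hxa|Hxa].
      - pose proof (Hgx a Ea Hxa) as H2. apply Rabs_def2 in H2. lra.
      - assert (Htt : tt * (2 * M + 2) <= del).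
        { apply Rmult_lt_compat_r with (r := 2 * M + 2) in Hy2; [|lra].
          unfold Rdiv in Hy2. rewrite Rmult_assoc, Rinv_l in Hy2 by lra. lra. }
        pose proof (met_tri d Hd x y a) as HT. fold tt in HT.
        assert (2 * M + 1 <= d y a / rho y).
        { apply Rmult_le_reg_r with (rho y); auto. unfold Rdiv. rewrite Rmult_assoc, Rinv_l by lra. nra. }
        pose proof (HM' x Ex). pose proof (HM' a Ea). lra. }
    apply Rabs_def1; lra.
  - destruct HE0 as [e0 Ee0].
    destruct (scont_bounded d Hd E (fun e => d e0 e) HE) as [B [HB0 HB]].
    { apply scont_intro. intros a _ e He. exists e; split; auto. intros b _ Hb.
      pose proof (met_tri d Hd e0 a b). pose proof (met_tri d Hd e0 b a).
      rewrite (met_sym d Hd b a) in H0. apply Rabs_def1; lra. }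
    specialize (Hpos x Ex) as Hpx. set (r := rho x) in *.
    set (D := d x e0 + B). assert (HD0 : 0 < D) by (unfold D; pose proof (met_ge0 d Hd x e0); lra).
    assert (HD : forall e, E e -> d x e <= D).
    { intros e Ee. pose proof (met_tri d Hd x e0 e). specialize (HB e Ee). pose proof (Rle_abs (d e0 e)).
      unfold D; lra. }
    (* Lipschitz constant at [x] for the quotients d(.,e)/rho, valid where rho >= r/2 and uniform in
       e because d(x,e) <= D. *)
    set (L := 2 / r + 2 * D / (r * r)).
    assert (HL : 0 < L).
    { unfold L. assert (0 < 2 / r) by (apply Rdiv_lt_0_compat; lra).
      assert (0 < 2 * D / (r * r)) by (apply Rdiv_lt_0_compat; nra). lra. }
    exists (Rmin (r / 2) (eps / (2 * L))). split.
    { apply Rmin_glb_lt; apply Rdiv_lt_0_compat; lra. }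
    intros y _ Hy.
    assert (Hy1 := Rlt_le_trans _ _ _ Hy (Rmin_l _ _)). assert (Hy2 := Rlt_le_trans _ _ _ Hy (Rmin_r _ _)).
    pose proof (RL x y) as HRL. apply Rabs_le_inv in HRL. fold r in HRL.
    set (s := rho y) in *. set (tt := d x y) in *.
    assert (Hs : r / 2 <= s) by lra.
    assert (Ey : ~ E y) by (intros Ey; apply RZ in Ey; fold s in Ey; lra).
    assert (Htt : tt * L < eps / 2).
    { apply Rmult_lt_compat_r with (r := L) in Hy2; auto.
      replace (eps / (2 * L) * L) with (eps / 2) in Hy2 by (field; lra). auto. }
    assert (Ht0 : 0 <= tt) by apply (met_ge0 d Hd).
    assert (Hkey : forall e, E e -> Rabs (d x e / r - d y e / s) <= tt * L).
    { intros e Ee. specialize (HD e Ee). pose proof (met_ge0 d Hd x e) as Hxe.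
      replace (d x e / r - d y e / s) with ((d x e - d y e) * / s + d x e * ((s - r) * (/ r * / s))) by (field; lra).
      assert (Hi : 0 < / s <= 2 / r).
      { split; [apply Rinv_0_lt_compat; lra|]. replace (2 / r) with (/ (r / 2)) by (field; lra).
        apply Rinv_le_contravar; lra. }
      assert (Hir : 0 < / r) by (apply Rinv_0_lt_compat; lra).
      assert (A1 : Rabs ((d x e - d y e) * / s) <= tt * (2 / r)).
      { rewrite Rabs_mult, (Rabs_right (/ s)) by lra. apply Rmult_le_compat; try lra; [apply Rabs_pos|].
        pose proof (met_tri d Hd x y e). pose proof (met_tri d Hd y x e). rewrite (met_sym d Hd y x) in H0.
        apply Rabs_le. fold tt in H, H0. lra. }
      assert (A2 : Rabs (d x e * ((s - r) * (/ r * / s))) <= D * (tt * (/ r * (2 / r)))).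
      { rewrite Rabs_mult, (Rabs_right (d x e)) by lra.
        assert (0 < / r * / s) by (apply Rmult_lt_0_compat; lra).
        apply Rmult_le_compat; auto; [apply Rabs_pos|].
        rewrite Rabs_mult, (Rabs_right (/ r * / s)) by lra.
        apply Rmult_le_compat; auto; [apply Rabs_pos|lra|apply Rabs_le; lra|].
        apply Rmult_le_compat_l; lra. }
      eapply Rle_trans; [apply Rabs_triang|].
      assert (tt * L = tt * (2 / r) + D * (tt * (/ r * (2 / r)))) by (unfold L; field; lra). lra. }
    destruct (HGn x Ex) as [X1 X2]. destruct (HGn y Ey) as [Y1 Y2]. fold r in X1, X2. fold s in Y1, Y2.
    destruct (X2 (eps/2)) as [a [Ea Ha]]; [lra|]. destruct (Y2 (eps/2)) as [b [Eb Hb]]; [lra|].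
    specialize (X1 b Eb). specialize (Y1 a Ea).
    pose proof (Rabs_le_inv _ _ (Hkey a Ea)). pose proof (Rabs_le_inv _ _ (Hkey b Eb)).
    apply Rabs_def1; lra.
Qed.

End Tietze.

(** * Stone-Weierstrass *)

(** The square root is that of s^2: for |s| <= 1 these polynomials in s^2 increase to |s|. *)
Fixpoint sqrt_iter (s : R) (n : nat) : R :=
  match n with O => 0 | S n => sqrt_iter s n + (s * s - sqrt_iter s n * sqrt_iter s n) / 2 end.

(** One step multiplies the error by at most 1 - |s|/2; the weight 1 + n|s|/2 absorbs this factor
    and leads to the error bound 2/n, uniform even near s = 0. *)
Lemma sqrt_iter_spec s n : Rabs s <= 1 ->
  0 <= sqrt_iter s n <= Rabs s /\ (Rabs s - sqrt_iter s n) * (1 + INR n * Rabs s / 2) <= Rabs s.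
Proof.
  intros Hs. pose proof (Rabs_pos s) as H0.
  assert (Hsq : s * s = Rabs s * Rabs s) by (rewrite <- Rabs_mult; rewrite Rabs_right; nra).
  set (t := Rabs s) in *. induction n.
  - simpl. lra.
  - destruct IHn as [[A1 A2] A3]. cbn [sqrt_iter]. rewrite Hsq. rewrite S_INR.
    set (y := sqrt_iter s n) in *. pose proof (pos_INR n) as Hn.
    assert (E : t - (y + (t * t - y * y) / 2) = (t - y) * (1 - (t + y) / 2)) by field.
    split; [split; nra|]. rewrite E.
    apply Rle_trans with ((t - y) * (1 + INR n * t / 2)); auto.
    rewrite Rmult_assoc. apply Rmult_le_compat_l; [lra|].
    assert (Hnt : 0 <= INR n * t) by nra.
    apply Rle_trans with ((1 - t / 2) * (1 + (INR n + 1) * t / 2)); [|nra].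
    apply Rmult_le_compat_r; nra.
Qed.

Lemma sqrt_iter_err s n : Rabs s <= 1 -> Rabs (Rabs s - sqrt_iter s n) * INR n <= 2.
Proof.
  intros Hs. destruct (sqrt_iter_spec s n Hs) as [[A1 A2] A3]. pose proof (pos_INR n).
  rewrite (Rabs_right (Rabs s - _)) by lra. set (t := Rabs s) in *. set (y := sqrt_iter s n) in *.
  destruct (Rle_lt_or_eq_dec 0 t (Rabs_pos s)) as [Ht|Ht].
  - assert ((t - y) * INR n * t <= 2 * t) by nra. nra.
  - replace (t - y) with 0 by lra. lra.
Qed.

Section StoneWeierstrass.
Context {T : Type} (d : T -> T -> R) (Hd : is_metric d) (K : T -> Prop) (A : (T -> R) -> Prop).
Hypothesis HK : compact_set d K.
Hypothesis A_const : forall c, A (fun _ => c).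
Hypothesis A_add : forall f g, A f -> A g -> A (fun x => f x + g x).
Hypothesis A_mul : forall f g, A f -> A g -> A (fun x => f x * g x).
Hypothesis A_lim : forall f, (forall eps, 0 < eps -> exists a, A a /\ forall x, K x -> Rabs (f x - a x) <= eps) -> A f.
Hypothesis A_cont : forall f, A f -> scont d K f.

Lemma A_ext f g : (forall x, f x = g x) -> A f -> A g.
Proof. intros H Hf. replace g with f; auto. apply functional_extensionality; auto. Qed.

Lemma A_abs f : A f -> A (fun x => Rabs (f x)).
Proof.
  intros Hf.
  destruct (scont_bounded d Hd K f (compact_cluster d Hd K HK) (A_cont f Hf)) as [B [HB Hb]].
  apply A_lim. intros e He.
  destruct (INR_unbounded (2 * B / e)) as [n Hn].
  exists (fun x => B * sqrt_iter (/ B * f x) n). split.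
  - apply A_mul; [apply A_const|].
    assert (Hs : A (fun x => / B * f x)) by (apply A_mul; auto).
    induction n; simpl; [apply A_const|]; clear Hn.
    assert (G : forall n, A (fun x => sqrt_iter (/ B * f x) n)).
    { clear n IHn. induction n; simpl; [apply A_const|].
      apply A_add; auto. unfold Rdiv. apply A_mul; [|apply A_const].
      apply A_ext with (fun x => (/ B * f x) * (/ B * f x) + (-1) * (sqrt_iter (/ B * f x) n * sqrt_iter (/ B * f x) n));
        [intros; ring|].
      apply A_add; [apply A_mul; auto|]. apply A_mul; [apply A_const|apply A_mul; auto]. }
    apply (G (S n)).
  - intros x Kx. specialize (Hb x Kx).
    assert (HiB : 0 < / B) by (apply Rinv_0_lt_compat; auto).
    set (s := / B * f x).
    assert (E : Rabs (f x) = B * Rabs s).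
    { unfold s. rewrite Rabs_mult, (Rabs_right (/ B)) by lra. field. lra. }
    assert (Hs : Rabs s <= 1).
    { apply Rmult_le_reg_l with B; auto. rewrite <- E. lra. }
    pose proof (sqrt_iter_err s n Hs) as H.
    rewrite E. replace (B * Rabs s - B * sqrt_iter s n) with (B * (Rabs s - sqrt_iter s n)) by ring.
    rewrite Rabs_mult, (Rabs_right B) by lra.
    set (v := Rabs (Rabs s - sqrt_iter s n)) in *.
    assert (Hv : 0 <= v) by apply Rabs_pos.
    assert (HBn : 2 * B < INR n * e).
    { apply Rmult_gt_compat_r with (r := e) in Hn; auto.
      replace (2 * B / e * e) with (2 * B) in Hn by (field; lra). lra. }
    assert (Hnpos : 0 < INR n) by nra.
    apply Rmult_le_reg_r with (INR n); auto. nra.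
Qed.

Lemma A_max f g : A f -> A g -> A (fun x => Rmax (f x) (g x)).
Proof.
  intros Hf Hg. apply A_ext with (fun x => (f x + g x + Rabs (f x + (-1) * g x)) * / 2).
  - intros x. unfold Rmax, Rabs. destruct (Rle_dec (f x) (g x)), (Rcase_abs (f x + -1 * g x)); lra.
  - apply A_mul; [|apply A_const]. apply A_add; [apply A_add; auto|]. apply A_abs.
    apply A_add; auto.
Qed.

Lemma A_min f g : A f -> A g -> A (fun x => Rmin (f x) (g x)).
Proof.
  intros Hf Hg. apply A_ext with (fun x => (f x + g x + (-1) * Rabs (f x + (-1) * g x)) * / 2).
  - intros x. unfold Rmin, Rabs. destruct (Rle_dec (f x) (g x)), (Rcase_abs (f x + -1 * g x)); lra.
  - apply A_mul; [|apply A_const]. apply A_add; [apply A_add; auto|]. apply A_mul; [apply A_const|].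
    apply A_abs. apply A_add; auto.
Qed.

Lemma open_gt a b : scont d K a -> scont d K b -> rel_open d K (fun z => a z < b z).
Proof.
  intros Ha Hb x Kx Hx.
  destruct (scont_eps d Hd K _ (scont_sub d K b a Hb Ha) x Kx (b x - a x)) as [del [Hdel H]]; [lra|].
  exists del. split; auto. intros y Ky Hy. specialize (H y Ky Hy). apply Rabs_def2 in H. lra.
Qed.

(** Interpolation at pairs of points replaces separation, because it will be used with separating
    functions that all vanish on [E]; there the target vanishes too. *)
Lemma stone_weierstrass f : scont d K f ->
  (forall x y, K x -> K y -> exists a, A a /\ a x = f x /\ a y = f y) -> A f.
Proof.
  intros Hf Hint. apply A_lim. intros e He.
  assert (Hup : forall x, K x -> exists b, A b /\ (forall y, K y -> f y - e < b y) /\ b x = f x).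
  { intros x Kx.
    assert (Hc : forall y, exists a, A a /\ a x = f x /\ (K y -> a y = f y)).
    { intros y. destruct (classic (K y)) as [Ky|Ky].
      - destruct (Hint x y Kx Ky) as [a [H1 [H2 H3]]]. exists a; auto.
      - exists (fun _ => f x). split; [apply A_const|]. tauto. }
    apply choice in Hc. destruct Hc as [c Hc].
    destruct (HK T (fun y z => K y /\ f z - e < c y z)) as [l Hl].
    - intros y z Kz [Ky Hz].
      destruct (open_gt (fun z => f z - e) (c y)) with (x := z) as [del [Hdel H]]; auto.
      + apply scont_sub; auto; apply scont_const.
      + apply A_cont, Hc.
      + exists del. split; auto.
    - intros y Ky. exists y. split; auto. destruct (Hc y) as [_ [_ H]]. rewrite H by auto. lra.
    (* Every [c y] takes the value f x at [x], so the maximum started from [c x] keeps it. *)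
    - exists (fun z => fold_right (fun y acc => Rmax (c y z) acc) (c x z) l).
      split; [|split].
      + clear Hl. induction l; simpl; [apply Hc|]. apply A_max; auto. apply Hc.
      + intros y Ky. destruct (Hl y Ky) as [i [Hi [_ Hiy]]]. eapply Rlt_le_trans; [exact Hiy|].
        clear -Hi. induction l; simpl; [destruct Hi|]. destruct Hi as [->|Hi]; [apply Rmax_l|].
        eapply Rle_trans; [apply IHl; auto|apply Rmax_r].
      + clear Hl. cbv beta. induction l as [|a l IHl]; [apply (Hc x); auto|]. simpl. rewrite IHl.
        destruct (Hc a) as [_ [-> _]]. apply Rmax_left; lra. }
  destruct (scont_bounded d Hd K f (compact_cluster d Hd K HK) Hf) as [M [HM0 HM]].
  assert (Hc : forall x, exists b, A b /\ (forall y, K y -> f y - e < b y) /\ (K x -> b x = f x)).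
  { intros x. destruct (classic (K x)) as [Kx|Kx].
    - destruct (Hup x Kx) as [b [H1 [H2 H3]]]. exists b; auto.
    - exists (fun _ => M). split; [apply A_const|]. split; [|tauto].
      intros y Ky. specialize (HM y Ky). apply Rabs_le_inv in HM. lra. }
  apply choice in Hc. destruct Hc as [c Hc].
  destruct (HK T (fun y z => K y /\ c y z < f z + e)) as [l Hl].
  - intros y z Kz [Ky Hz].
    destruct (open_gt (c y) (fun z => f z + e)) with (x := z) as [del [Hdel H]]; auto.
    + apply A_cont, Hc.
    + apply scont_add; auto; apply scont_const.
    + exists del. split; auto.
  - intros y Ky. exists y. split; auto. destruct (Hc y) as [_ [_ H]]. rewrite H by auto. lra.
  - exists (fun z => fold_right (fun y acc => Rmin (c y z) acc) M l). split.
    + clear Hl. induction l; simpl; [apply A_const|]. apply A_min; auto. apply Hc.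
    + intros x Kx. apply Rabs_le. split.
      * assert (fold_right (fun y acc => Rmin (c y x) acc) M l <= f x + e); [|lra].
        destruct (Hl x Kx) as [i [Hi [_ Hix]]]. apply Rle_trans with (c i x); [|lra].
        clear -Hi. induction l; simpl; [destruct Hi|]. destruct Hi as [->|Hi]; [apply Rmin_l|].
        eapply Rle_trans; [apply Rmin_r|apply IHl; auto].
      * assert (f x - e <= fold_right (fun y acc => Rmin (c y x) acc) M l); [|lra].
        clear Hl. induction l; simpl.
        -- specialize (HM x Kx). apply Rabs_le_inv in HM. lra.
        -- apply Rmin_glb; auto. left. apply (Hc a); auto.
Qed.

End StoneWeierstrass.

(** * Perturbing zeros away on spaces of dimension at most one *)

Fixpoint Csum (n : nat) (f : nat -> C) : C :=
  match n with O => C0 | S n => (Csum n f + f n)%Cx end.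
Fixpoint Rsum (n : nat) (f : nat -> R) : R :=
  match n with O => 0 | S n => Rsum n f + f n end.

Lemma Csum_zero n f : (forall j, (j < n)%nat -> f j = C0) -> Csum n f = C0.
Proof. induction n; simpl; intros H; auto. rewrite IHn, H; auto. ring. Qed.

Lemma Csum_one n f i : (i < n)%nat -> (forall j, (j < n)%nat -> j <> i -> f j = C0) -> Csum n f = f i.
Proof.
  induction n; intros Hi H; [lia|]. simpl. destruct (Nat.eq_dec i n) as [->|Hin].
  - rewrite Csum_zero; [ring|]. intros; apply H; lia.
  - rewrite IHn, (H n); [ring| | | |]; try lia. intros; apply H; lia.
Qed.

Lemma Csum_two n f i k : (i < k)%nat -> (k < n)%nat ->
  (forall j, (j < n)%nat -> j <> i -> j <> k -> f j = C0) -> Csum n f = (f i + f k)%Cx.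
Proof.
  induction n; intros Hi Hk H; [lia|]. simpl. destruct (Nat.eq_dec k n) as [->|Hkn].
  - rewrite (Csum_one n f i); auto. intros; apply H; lia.
  - rewrite IHn, (H n); [ring| | | | | |]; try lia. intros; apply H; lia.
Qed.

Lemma scontC_Csum {T} (d : T -> T -> R) K n (f : nat -> T -> C) :
  (forall j, (j < n)%nat -> scontC d K (f j)) -> scontC d K (fun x => Csum n (fun j => f j x)).
Proof. induction n; simpl; intros H; [apply scontC_const|]. apply scontC_add; auto. Qed.

Lemma scont_Rsum {T} (d : T -> T -> R) K n (f : nat -> T -> R) :
  (forall j, (j < n)%nat -> scont d K (f j)) -> scont d K (fun x => Rsum n (fun j => f j x)).
Proof. induction n; simpl; intros H; [apply scont_const|]. apply scont_add; auto. Qed.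

Lemma Rsum_ge n f i : (forall j, (j < n)%nat -> 0 <= f j) -> (i < n)%nat -> f i <= Rsum n f.
Proof.
  assert (G : forall n, (forall j, (j < n)%nat -> 0 <= f j) -> 0 <= Rsum n f).
  { clear. induction n; simpl; intros H; [lra|]. specialize (IHn ltac:(auto)). pose proof (H n ltac:(lia)). lra. }
  induction n; simpl; intros H Hi; [lia|]. destruct (Nat.eq_dec i n) as [->|Hin].
  - specialize (G n ltac:(auto)). lra.
  - specialize (IHn ltac:(auto) ltac:(lia)). pose proof (H n ltac:(lia)). lra.
Qed.

Lemma Csum_weighted n (w : nat -> R) (g : nat -> C) c e : 0 <= e -> (forall j, (j < n)%nat -> 0 <= w j) ->
  (forall j, (j < n)%nat -> 0 < w j -> Cabs (g j - c)%Cx <= e) ->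
  Cabs (Csum n (fun j => RtoC (w j) * g j) - RtoC (Rsum n w) * c)%Cx <= Rsum n w * e.
Proof.
  intros He. induction n; simpl; intros H0 H.
  - replace (C0 - RtoC 0 * c)%Cx with C0 by (apply C_ext; simpl; ring). rewrite Cabs_C0; lra.
  - set (S := Csum n _) in *.
    replace (S + RtoC (w n) * g n - RtoC (Rsum n w + w n) * c)%Cx with
      ((S - RtoC (Rsum n w) * c) + RtoC (w n) * (g n - c))%Cx by (apply C_ext; simpl; ring).
    eapply Rle_trans; [apply Cabs_add|]. rewrite Cabs_mul, Cabs_RtoC.
    specialize (IHn ltac:(auto) ltac:(auto)). pose proof (H0 n ltac:(lia)) as Hn.
    rewrite (Rabs_right (w n)) by lra.
    destruct (Rle_lt_or_eq_dec _ _ Hn) as [Hw|Hw].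
    + specialize (H n ltac:(lia) Hw). nra.
    + rewrite <- Hw. lra.
Qed.

(** Vanishes exactly when [w] and [g] are linearly dependent over the reals. *)
Definition Cdet (w g : C) : R := Cim (w * Cconj g)%Cx.

Lemma Cdet_lip w w' g : Rabs (Cdet w' g - Cdet w g) <= Cabs (w' - w)%Cx * Cabs g.
Proof.
  replace (Cdet w' g - Cdet w g) with (Cdet (w' - w)%Cx g) by (unfold Cdet; simpl; ring).
  unfold Cdet. eapply Rle_trans; [apply Rabs_Cim|]. rewrite Cabs_mul. right. f_equal.
  unfold Cabs; f_equal; simpl; ring.
Qed.

(** A small step along i g leaves the real line of [g], and a small disc then stays clear of it;
    carrying the disc along lets the remaining lines be avoided inside it. *)
Lemma avoid_lines (l : list C) : (forall g, In g l -> g <> C0) -> forall a r, 0 < r ->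
  exists w r', 0 < r' /\ Cabs (w - a)%Cx + r' <= r /\
    forall w', Cabs (w' - w)%Cx <= r' -> forall g, In g l -> Cdet w' g <> 0.
Proof.
  induction l as [|g l IH]; intros Hl a r Hr.
  - exists a, r. replace (a - a)%Cx with C0 by ring. rewrite Cabs_C0. split; auto. split; [lra|].
    intros w' _ g [].
  - assert (Hg : g <> C0) by (apply Hl; left; auto).
    pose proof (Cabs_pos g Hg) as Hgp.
    assert (H1 : exists w, Cabs (w - a)%Cx <= r / 2 /\ Cdet w g <> 0).
    { destruct (Req_dec (Cdet a g) 0) as [E|E].
      - exists (a + mkC 0 (r / 2 / Cabs g) * g)%Cx. split.
        + replace (a + mkC 0 (r / 2 / Cabs g) * g - a)%Cx with (mkC 0 (r / 2 / Cabs g) * g)%Cx by ring.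
          rewrite Cabs_mul. assert (Hi : Cabs (mkC 0 (r / 2 / Cabs g)) = r / 2 / Cabs g).
          { unfold Cabs at 1; simpl. set (v := r / 2 / Cabs g).
            replace (0 * 0 + v * v) with (Rsqr v) by (unfold Rsqr; ring). apply sqrt_Rsqr.
            unfold v. left. apply Rdiv_lt_0_compat; lra. }
          rewrite Hi. right. field. lra.
        + unfold Cdet in *. set (v := r / 2 / Cabs g). assert (Hv : 0 < v) by (unfold v; apply Rdiv_lt_0_compat; lra).
          assert (Hn := Cn2_neq0 g Hg). unfold Cn2 in Hn. simpl in *.
          match goal with |- ?x <> 0 => replace x with (v * (Cre g * Cre g + Cim g * Cim g)) by lra end. nra.
      - exists a. replace (a - a)%Cx with C0 by ring. rewrite Cabs_C0. split; auto. lra. }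
    destruct H1 as [w [Hw1 Hw2]].
    pose proof (Rabs_pos_lt _ Hw2) as Hwp.
    set (r1 := Rmin (r / 2) (Rabs (Cdet w g) / 2 / Cabs g)).
    assert (Hr1 : 0 < r1) by (apply Rmin_glb_lt; [lra|apply Rdiv_lt_0_compat; lra]).
    destruct (IH (fun g Hg => Hl g (or_intror Hg)) w r1 Hr1) as [w2 [r2 [Hr2 [Hw3 Hw4]]]].
    exists w2, r2. split; auto. split.
    + pose proof (Cabs_triang w2 w a). pose proof (Rmin_l (r/2) (Rabs (Cdet w g) / 2 / Cabs g)). fold r1 in H0. lra.
    + intros w' Hw' g' [<-|Hg']; [|apply (Hw4 w'); auto].
      intros E. pose proof (Cdet_lip w w' g) as HL. rewrite E in HL.
      rewrite Rminus_0_l, Rabs_Ropp in HL.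
      pose proof (Cabs_triang w' w2 w). pose proof (Rmin_r (r/2) (Rabs (Cdet w g) / 2 / Cabs g)) as Hm. fold r1 in Hm.
      assert (Hwr : Cabs (w' - w)%Cx <= Rabs (Cdet w g) / 2 / Cabs g) by lra.
      apply Rmult_le_compat_r with (r := Cabs g) in Hwr; [|lra].
      replace (Rabs (Cdet w g) / 2 / Cabs g * Cabs g) with (Rabs (Cdet w g) / 2) in Hwr by (field; lra). lra.
Qed.

Lemma general_position (a : nat -> C) e N : 0 < e -> exists g : nat -> C,
  (forall j, (j < N)%nat -> Cabs (g j - a j)%Cx <= e /\ g j <> C0) /\
  forall i j, (i < j)%nat -> (j < N)%nat -> Cdet (g j) (g i) <> 0.
Proof.
  intros He. induction N as [|N [g [H1 H2]]].
  - exists a. split; intros; lia.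
  - destruct (avoid_lines (C1 :: map g (seq 0 N))) with (a := a N) (r := e) as [w [r [Hr [Hw1 Hw2]]]]; auto.
    { intros x [<-|Hx]; [apply C1_neq0|]. apply in_map_iff in Hx. destruct Hx as [j [<- Hj]].
      apply in_seq in Hj. apply H1; lia. }
    assert (Hww : Cabs (w - w)%Cx <= r) by (replace (w - w)%Cx with C0 by ring; rewrite Cabs_C0; lra).
    specialize (Hw2 w Hww).
    exists (fun j => if Nat.eq_dec j N then w else g j). split.
    + intros j Hj. destruct (Nat.eq_dec j N) as [->|Hn]; [|apply H1; lia]. split; [lra|].
      intros ->. apply (Hw2 C1 (or_introl eq_refl)). unfold Cdet; simpl; ring.
    + intros i j Hij Hj. destruct (Nat.eq_dec i N); [lia|]. destruct (Nat.eq_dec j N) as [->|Hn].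
      * apply Hw2. right. apply in_map, in_seq. lia.
      * apply H2; lia.
Qed.

Section DimensionOne.
Context {T : Type} (d : T -> T -> R) (Hd : is_metric d) (K : T -> Prop).
Hypothesis HK : compact_set d K.
Hypothesis Hdim : covering_dim_le1 d K.

(** Distance to the complement of [V], capped at 1 by [None], which also keeps the family nonempty
    when [V] is everything. *)
Lemma bump_function (V : T -> Prop) : rel_open d K V -> exists f : T -> R, scont d K f /\
  forall x, K x -> 0 <= f x /\ (V x <-> 0 < f x).
Proof.
  intros HV.
  destruct (inf_family (option T) (fun o => match o with None => True | Some y => K y /\ ~ V y end)
    (fun x o => match o with None => 1 | Some y => d x y end) 0) as [f Hf].
  { exists None; auto. }
  { intros x [y|] _; [apply (met_ge0 d Hd)|lra]. }
  assert (H0 : forall x, 0 <= f x).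
  { intros x. apply Rnot_lt_le; intros Hlt. destruct (Hf x) as [_ H].
    destruct (H (- f x)) as [[y|] [_ Hy]]; [lra| |lra]. pose proof (met_ge0 d Hd x y). lra. }
  assert (HL : forall x y, f x - f y <= d x y).
  { intros x y. apply le_epsilon. intros e He. destruct (Hf y) as [_ H].
    destruct (H e He) as [[a|] [Pa Ha]]; destruct (Hf x) as [H1 _].
    - specialize (H1 (Some a) Pa). simpl in H1. pose proof (met_tri d Hd x y a). lra.
    - specialize (H1 None I). simpl in H1. pose proof (met_ge0 d Hd x y). lra. }
  exists f. split.
  - apply scont_intro. intros x _ e He. exists e. split; auto. intros y _ Hy.
    pose proof (HL x y). pose proof (HL y x). rewrite (met_sym d Hd y x) in H1. apply Rabs_def1; lra.
  - intros x Kx. split; auto. split.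
    + intros Vx. destruct (HV x Kx Vx) as [del [Hdel H]].
      destruct (Hf x) as [_ H1].
      apply Rlt_le_trans with (Rmin 1 del / 2); [assert (0 < Rmin 1 del) by (apply Rmin_glb_lt; lra); lra|].
      apply Rnot_lt_le; intros Hlt. destruct (H1 (Rmin 1 del / 2)) as [[y|] [Py Hy]].
      * assert (0 < Rmin 1 del) by (apply Rmin_glb_lt; lra). lra.
      * destruct Py as [Ky Vy]. apply Vy, H; auto. pose proof (Rmin_r 1 del). lra.
      * pose proof (Rmin_l 1 del). lra.
    + intros Hx. apply NNPP; intros Vx. destruct (Hf x) as [H1 _].
      specialize (H1 (Some x) (conj Kx Vx)). simpl in H1. rewrite (met_refl d Hd) in H1. lra.
Qed.

(** Factor through the nerve of a fine cover in which no three sets meet, and map the vertices to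
    nonzero values that are pairwise independent over the reals: a positive combination of one or
    two of them is never 0. *)
Lemma nonvanishing_approx (g1 : T -> C) e : scontC d K g1 -> 0 < e ->
  exists g, scontC d K g /\ forall x, K x -> g x <> C0 /\ Cabs (g x - g1 x)%Cx <= e.
Proof.
  intros Hg1 He.
  set (U := fun y x => Cabs (g1 x - g1 y)%Cx < e / 4).
  assert (HU : forall y, rel_open d K (U y)).
  { intros y. apply (open_gt d Hd K (fun x => Cabs (g1 x - g1 y)%Cx) (fun _ => e / 4)).
    - apply scont_Cabs, scontC_sub; auto. apply scontC_const.
    - apply scont_const. }
  destruct (HK T U HU) as [l Hl].
  { intros x _. exists x. unfold U. replace (g1 x - g1 x)%Cx with C0 by ring. rewrite Cabs_C0; lra. }
  destruct (Hdim (map U l)) as [Vs [HVo [HVc [HVr HVd]]]].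
  { intros V HV. apply in_map_iff in HV. destruct HV as [y [<- _]]. auto. }
  { intros x Kx. destruct (Hl x Kx) as [y [Hy Hx]]. exists (U y). split; auto. apply in_map; auto. }
  set (N := length Vs). set (V := fun j => nth j Vs (fun _ => False)).
  assert (HVin : forall j, (j < N)%nat -> In (V j) Vs) by (intros; apply nth_In; auto).
  assert (Ha : forall j, exists a, (j < N)%nat -> forall x, K x -> V j x -> Cabs (g1 x - a)%Cx < e / 4).
  { intros j. destruct (Nat.lt_ge_cases j N) as [Hj|Hj]; [|exists C0; lia].
    destruct (HVr (V j) (HVin j Hj)) as [W [HW Hsub]]. apply in_map_iff in HW. destruct HW as [y [<- _]].
    exists (g1 y). intros _ x Kx Vx. apply (Hsub x Kx Vx). }
  apply choice in Ha. destruct Ha as [a Ha].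
  assert (Hb : forall j, exists f : T -> R, (j < N)%nat -> scont d K f /\
     forall x, K x -> 0 <= f x /\ (V j x <-> 0 < f x)).
  { intros j. destruct (Nat.lt_ge_cases j N) as [Hj|Hj]; [|exists (fun _ => 0); lia].
    destruct (bump_function (V j) (HVo _ (HVin j Hj))) as [f Hf]. exists f; auto. }
  apply choice in Hb. destruct Hb as [b Hb].
  destruct (general_position a (e/4) N) as [g [Hga Hgp]]; [lra|].
  set (s := fun x => Rsum N (fun j => b j x)).
  assert (Hcov : forall x, K x -> exists i, (i < N)%nat /\ 0 < b i x).
  { intros x Kx. destruct (HVc x Kx) as [W [HW Wx]].
    destruct (In_nth Vs W (fun _ => False) HW) as [i [Hi Ei]]. exists i. split; auto.
    apply (Hb i Hi); auto. unfold V. rewrite Ei; auto. }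
  assert (Hs : forall x, K x -> 0 < s x).
  { intros x Kx. destruct (Hcov x Kx) as [i [Hi Hbi]]. eapply Rlt_le_trans; [exact Hbi|].
    apply (Rsum_ge N (fun j => b j x)); auto. intros j Hj. apply (Hb j Hj); auto. }
  exists (fun x => RtoC (/ s x) * Csum N (fun j => RtoC (b j x) * g j))%Cx. split.
  - apply scontC_mul.
    + apply scontC_RtoC, scont_inv; [|intros x Kx; apply Rgt_not_eq, Hs; auto].
      apply scont_Rsum. intros j Hj; apply (Hb j Hj).
    + apply (scontC_Csum d K N (fun j x => RtoC (b j x) * g j)%Cx). intros j Hj.
      apply scontC_mul; [apply scontC_RtoC, (Hb j Hj)|apply scontC_const].
  - intros x Kx. specialize (Hs x Kx). split.
    + apply Cmul_neq0; [apply RtoC_neq0, Rgt_not_eq, Rinv_0_lt_compat; auto|].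
      assert (Hnz : forall j, (j < N)%nat -> ~ 0 < b j x -> (RtoC (b j x) * g j)%Cx = C0).
      { intros j Hj Hn. destruct (Hb j Hj) as [_ H]. destruct (H x Kx) as [H1 _].
        replace (b j x) with 0 by lra. apply C_ext; simpl; ring. }
      assert (Hpair : forall i k, (i < k)%nat -> (k < N)%nat -> 0 < b i x -> 0 < b k x ->
         Csum N (fun j => RtoC (b j x) * g j)%Cx <> C0).
      { intros i k Hik Hk Bi Bk.
        rewrite (Csum_two N _ i k Hik Hk).
        - intros E. apply (Hgp i k Hik Hk).
          assert (E2 : Cdet (RtoC (b i x) * g i + RtoC (b k x) * g k)%Cx (g i) = 0)
            by (rewrite E; unfold Cdet; simpl; ring).
          assert (E3 : b k x * Cdet (g k) (g i) = 0) by (rewrite <- E2; unfold Cdet, RtoC; simpl; ring).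
          apply Rmult_integral in E3. destruct E3; [lra|auto].
        (* A third active index would put [x] into three members of the cover. *)
        - intros j Hj Hji Hjk. apply Hnz; auto. intros Bj.
          assert (HV : forall j, (j < N)%nat -> 0 < b j x -> V j x) by (intros j' Hj' B; apply (Hb j' Hj'); auto).
          pose proof (HV i ltac:(lia) Bi). pose proof (HV k Hk Bk). pose proof (HV j Hj Bj).
          destruct (Nat.lt_trichotomy j i) as [L|[L|L]]; [|lia|destruct (Nat.lt_trichotomy j k) as [L2|[L2|L2]]; [|lia|]].
          + apply (HVd x Kx j i k); auto.
          + apply (HVd x Kx i j k); auto.
          + apply (HVd x Kx i k j); auto. }
      destruct (Hcov x Kx) as [i [Hi Bi]].
      destruct (classic (exists k, (k < N)%nat /\ k <> i /\ 0 < b k x)) as [[k [Hk [Hki Bk]]]|Hno].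
      * destruct (Nat.lt_trichotomy i k) as [L|[L|L]]; [apply (Hpair i k)|lia|apply (Hpair k i)]; auto.
      * rewrite (Csum_one N _ i Hi).
        -- apply Cmul_neq0; [apply RtoC_neq0; lra|]. apply Hga; auto.
        -- intros j Hj Hji. apply Hnz; auto. intros Bj. apply Hno; exists j; auto.
    + pose proof (Csum_weighted N (fun j => b j x) g (g1 x) e ltac:(lra)) as HW.
      fold (s x) in HW. cbv beta in HW.
      assert (HW' : Cabs (Csum N (fun j => RtoC (b j x) * g j) - RtoC (s x) * g1 x)%Cx <= s x * e).
      { apply HW; [intros j Hj; apply (Hb j Hj); auto|]. intros j Hj Bj.
        destruct (Hga j Hj) as [G1 _]. assert (Vx : V j x) by (apply (Hb j Hj); auto).
        specialize (Ha j Hj x Kx Vx). pose proof (Cabs_triang (g j) (a j) (g1 x)) as HT.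
        rewrite (Cabs_sub_sym (a j)) in HT. lra. }
      set (S := Csum N _) in *.
      assert (E : (RtoC (/ s x) * S - g1 x)%Cx = (RtoC (/ s x) * (S - RtoC (s x) * g1 x))%Cx).
      { transitivity (RtoC (/ s x) * S - RtoC (/ s x * s x) * g1 x)%Cx.
        - rewrite Rinv_l by lra. apply C_ext; simpl; ring.
        - apply C_ext; simpl; ring. }
      assert (Hi : 0 < / s x) by (apply Rinv_0_lt_compat; auto).
      rewrite E, Cabs_mul, Cabs_RtoC, Rabs_right by lra.
      apply Rmult_le_reg_l with (s x); auto. rewrite <- Rmult_assoc, Rinv_r by lra. lra.
Qed.

Lemma nonvanishing_approx_rel (E : T -> Prop) (g1 : T -> C) c e : scontC d K g1 -> 0 < e -> 0 < c ->
  (forall x, E x -> K x) -> (forall x, E x -> c <= Cabs (g1 x)) ->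
  exists g, scontC d K g /\ (forall x, K x -> g x <> C0 /\ Cabs (g x - g1 x)%Cx <= e) /\
    forall x, E x -> g x = g1 x.
Proof.
  intros Hg1 He Hc HEK HE.
  set (h := Rmin e (c / 3)). assert (Hh : 0 < h) by (apply Rmin_glb_lt; lra).
  assert (Hhe : h <= e) by apply Rmin_l. assert (Hhc : h <= c / 3) by apply Rmin_r.
  destruct (nonvanishing_approx g1 h Hg1 Hh) as [g [Hg Hgn]].
  (* The cutoff is 1 where |g1| <= 2h and 0 where |g1| >= 3h, hence on [E]. Where |g1| > 2h, a
     correction of size at most h creates no zero. *)
  set (chi := fun x => Rmax 0 (Rmin 1 ((3 * h - Cabs (g1 x)) * / h))).
  assert (Hih : 0 < / h) by (apply Rinv_0_lt_compat; auto).
  assert (Hchi : forall x, 0 <= chi x <= 1).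
  { intros x. unfold chi. split; [apply Rmax_l|]. apply Rmax_lub; [lra|apply Rmin_l]. }
  exists (fun x => g1 x + RtoC (chi x) * (g x - g1 x))%Cx. split; [|split].
  - apply scontC_add; auto. apply scontC_mul; [|apply scontC_sub; auto].
    apply scontC_RtoC. unfold chi. apply scont_max; [apply scont_const|]. apply scont_min; [apply scont_const|].
    apply scont_mul; [|apply scont_const]. apply scont_sub; [apply scont_const|]. apply scont_Cabs; auto.
  - intros x Kx. destruct (Hgn x Kx) as [G1 G2]. specialize (Hchi x).
    assert (Hb : Cabs (RtoC (chi x) * (g x - g1 x))%Cx <= h).
    { rewrite Cabs_mul, Cabs_RtoC, Rabs_right by lra. pose proof (Cabs_ge0 (g x - g1 x)%Cx). nra. }
    split.
    + destruct (Rle_lt_dec (Cabs (g1 x)) (2 * h)) as [Hx|Hx].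
      * assert (chi x = 1) as ->.
        { unfold chi. assert (1 <= (3 * h - Cabs (g1 x)) * / h).
          { apply Rmult_le_reg_r with h; auto. rewrite Rmult_assoc, Rinv_l by lra. lra. }
          rewrite Rmin_left, Rmax_right; lra. }
        replace (g1 x + RtoC 1 * (g x - g1 x))%Cx with (g x); auto. apply C_ext; simpl; ring.
      * intros E0. pose proof (Cabs_sub_le (g1 x) (- (RtoC (chi x) * (g x - g1 x)))%Cx) as HT.
        replace (g1 x - - (RtoC (chi x) * (g x - g1 x)))%Cx with (g1 x + RtoC (chi x) * (g x - g1 x))%Cx in HT by ring.
        rewrite E0, Cabs_C0, Cabs_opp in HT. lra.
    + replace (g1 x + RtoC (chi x) * (g x - g1 x) - g1 x)%Cx with (RtoC (chi x) * (g x - g1 x))%Cx by ring. lra.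
  - intros x Ex. specialize (HE x Ex).
    assert (chi x = 0) as ->.
    { unfold chi. assert ((3 * h - Cabs (g1 x)) * / h <= 0) by nra.
      rewrite Rmin_right, Rmax_left; lra. }
    apply C_ext; simpl; ring.
Qed.

End DimensionOne.

(** * Collapsing E: the embedding and its polynomial algebra *)

Fixpoint fapp {A : Type} (m k : nat) : (Fin.t m -> A) -> (Fin.t k -> A) -> Fin.t (m + k) -> A :=
  match m return (Fin.t m -> A) -> (Fin.t k -> A) -> Fin.t (m + k) -> A with
  | O => fun _ b => b
  | S m => fun a b i => Fin.caseS' i (fun _ => A) (a Fin.F1) (fapp m k (fun j => a (Fin.FS j)) b)
  end.

Lemma fapp_L {A} m k (a : Fin.t m -> A) (b : Fin.t k -> A) i : fapp m k a b (Fin.L k i) = a i.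
Proof.
  induction m as [|m IH]; [apply (Fin.case0 (fun _ => _) i)|].
  apply (Fin.caseS' i); [reflexivity|]. intros j. simpl. apply (IH (fun j => a (Fin.FS j))).
Qed.

Lemma fapp_R {A} m k (a : Fin.t m -> A) (b : Fin.t k -> A) i : fapp m k a b (Fin.R m i) = b i.
Proof. induction m as [|m IH]; simpl; auto. Qed.

Lemma fapp_ind m k (P : Fin.t (m + k) -> Prop) :
  (forall i, P (Fin.L k i)) -> (forall i, P (Fin.R m i)) -> forall i, P i.
Proof.
  induction m as [|m IH]; simpl; intros HL HR i; [apply HR|].
  apply (Fin.caseS' i); [apply (HL Fin.F1)|]. apply (IH (fun j => P (Fin.FS j))).
  - intros j. apply (HL (Fin.FS j)).
  - auto.
Qed.

Definition fcons {A : Type} {k : nat} (a : A) (b : Fin.t k -> A) (i : Fin.t (S k)) : A :=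
  Fin.caseS' i (fun _ => A) a b.

Fixpoint psubst {N M} (s : Fin.t N -> poly M) (p : poly N) : poly M :=
  match p with
  | PConst c => PConst c
  | PVar i => s i
  | PAdd p q => PAdd (psubst s p) (psubst s q)
  | PMul p q => PMul (psubst s p) (psubst s q)
  end.

Lemma peval_psubst {N M} (s : Fin.t N -> poly M) p z :
  peval (psubst s p) z = peval p (fun i => peval (s i) z).
Proof. induction p; simpl; rewrite ?IHp1, ?IHp2; auto. Qed.

(** The copy of C^3 on which rho = 0, where the embedding puts [E]. [restr] pulls polynomials back
    along it, and [lift] gives polynomials in the [F] coordinates alone. *)
Definition slice {n} (z : Cn 3) : Cn (n + 4) := fapp n 4 (fun _ => C0) (fcons C0 z).
Definition restr {n} (p : poly (n + 4)) : poly 3 :=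
  psubst (fapp n 4 (fun _ => PConst C0) (fcons (PConst C0) PVar)) p.
Definition lift {n} (p : poly 3) : poly (n + 4) := psubst (fun j => PVar (Fin.R n (Fin.FS j))) p.

Lemma peval_restr {n} (p : poly (n + 4)) z : peval (restr p) z = peval p (slice z).
Proof.
  unfold restr. rewrite peval_psubst. f_equal. apply functional_extensionality.
  unfold slice. apply fapp_ind; intros i; [rewrite !fapp_L|rewrite !fapp_R]; auto.
  apply (Fin.caseS' i); simpl; auto.
Qed.

Lemma continuous_on_coords {T} (d : T -> T -> R) K N (F : T -> Cn N) : is_metric d ->
  (forall i, scontC d K (fun x => F x i)) -> continuous_on d (dist_Cn N) K F.
Proof.
  intros Hd HF x Kx e He. apply NNPP; intros Hno.
  assert (Hc : forall n : nat, exists y, K y /\ d x y < / (INR n + 1) /\ e <= dist_Cn N (F x) (F y)).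
  { intros n. apply NNPP; intros H. apply Hno. exists (/ (INR n + 1)).
    split; [apply inv_INR_pos|]. intros y Ky Hy. apply Rnot_le_lt; intros Hle.
    apply H; exists y; auto. }
  apply choice in Hc. destruct Hc as [y Hy].
  assert (Hyx : mcv d y x) by (apply mcv_inv_INR; auto; intros n; apply Hy).
  assert (Hcv : mcv (dist_Cn N) (fun n => F (y n)) (F x)).
  { apply mcv_Cn; intros i; destruct (HF i) as [H1 H2].
    - apply H1; auto. intros n; apply Hy.
    - apply H2; auto. intros n; apply Hy. }
  destruct (mcv_elim _ _ _ Hcv e He) as [M HM]. specialize (HM M (le_n _)).
  destruct (Hy M) as [_ [_ H]]. lra.
Qed.

Lemma continuous_on_scontC {T} (d : T -> T -> R) K N (F : T -> Cn N) i :
  continuous_on d (dist_Cn N) K F -> scontC d K (fun x => F x i).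
Proof.
  intros HF. apply scontC_intro. intros x Kx e He. destruct (HF x Kx e He) as [del [Hdel H]].
  exists del. split; auto. intros y Ky Hy. eapply Rle_lt_trans; [|apply (H y Ky Hy)].
  rewrite Cabs_sub_sym. apply dist_Cn_coord.
Qed.

Lemma scontC_ext {T} (d : T -> T -> R) K (f g : T -> C) :
  (forall x, K x -> f x = g x) -> scontC d K f -> scontC d K g.
Proof.
  intros H [H1 H2]; split.
  - apply scont_ext with (fun x => Cre (f x)); auto. intros x Kx; rewrite H; auto.
  - apply scont_ext with (fun x => Cim (f x)); auto. intros x Kx; rewrite H; auto.
Qed.

Section Embedding.
Variable n : nat.
Variable K E : Rn n -> Prop.
Variable F : Rn n -> Cn 3.
Variable rho : Rn n -> R.
Let d := dist_Rn n.
Let Hd : is_metric d := dist_Rn_metric n.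
Hypothesis HK : compact_set d K.
Hypothesis HF : forall i, scontC d K (fun x => F x i).
Hypothesis Hrho : scont d K rho.
Hypothesis HEK : forall x, E x -> K x.
Hypothesis HrhoE : forall x, rho x = 0 <-> E x.
Hypothesis HFinj : forall x y, E x -> E y -> F x = F y -> x = y.

Definition Phi (x : Rn n) : Cn (n + 4) :=
  fapp n 4 (fun i => RtoC (rho x * x i)) (fcons (RtoC (rho x)) (F x)).

Lemma Phi_L x i : Phi x (Fin.L 4 i) = RtoC (rho x * x i).
Proof. unfold Phi; rewrite fapp_L; reflexivity. Qed.
Lemma Phi_rho x : Phi x (Fin.R n Fin.F1) = RtoC (rho x).
Proof. unfold Phi; rewrite fapp_R; reflexivity. Qed.
Lemma Phi_F x j : Phi x (Fin.R n (Fin.FS j)) = F x j.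
Proof. unfold Phi; rewrite fapp_R; reflexivity. Qed.

Lemma Phi_slice x : E x -> Phi x = slice (F x).
Proof.
  intros Ex. apply HrhoE in Ex. unfold Phi, slice. rewrite Ex. f_equal.
  apply functional_extensionality; intros i. rewrite Rmult_0_l; reflexivity.
Qed.

Lemma scont_proj i : scont d K (fun x => x i).
Proof.
  apply scont_intro. intros x _ e He. exists e. split; auto. intros y _ Hy.
  eapply Rle_lt_trans; [|exact Hy]. rewrite Rabs_minus_sym. apply dist_Rn_coord.
Qed.

Lemma Phi_coord_cont i : scontC d K (fun x => Phi x i).
Proof.
  revert i. apply fapp_ind; intros i.
  - apply scontC_ext with (fun x => RtoC (rho x * x i)); [intros; symmetry; apply Phi_L|].
    apply scontC_RtoC, scont_mul; auto. apply scont_proj.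
  - apply (Fin.caseS' i).
    + apply scontC_ext with (fun x => RtoC (rho x)); [intros; symmetry; apply Phi_rho|].
      apply scontC_RtoC; auto.
    + intros j. apply scontC_ext with (fun x => F x j); [intros; symmetry; apply Phi_F|]. auto.
Qed.

Lemma Phi_continuous : continuous_on d (dist_Cn (n + 4)) K Phi.
Proof. apply continuous_on_coords; auto. apply Phi_coord_cont. Qed.

(** Where rho is nonzero, x is recovered by dividing rho x by rho; where it is 0 the point lies in
    [E] and [F] determines it. *)
Lemma Phi_inj x y : Phi x = Phi y -> x = y.
Proof.
  intros H. pose proof (f_equal (fun f => f (Fin.R n Fin.F1)) H) as H0. cbv beta in H0.
  rewrite !Phi_rho in H0. apply (f_equal Cre) in H0. simpl in H0.
  destruct (Req_dec (rho x) 0) as [Z|Z].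
  - apply HFinj; [apply HrhoE; auto|apply HrhoE; lra|].
    apply functional_extensionality; intros j. rewrite <- !Phi_F, H; auto.
  - apply functional_extensionality; intros i.
    pose proof (f_equal (fun f => f (Fin.L 4 i)) H) as Hi. cbv beta in Hi.
    rewrite !Phi_L in Hi. apply (f_equal Cre) in Hi. simpl in Hi. rewrite <- H0 in Hi.
    apply Rmult_eq_reg_l with (rho x); auto.
Qed.

(** The algebra P(X) of the embedded copy, pulled back to [K]. *)
Definition PK (h : Rn n -> C) : Prop :=
  forall eps, 0 < eps -> exists p : poly (n + 4), forall x, K x -> Cabs (h x - peval p (Phi x))%Cx <= eps.

Lemma PK_poly p : PK (fun x => peval p (Phi x)).
Proof.
  intros e He. exists p. intros x _. replace (_ - _)%Cx with C0 by ring. rewrite Cabs_C0; lra.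
Qed.

Lemma PK_cont h : PK h -> scontC d K h.
Proof.
  intros Hh. apply scontC_intro. intros x Kx e He.
  destruct (Hh (e/3)) as [p Hp]; [lra|].
  destruct (scontC_eps d Hd K _ (scontC_peval d K _ Phi p Phi_coord_cont) x Kx (e/3)) as [del [Hdel H]]; [lra|].
  exists del. split; auto. intros y Ky Hy. specialize (H y Ky Hy).
  pose proof (Cabs_triang (h y) (peval p (Phi y)) (h x)). pose proof (Cabs_triang (peval p (Phi y)) (peval p (Phi x)) (h x)).
  pose proof (Hp x Kx) as H2. rewrite Cabs_sub_sym in H2. pose proof (Hp y Ky). lra.
Qed.

Lemma PK_lim h : (forall eps, 0 < eps -> exists a, PK a /\ forall x, K x -> Cabs (h x - a x)%Cx <= eps) -> PK h.
Proof.
  intros H e He. destruct (H (e/2)) as [a [Ha Hha]]; [lra|]. destruct (Ha (e/2)) as [p Hp]; [lra|].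
  exists p. intros x Kx. pose proof (Cabs_triang (h x) (a x) (peval p (Phi x))).
  specialize (Hha x Kx). specialize (Hp x Kx). lra.
Qed.

Lemma PK_add f g : PK f -> PK g -> PK (fun x => f x + g x)%Cx.
Proof.
  intros Hf Hg e He. destruct (Hf (e/2)) as [p Hp]; [lra|]. destruct (Hg (e/2)) as [q Hq]; [lra|].
  exists (PAdd p q). intros x Kx. specialize (Hp x Kx). specialize (Hq x Kx). simpl.
  replace (f x + g x - (peval p (Phi x) + peval q (Phi x)))%Cx with
    ((f x - peval p (Phi x)) + (g x - peval q (Phi x)))%Cx by ring.
  eapply Rle_trans; [apply Cabs_add|]. lra.
Qed.

Lemma scontC_bounded h : scontC d K h -> exists B, 0 < B /\ forall x, K x -> Cabs (h x) <= B.
Proof.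
  intros Hh. destruct (scont_bounded d Hd K _ (compact_cluster d Hd K HK) (scont_Cabs d K h Hh)) as [B [HB H]].
  exists B. split; auto. intros x Kx. eapply Rle_trans; [apply Rle_abs|auto].
Qed.

Lemma PK_mul f g : PK f -> PK g -> PK (fun x => f x * g x)%Cx.
Proof.
  intros Hf Hg e He.
  destruct (scontC_bounded f (PK_cont f Hf)) as [B [HB Bf]].
  destruct (scontC_bounded g (PK_cont g Hg)) as [B' [HB' Bg]].
  destruct (small_pos (e / (B + B' + 1)) 1) as [h [Hh [Hh1 _]]]; [apply Rdiv_lt_0_compat; lra|lra|].
  assert (Hh2 : h * (B + B' + 1) <= e).
  { apply Rmult_le_compat_r with (r := B + B' + 1) in Hh1; [|lra].
    unfold Rdiv in Hh1. rewrite Rmult_assoc, Rinv_l, Rmult_1_r in Hh1 by lra. auto. }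
  destruct (Hf h) as [p Hp]; [lra|]. destruct (Hg h) as [q Hq]; [lra|].
  exists (PMul p q). intros x Kx. specialize (Hp x Kx). specialize (Hq x Kx).
  specialize (Bf x Kx). specialize (Bg x Kx). simpl.
  set (a := peval p (Phi x)) in *. set (b := peval q (Phi x)) in *.
  replace (f x * g x - a * b)%Cx with
    ((- (f x - a)) * (g x - b) + (f x - a) * g x + f x * (g x - b))%Cx by ring.
  eapply Rle_trans; [apply Cabs_add|]. eapply Rle_trans; [apply Rplus_le_compat_r, Cabs_add|].
  rewrite !Cabs_mul, Cabs_opp.
  pose proof (Cabs_ge0 (f x - a)%Cx). pose proof (Cabs_ge0 (g x - b)%Cx).
  pose proof (Cabs_ge0 (f x)). pose proof (Cabs_ge0 (g x)).
  assert (Cabs (f x - a)%Cx * Cabs (g x - b)%Cx <= h * 1) by (apply Rmult_le_compat; lra).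
  assert (Cabs (f x - a)%Cx * Cabs (g x) <= h * B') by (apply Rmult_le_compat; lra).
  assert (Cabs (f x) * Cabs (g x - b)%Cx <= B * h) by (apply Rmult_le_compat; lra).
  lra.
Qed.

Lemma PK_ext f g : (forall x, f x = g x) -> PK f -> PK g.
Proof. intros H Hf. replace g with f; auto. apply functional_extensionality; auto. Qed.

Lemma PK_const c : PK (fun _ => c).
Proof. apply (PK_poly (PConst c)). Qed.

(** The coordinates rho and rho x_i are real and separate any two points not both in [E], while f is
    constant on [E]; so the real functions in the algebra interpolate f at every pair of points. *)
Lemma PK_vanishing_real f : scont d K f -> (forall x, E x -> f x = 0) -> PK (fun x => RtoC (f x)).
Proof.
  intros Hf HfE.
  assert (Aconst : forall c : R, PK (fun _ => RtoC c)) by (intros; apply PK_const).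
  assert (Aadd : forall a b, PK (fun x => RtoC (a x)) -> PK (fun x => RtoC (b x)) -> PK (fun x => RtoC (a x + b x))).
  { intros a b Ha Hb. apply PK_ext with (fun x => RtoC (a x) + RtoC (b x))%Cx.
    - intros; apply C_ext; simpl; ring.
    - apply PK_add; auto. }
  assert (Amul : forall a b, PK (fun x => RtoC (a x)) -> PK (fun x => RtoC (b x)) -> PK (fun x => RtoC (a x * b x))).
  { intros a b Ha Hb. apply PK_ext with (fun x => RtoC (a x) * RtoC (b x))%Cx.
    - intros; apply C_ext; simpl; ring.
    - apply PK_mul; auto. }
  apply (stone_weierstrass d Hd K (fun a => PK (fun x => RtoC (a x))) HK Aconst Aadd Amul); auto.
  - intros h Hh. apply PK_lim. intros e He. destruct (Hh e He) as [a [Ha Hha]].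
    exists (fun x => RtoC (a x)). split; auto. intros x Kx.
    replace (RtoC (h x) - RtoC (a x))%Cx with (RtoC (h x - a x)) by (apply C_ext; simpl; ring).
    rewrite Cabs_RtoC; auto.
  - intros a Ha. apply PK_cont in Ha. apply Ha.
  - intros x y Kx Ky. destruct (Req_dec (f x) (f y)) as [Ef|Ef].
    + exists (fun _ => f x). split; [apply Aconst|auto].
    + assert (Hsep : exists c : Rn n -> R, PK (fun z => RtoC (c z)) /\ c x <> c y).
      { destruct (Req_dec (rho x) (rho y)) as [Er|Er].
        - assert (Hr : rho x <> 0).
          { intros Z. apply Ef. rewrite (HfE x), (HfE y); auto; apply HrhoE; lra. }
          assert (Hi : exists i, x i <> y i).
          { apply NNPP; intros Hno. apply Ef. f_equal. apply functional_extensionality; intros i.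
            apply NNPP; intros Hxi. apply Hno; eauto. }
          destruct Hi as [i Hi]. exists (fun z => rho z * z i). split.
          + apply PK_ext with (fun z => peval (PVar (Fin.L 4 i)) (Phi z)); [intros; apply Phi_L|apply PK_poly].
          + rewrite <- Er. intros H. apply Hi. apply Rmult_eq_reg_l with (rho x); auto.
        - exists rho. split; auto.
          apply PK_ext with (fun z => peval (PVar (Fin.R n Fin.F1)) (Phi z)); [intros; apply Phi_rho|apply PK_poly]. }
      destruct Hsep as [c [Hc Hcxy]].
      exists (fun z => f x + (f y - f x) / (c y - c x) * (c z + - c x)). split; [|split].
      * apply Aadd; auto.
      * ring.
      * field. lra.
Qed.

Lemma PK_vanishing h : scontC d K h -> (forall x, E x -> h x = C0) -> PK h.
Proof.
  intros [H1 H2] HE.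
  apply PK_ext with (fun x => RtoC (Cre (h x)) + mkC 0 1 * RtoC (Cim (h x)))%Cx.
  - intros x; apply C_ext; simpl; ring.
  - apply PK_add; [|apply PK_mul; [apply PK_const|]]; apply PK_vanishing_real; auto;
    intros x Ex; rewrite HE; auto.
Qed.

Lemma peval_lift (p : poly 3) x : peval (lift p) (Phi x) = peval p (F x).
Proof.
  unfold lift. rewrite peval_psubst. f_equal. apply functional_extensionality; intros j. apply Phi_F.
Qed.

(** The difference h - p(F) is small on [E], hence uniformly close to a function that vanishes
    there, and [PK_vanishing] covers the latter. *)
Lemma PK_of_restriction h : scontC d K h ->
  (forall eps, 0 < eps -> exists p : poly 3, forall x, E x -> Cabs (h x - peval p (F x))%Cx <= eps) -> PK h.
Proof.
  intros Hh HE. apply PK_lim. intros e He. destruct (HE (e/2)) as [p Hp]; [lra|].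
  set (k := fun x => (h x - peval p (F x))%Cx).
  assert (Hk : scontC d K k) by (apply scontC_sub; auto; apply scontC_peval; auto).
  (* The cutoff is 0 where |k| <= e/2, hence on [E], and 1 where |k| >= e, so chi k differs from k
     by at most e. *)
  set (chi := fun x => Rmax 0 (Rmin 1 ((Cabs (k x) - e / 2) * / (e / 2)))).
  assert (Hie : 0 < / (e / 2)) by (apply Rinv_0_lt_compat; lra).
  assert (Hchi : forall x, 0 <= chi x <= 1).
  { intros x. unfold chi. split; [apply Rmax_l|]. apply Rmax_lub; [lra|apply Rmin_l]. }
  exists (fun x => peval p (F x) + RtoC (chi x) * k x)%Cx. split.
  - apply PK_add.
    + apply PK_ext with (fun x => peval (lift p) (Phi x)); [apply peval_lift|apply PK_poly].
    + apply PK_vanishing.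
      * apply scontC_mul; auto. apply scontC_RtoC. unfold chi.
        apply scont_max; [apply scont_const|]. apply scont_min; [apply scont_const|].
        apply scont_mul; [|apply scont_const]. apply scont_sub; [|apply scont_const]. apply scont_Cabs; auto.
      * intros x Ex. specialize (Hp x Ex). fold (k x) in Hp. assert (chi x = 0) as ->.
        { unfold chi. assert ((Cabs (k x) - e / 2) * / (e / 2) <= 0) by nra.
          rewrite Rmin_right, Rmax_left; lra. }
        apply C_ext; simpl; ring.
  - intros x Kx.
    replace (h x - (peval p (F x) + RtoC (chi x) * k x))%Cx with (RtoC (1 - chi x) * k x)%Cx
      by (unfold k; apply C_ext; simpl; ring).
    specialize (Hchi x). rewrite Cabs_mul, Cabs_RtoC, Rabs_right by lra.
    pose proof (Cabs_ge0 (k x)).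
    destruct (Rle_lt_dec (Cabs (k x)) e) as [Hx|Hx]; [nra|].
    assert (chi x = 1) as ->; [|lra].
    unfold chi. assert (1 <= (Cabs (k x) - e / 2) * / (e / 2)).
    { apply Rmult_le_reg_r with (e/2); [lra|]. rewrite Rmult_assoc, Rinv_l by lra. lra. }
    rewrite Rmin_left, Rmax_right; lra.
Qed.

Definition image (w : Cn (n + 4)) : Prop := exists x, K x /\ w = Phi x.

Variable Psi : Cn (n + 4) -> Rn n.
Hypothesis HPsi : forall x, K x -> Psi (Phi x) = x.

Lemma in_PX_of_PK h : PK h -> in_PX image (fun w => h (Psi w)).
Proof.
  intros Hh e He. destruct (Hh e He) as [p Hp]. exists p. intros w [x [Kx ->]]. rewrite HPsi; auto.
Qed.

Variable X : Cn 3 -> Prop.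
Hypothesis HXJ : forall z, X z -> J z.
Hypothesis HFE : forall x, E x -> X (F x).
Hypothesis Hdense : forall (p : poly 3) M e, 0 < e -> exists p' : poly 3, approx_inv X p' /\
    forall z, bounded_by M z -> Cabs (peval p' z - peval p z)%Cx <= e.
Hypothesis Hdim : covering_dim_le1 d K.

Lemma image_dense_invertibles : PX_dense_invertibles image.
Proof.
  intros f Hf eps Heps.
  destruct (Hf (eps/3)) as [p Hp]; [lra|].
  assert (HM : exists M, forall x, K x -> bounded_by M (F x)).
  { destruct (scontC_bounded _ (HF i1)) as [B1 [_ H1]]. destruct (scontC_bounded _ (HF i2)) as [B2 [_ H2]].
    destruct (scontC_bounded _ (HF i3)) as [B3 [_ H3]]. exists (Rmax B1 (Rmax B2 B3)). intros x Kx.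
    specialize (H1 x Kx). specialize (H2 x Kx). specialize (H3 x Kx).
    pose proof (Rmax_l B1 (Rmax B2 B3)). pose proof (Rmax_r B1 (Rmax B2 B3)).
    pose proof (Rmax_l B2 B3). pose proof (Rmax_r B2 B3).
    unfold bounded_by. apply fin3_ind; lra. }
  destruct HM as [M HM].
  destruct (Hdense (restr p) M (eps/3)) as [p' [Hinv Hp']]; [lra|].
  (* Changes p(Phi) by at most eps/3 on all of [K], so that on [E], where p(Phi) and (restr p)(F)
     agree, it becomes the approximately invertible p'(F). *)
  set (g1 := fun x => (peval p (Phi x) + (peval p' (F x) - peval (restr p) (F x)))%Cx).
  assert (Hg1 : scontC d K g1).
  { apply scontC_add; [apply scontC_peval, Phi_coord_cont|].
    apply scontC_sub; apply scontC_peval; auto. }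
  assert (Hg1E : forall x, E x -> g1 x = peval p' (F x)).
  { intros x Ex. unfold g1. rewrite peval_restr, <- Phi_slice by auto. ring. }
  assert (Hc : exists c, 0 < c /\ forall x, E x -> c <= Cabs (peval p' (F x))).
  (* If |1 - p' h| <= 1/2 and |h| <= B, then |p'| >= 1/(2(B+1)). *)
  { destruct (Hinv (1/2)) as [h Hh]; [lra|]. destruct (poly_bounded h 1) as [B [HB Hb]].
    exists (/ (2 * (B + 1))). split; [apply Rinv_0_lt_compat; lra|]. intros x Ex.
    specialize (Hh _ (HFE x Ex)). specialize (Hb _ (J_bounded _ (HXJ _ (HFE x Ex)))).
    pose proof (Cabs_sub_le C1 (peval p' (F x) * peval h (F x))%Cx) as HT. rewrite Cabs_C1, Cabs_mul in HT.
    pose proof (Cabs_ge0 (peval p' (F x))) as H0.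
    apply Rmult_le_reg_r with (2 * (B + 1)); [lra|]. rewrite Rinv_l by lra. nra. }
  destruct Hc as [c [Hc0 Hc]].
  destruct (nonvanishing_approx_rel d Hd K HK Hdim E g1 c (eps/3) Hg1) as [g [Hg [Hgn HgE]]]; auto; [lra| |].
  { intros x Ex. rewrite Hg1E; auto. }
  assert (PKg : PK g).
  { apply PK_of_restriction; auto. intros e He. exists p'. intros x Ex. rewrite HgE, Hg1E by auto.
    replace (_ - _)%Cx with C0 by ring. rewrite Cabs_C0; lra. }
  assert (PKi : PK (fun x => Cinv (g x))).
  { apply PK_of_restriction.
    - apply scontC_inv; auto. intros x Kx; apply Hgn; auto.
    (* The tolerance is c e because 1/p' - h = (1 - p' h)/p' and |p'| >= c on [E]. *)
    - intros e He. destruct (Hinv (c * e)) as [h Hh]; [nra|]. exists h. intros x Ex.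
      rewrite HgE, Hg1E by auto. specialize (Hh _ (HFE x Ex)). specialize (Hc x Ex).
      assert (Hnz : peval p' (F x) <> C0) by (intros Z; rewrite Z, Cabs_C0 in Hc; lra).
      assert (Heq : (Cinv (peval p' (F x)) - peval h (F x))%Cx =
         (Cinv (peval p' (F x)) * (C1 - peval p' (F x) * peval h (F x)))%Cx) by (field; auto).
      rewrite Heq, Cabs_mul, Cabs_inv by auto.
      apply Rmult_le_reg_l with (Cabs (peval p' (F x))); [lra|].
      rewrite <- Rmult_assoc, Rinv_r by lra. nra. }
  exists (fun w => g (Psi w)). split; [apply in_PX_of_PK; auto|]. split.
  - exists (fun w => Cinv (g (Psi w))). split; [apply (in_PX_of_PK (fun x => Cinv (g x))); auto|].
    intros w [x [Kx ->]]. rewrite HPsi by auto. field. apply Hgn; auto.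
  - intros w [x [Kx ->]]. rewrite HPsi by auto.
    specialize (Hp (Phi x) ltac:(exists x; auto)). destruct (Hgn x Kx) as [_ G].
    specialize (Hp' (F x) (HM x Kx)).
    pose proof (Cabs_triang (f (Phi x)) (peval p (Phi x)) (g x)) as T1.
    pose proof (Cabs_triang (peval p (Phi x)) (g1 x) (g x)) as T2.
    rewrite (Cabs_sub_sym (g1 x)) in T2.
    assert (T3 : Cabs (peval p (Phi x) - g1 x)%Cx = Cabs (peval p' (F x) - peval (restr p) (F x))%Cx).
    { rewrite Cabs_sub_sym. f_equal. unfold g1. ring. }
    lra.
Qed.

End Embedding.

(** * Assembly: the embedded copy of [K], its hull and its algebra *)

Theorem theorem1p5 (n : nat) (K : Rn n -> Prop) :
  uncountable K ->
  compact_set (@dist_Rn n) K ->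
  covering_dim_le1 (@dist_Rn n) K ->
  exists X : Cn (n + 4) -> Prop,
    homeomorphic (@dist_Rn n) (@dist_Cn (n + 4)) K X /\
    (exists z, poly_hull X z /\ ~ X z) /\
    PX_dense_invertibles X.
Proof.
  intros Hunc HK Hdim.
  pose proof (dist_Rn_metric n) as Hd.
  destruct dense_inv_subset as [X [HXJ [HXc [Hhull Hdense]]]].
  assert (HXne : exists z, X z).
  (* On an empty set every real number is an upper bound, so the constant 1 tested against -1 shows
     that its hull is empty. *)
  { apply NNPP; intros Hno. specialize (Hhull (PConst C1) (-1)). simpl in Hhull. rewrite Cabs_C1 in Hhull.
    assert (1 <= -1); [|lra]. apply Hhull. intros x Xx; exfalso; eauto. }
  destruct (zero_dim_embeds (dist_Rn n) (dist_Cn 3) K X jbit Hd (dist_Cn_metric 3)) as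
    [E [g [HEK [HEc [HgX [Hgsurj [Hginj Hgcont]]]]]]]; auto.
  { exact (inhabits (fun _ => 0)). }
  { intros z z' Xz Xz' H. apply jbit_inj; auto. }
  { intros i z Xz. destruct (jbit_loc i z (HXJ z Xz)) as [del [Hdel H]]. exists del. split; auto. }
  assert (HEne : exists e, E e).
  { destruct HXne as [z Xz]. destruct (Hgsurj z Xz) as [x [Ex _]]. eauto. }
  assert (HFex : forall i, exists f : Rn n -> C, scontC (dist_Rn n) K f /\ forall x, E x -> f x = g x i).
  { intros i. destruct (continuous_on_scontC (dist_Rn n) E 3 g i Hgcont) as [C1' C2'].
    destruct (tietze (dist_Rn n) Hd E HEc HEne _ K C1') as [a [Ha1 Ha2]].
    destruct (tietze (dist_Rn n) Hd E HEc HEne _ K C2') as [b [Hb1 Hb2]].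
    exists (fun x => mkC (a x) (b x)). split; [split; simpl; auto|].
    intros x Ex. apply C_ext; simpl; auto. }
  apply choice in HFex. destruct HFex as [F' HF'].
  set (F := fun x i => F' i x).
  assert (HFg : forall x, E x -> F x = g x).
  { intros x Ex. apply functional_extensionality; intros i. apply HF'; auto. }
  destruct (dist_fun_exists (dist_Rn n) Hd E HEc HEne) as [rho [_ [RL [_ [RZ _]]]]].
  assert (Hrho : scont (dist_Rn n) K rho).
  { apply scont_intro. intros x _ e He. exists e. split; auto. intros y _ Hy.
    eapply Rle_lt_trans; [apply RL|]. rewrite (met_sym _ Hd). auto. }
  assert (HF : forall i, scontC (dist_Rn n) K (fun x => F x i)) by (intros i; apply HF').
  assert (HFinj : forall x y, E x -> E y -> F x = F y -> x = y).
  { intros x y Ex Ey H. rewrite !HFg in H by auto. auto. }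
  assert (HPhi_inj : forall x y, Phi n F rho x = Phi n F rho y -> x = y) by (intros; eapply Phi_inj; eauto).
  assert (HPsi : forall w, exists x, image n K F rho w -> K x /\ w = Phi n F rho x).
  { intros w. destruct (classic (image n K F rho w)) as [[x Hx]|H]; [exists x; auto|].
    exists (fun _ => 0). tauto. }
  apply choice in HPsi. destruct HPsi as [Psi HPsi].
  assert (HPsi1 : forall x, K x -> Psi (Phi n F rho x) = x).
  { intros x Kx. symmetry. apply HPhi_inj. apply HPsi. exists x; auto. }
  assert (HPc := Phi_continuous n K F rho HF Hrho).
  exists (image n K F rho). split; [|split].
  - exists (Phi n F rho), Psi. split; [intros x Kx; exists x; auto|].
    split; [intros y Hy; apply HPsi; auto|]. split; [auto|].
    split; [intros y Hy; symmetry; apply HPsi; auto|]. split; [exact HPc|].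
    apply (inverse_continuous (dist_Rn n) (dist_Cn (n + 4)) K _ (Phi n F rho)); auto.
    + apply dist_Cn_metric.
    + apply compact_cluster; auto.
    + intros y Hy; apply HPsi; auto.
    + intros y Hy; symmetry; apply HPsi; auto.
  (* The hull point is the origin. It is in the hull already of the image of [E], where polynomials
     reduce to polynomials on [X]; it is not in the image, since rho x = 0 and F x = 0 would put 0
     into [J]. *)
  - exists (slice zero3). split.
    + intros p M HM. rewrite <- peval_restr. apply Hhull. intros z Xz.
      destruct (Hgsurj z Xz) as [x [Ex <-]]. rewrite peval_restr, <- HFg by auto.
      rewrite <- (Phi_slice n E F rho RZ x Ex). apply HM. exists x; auto.
    + intros [x [Kx Hx]].
      assert (Ex : E x).
      { apply RZ. pose proof (f_equal (fun f => f (Fin.R n Fin.F1)) Hx) as H. cbv beta in H.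
        rewrite Phi_rho in H. unfold slice in H. rewrite fapp_R in H. apply (f_equal Cre) in H. simpl in H. auto. }
      assert (HF0 : F x = zero3).
      { apply functional_extensionality; intros j. rewrite <- (Phi_F n F rho), <- Hx. unfold slice. rewrite fapp_R.
        reflexivity. }
      apply J_not_origin. rewrite <- HF0. apply HXJ. rewrite HFg; auto.
  - apply (image_dense_invertibles n K E F rho HK HF Hrho HEK RZ Psi HPsi1 X HXJ); auto.
    intros x Ex. rewrite HFg; auto.
Qed.
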